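(* Let $A$ be a ring with $\mu_2(A)=\{\pm1\}$ such that the inclusion $T(A)\hookrightarrow B(A)$ induces isomorphisms $H_i(T(A),\mathbb{Z})\simeq H_i(B(A),\mathbb{Z})$ for $i\leq 3$, and such that $H_1(\mathrm{SL}_2(A),\mathbb{Z})=0$. (i) If $A$ is a $\mathrm{GE}_2$-ring, then $H_2(\mathrm{SL}_2(A),T(A);\mathbb{Z})\simeq K_1^{\mathrm{MW}}(A)$. (ii) If $A$ is a universal $\mathrm{GE}_2$-ring, then $H_3(\mathrm{SL}_2(A),T(A);\mathbb{Z}[\tfrac12])\simeq \mathcal{RP}_1(A)[\tfrac12]$.
   Context: Rings are commutative with $1$. $A^\times$ is the unit group, $\mu_2(A)=\{a\in A^\times: a^2=1\}$, $\mathcal{G}_A=A^\times/(A^\times)^2$, $\langle a\rangle$ is the class of $a\in A^\times$, and $\langle\!\langle a\rangle\!\rangle=\langle a\rangle-1\in\mathbb{Z}[\mathcal{G}_A]$. $T(A)$ (identified with $A^\times$) is the group of diagonal matrices in $\mathrm{SL}_2(A)$, and $B(A)$ the group of upper triangular matrices in $\mathrm{SL}_2(A)$. $H_n(G,G';\cdot)$ is the usual relative group homology for a subgroup $G'\le G$. For an abelian group $M$, $M[\tfrac12]=M\otimes\mathbb{Z}[\tfrac12]$. For $x\in A$ let $E(x)=\begin{pmatrix}x&1\\-1&0\end{pmatrix}$. $A$ is a $\mathrm{GE}_2$-ring if $\mathrm{SL}_2(A)$ is generated by elementary matrices (equivalently by the $E(x)$). It is a universal $\mathrm{GE}_2$-ring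 if $\mathrm{SL}_2(A)$ is generated by the $E(x)$, $x\in A$, with the following complete set of defining relations ($x,y\in A$, $a,b\in A^\times$): $E(x)E(0)E(y)=D(-1)E(x+y)$; $E(x)D(a)=D(a^{-1})E(a^2x)$; $D(a)D(b)=D(ab)$, where $D(a):=E(-a)E(-a^{-1})E(-a)$. A column vector $u\in A^2$ is unimodular if it is the first column of some matrix in $\mathrm{GL}_2(A)$; $\langle u\rangle=uA$. $X_n(A^2)$ is the free abelian group on all $(n+1)$-tuples $(\langle v_0\rangle,\dots,\langle v_n\rangle)$ with every $v_i$ unimodular and the matrix $(v_i,v_j)$ invertible for $i\neq j$; $\mathrm{GL}_2(A)$ acts by left multiplication; $\partial_n:X_n(A^2)\to X_{n-1}(A^2)$ is the alternating sum of the maps omitting the $i$-th entry; $Z_i(A^2)=\ker\partial_i$, $i=1,2$. Put $\pmb\infty=\langle e_1\rangle$, $\pmb 0=\langle e_2\rangle$, $\pmb a=\langle e_1+ae_2\rangle$ for $a\in A^\times$. $X_2(A^2)_{\mathrm{SL}_2(A)}$ is identified with $\mathbb{Z}[\mathcal{G}_A]$ by $(\pmb\infty,\pmb 0,\pmb a)\leftrightarrow\langle a\rangle$. $\mathcal{RP}(A)=H_0(\mathrm{SL}_2(A),Z_2(A^2))$ and $\mathcal{RP}_1(A)=\ker(\mathcal{RP}(A)\to\mathbb{Z}[\mathcal{G}_A])$, the map being induced by the inclusion $Z_2(A^2)\subseteq X_2(A^2)$. $\mathrm{GW}(A)=H_0(\mathrm{SL}_2(A),Z_1(A^2))$, and the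 fundamental ideal $I(A)$ is the kernel of $\mathrm{GW}(A)\to H_0(\mathrm{SL}_2(A),X_1(A^2))\simeq\mathbb{Z}$ (induced by inclusion). The map $\partial_2$ induces $\mathbb{Z}[\mathcal{G}_A]=X_2(A^2)_{\mathrm{SL}_2(A)}\to\mathrm{GW}(A)$, carrying $\langle\!\langle a\rangle\!\rangle$ into $I(A)$. When $A$ is a $\mathrm{GE}_2$-ring, $0\to Z_1(A^2)\to X_1(A^2)\to X_0(A^2)\to0$ is a resolution of $\mathbb{Z}$ and gives a spectral sequence converging to $H_{p+q}(\mathrm{SL}_2(A),\mathbb{Z})$ with $E^1_{p,q}=H_q(\mathrm{SL}_2(A),X_p(A^2))$ for $p=0,1$, $E^1_{2,q}=H_q(\mathrm{SL}_2(A),Z_1(A^2))$ and $E^1_{p,q}=0$ for $p>2$; if $A$ is a $\mathrm{GE}_2$-ring with $\mu_2(A)=\{\pm1\}$ such that the inclusion $T(A)\hookrightarrow B(A)$ induces isomorphisms $H_i(T(A),\mathbb{Z})\simeq H_i(B(A),\mathbb{Z})$ for $i\leq 3$ and such that $H_1(\mathrm{SL}_2(A),\mathbb{Z})=0$, then $E^2_{2,0}=I(A)$, $E^2_{0,1}=\mathcal{G}_A$, and $d^2_{2,0}:I(A)\to\mathcal{G}_A$ sends $\langle\!\langle a\rangle\!\rangle$ to $\langle a\rangle$. $I^2(A)$ denotes $\ker(d^2_{2,0})$; when $A$ is a universal $\mathrm{GE}_2$-ring, $\mathrm{GW}(A)$ is a quotient ring of $\mathbb{Z}[\mathcal{G}_A]$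 and $I^2(A)$ is the square of the ideal $I(A)$. Thus $I(A)/I^2(A)\simeq\mathcal{G}_A$. With $K_1^M(A)=A^\times$, the first Milnor--Witt $K$-group $K_1^{\mathrm{MW}}(A)$ is the fibre product $K_1^M(A)\times_{I(A)/I^2(A)}I(A)$ of the map $A^\times\to I(A)/I^2(A)$, $a\mapsto\langle\!\langle a\rangle\!\rangle$ mod $I^2(A)$, and the projection $I(A)\to I(A)/I^2(A)$. *)

(* Defs.v *)
From HB Require Import structures.
From mathcomp Require Import all_boot all_order all_algebra.
From mathcomp Require Import boolp classical_sets.
From mathcomp Require Import finmap monalg zify ring.

Set Implicit Arguments.
Unset Strict Implicit.
Unset Printing Implicit Defensive.

Import GRing.Theory.
Local Open Scope ring_scope.
Local Open Scope quotient_scope.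

Definition Additive (U V : zmodType) (f : U -> V) (fB : zmod_morphism f) :
    {additive U -> V} :=
  HB.pack f (GRing.isZmodMorphism.Build U V f fB).

Definition isomorphic (U V : zmodType) : Prop :=
  exists f : {additive U -> V}, bijective f.

Section Span.
Variables (V : zmodType) (S : set V).

Inductive in_zspan : V -> Prop :=
| zspan_gen v of S v : in_zspan v
| zspan0 : in_zspan 0
| zspanB u v of in_zspan u & in_zspan v : in_zspan (u - v).

Definition zspan : {pred V} := fun v => `[< in_zspan v >].

Lemma zspanP v : reflect (in_zspan v) (v \in zspan).
Proof. exact: asboolP. Qed.

Fact zspan_closed : zmod_closed zspan.
Proof.
split=> [|u v /zspanP uS /zspanP vS]; apply/zspanP; first exact: zspan0.
exact: zspanB.
Qed.
HB.instance Definition _ := GRing.isZmodClosed.Build V zspan zspan_closed.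

End Span.

(* The quotient of V by the subgroup generated by S : set V *)
Notation "{ 'quotz' S }" := (@Quotient.quot _ (zspan S))
  (at level 0, format "{ 'quotz'  S }") : type_scope.

Definition qpi (V : zmodType) (S : set V) : {additive V -> {quotz S}} :=
  \pi_({quotz S}).

Lemma quot_eq (V : zmodType) (S : set V) (u v : V) :
  (qpi S u == qpi S v) = (u - v \in zspan S).
Proof. by rewrite Quotient.idealrBE. Qed.

Lemma repr_qpi (V : zmodType) (S : set V) (x : {quotz S}) : qpi S (repr x) = x.
Proof. exact: reprK. Qed.

Section QuotMap.
Variables (U V : zmodType) (S : set U) (T : set V) (f : {additive U -> V}).
Hypothesis fS : forall u, S u -> f u \in zspan T.

Lemma quot_map_span u : u \in zspan S -> f u \in zspan T.
Proof.
move/zspanP; elim=> [v /fS //||v w _ fv _ fw]; first by rewrite raddf0 rpred0.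
by rewrite raddfB rpredB.
Qed.

Definition quot_map_fun (x : {quotz S}) : {quotz T} :=
  qpi T (f (repr x)).

Lemma quot_map_pi u : quot_map_fun (qpi S u) = qpi T (f u).
Proof.
apply/eqP; rewrite quot_eq -raddfB quot_map_span // -quot_eq.
by rewrite repr_qpi.
Qed.

Fact quot_map_zmod_morphism : zmod_morphism quot_map_fun.
Proof.
move=> x y; rewrite -[x]repr_qpi -[y]repr_qpi -raddfB !quot_map_pi.
by rewrite !raddfB.
Qed.

Definition quot_map : {additive {quotz S} -> {quotz T}} :=
  Additive quot_map_zmod_morphism.

Lemma quot_mapE u : quot_map (qpi S u) = qpi T (f u).
Proof. exact: quot_map_pi. Qed.

End QuotMap.

Section Kernel.
Variables (U V : zmodType) (f : {additive U -> V}).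

Definition kerb : {pred U} := fun u => f u == 0.

Fact kerb_closed : zmod_closed kerb.
Proof.
split=> [|u v]; rewrite !unfold_in ?raddf0 // => /eqP fu /eqP fv.
by rewrite /kerb raddfB fu fv subrr.
Qed.
HB.instance Definition _ := GRing.isZmodClosed.Build U kerb kerb_closed.

Definition ker := {u : U | u \in kerb}.
HB.instance Definition _ := Choice.on ker.
HB.instance Definition _ := SubChoice.on ker.
HB.instance Definition _ := [SubChoice_isSubZmodule of ker by <:].

Lemma kerP (x : ker) : f (val x) = 0.
Proof. exact/eqP/(valP x). Qed.

Definition in_ker (u : U) (fu : f u = 0) : ker := exist _ u (introT eqP fu).

Definition ker_incl : {additive ker -> U} := val.

End Kernel.

Section KerMap.
Variables (U V U' V' : zmodType).
Variables (f : {additive U -> V}) (f' : {additive U' -> V'}).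
Variable h : {additive U -> U'}.
Hypothesis hP : forall u, f u = 0 -> f' (h u) = 0.

Definition ker_map_fun (x : ker f) : ker f' := in_ker (hP (kerP x)).

Fact ker_map_zmod_morphism : zmod_morphism ker_map_fun.
Proof. by move=> x y; apply/val_inj; rewrite /= !raddfB. Qed.

Definition ker_map : {additive ker f -> ker f'} := Additive ker_map_zmod_morphism.

End KerMap.

Section FibreProduct.
Variables (U V Q : zmodType) (f : {additive U -> Q}) (g : {additive V -> Q}).

Definition fibpred : {pred U * V} := fun p => f p.1 == g p.2.

Fact fibpred_closed : zmod_closed fibpred.
Proof.
split=> [|p q]; rewrite !unfold_in /fibpred /= ?raddf0 // => /eqP fp /eqP fq.
by rewrite !raddfB /= fp fq.
Qed.
HB.instance Definition _ := GRing.isZmodClosed.Build (U * V)%type fibpred fibpred_closed.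

Definition fibprod := {p : U * V | p \in fibpred}.
HB.instance Definition _ := SubChoice.on fibprod.
HB.instance Definition _ := [SubChoice_isSubZmodule of fibprod by <:].

End FibreProduct.

Lemma alt_sum_sum (V : zmodType) (N : nat) (F : 'I_N -> 'I_N.+1 -> V) :
    (forall i j : 'I_N, (i <= j)%N ->
       F i (lift ord0 j) = F j (widen_ord (leqnSn N) i)) ->
  \sum_(j < N.+1) (\sum_(i < N) F i j *~ (-1) ^+ i) *~ (-1) ^+ j = 0.
Proof.
move=> FE; under eq_bigr do rewrite mulrz_suml.
rewrite exchange_big /=.
pose G (i : 'I_N) (j : 'I_N.+1) := F i j *~ (-1) ^+ i *~ (-1) ^+ j.
rewrite -[LHS]/(\sum_i \sum_j G i j).
have -> : \sum_i \sum_j G i j =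
    \sum_(i < N) \sum_(j < N | (j <= i)%N) G i (widen_ord (leqnSn N) j)
    + \sum_(i < N) \sum_(j < N | (i <= j)%N) G i (lift ord0 j).
  rewrite -big_split; apply: eq_bigr => i _ /=.
  rewrite (bigID (fun j : 'I_N.+1 => (j <= i)%N)) /=; congr (_ + _).
    by rewrite big_mkcond big_ord_recr /= leqNgt ltn_ord /= addr0 -big_mkcond.
  rewrite big_mkcond big_ord_recl /= add0r -big_mkcond.
  by apply: eq_bigl => j; rewrite -ltnNge.
rewrite [X in X + _](exchange_big_dep xpredT) //= -big_split big1 // => i _ /=.
rewrite -big_split big1 //= => j le_ij.
rewrite /G FE // /bump /= exprS mulN1r mulrNz.
by rewrite -!mulrzA [_ ^+ j * _ ^+ i]mulrC addrC addNr.
Qed.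

(* The group [{malg M[K]}] of finitely supported functions from K to M is
   M (x) Z[K], with m (x) k written [<< m *g k >>]. *)
Section MalgLift.
Variables (K : choiceType) (M N : zmodType) (F : K -> {additive M -> N}).

Definition malg_lift_fun (c : {malg M[K]}) : N :=
  \sum_(k <- msupp c) F k (c@_k).

Lemma malg_liftEw (D : {fset K}) c : (msupp c `<=` D)%fset ->
  malg_lift_fun c = \sum_(k <- D) F k (c@_k).
Proof.
move=> sD; rewrite /malg_lift_fun [RHS](big_fsetID _ (mem (msupp c))) /=.
rewrite [X in _ = _ + X]big1_fset ?addr0; last first.
  by move=> k; rewrite !inE => /andP[_ /mcoeff_outdom ->] _; rewrite raddf0.
apply: eq_fbigl => k; rewrite !inE andbC; case: (boolP (k \in msupp c)) => //=.
by move/(fsubsetP sD) => ->.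
Qed.

Fact malg_lift_zmod_morphism : zmod_morphism malg_lift_fun.
Proof.
move=> c d; pose D := (msupp c `|` msupp d)%fset.
rewrite (@malg_liftEw D (c - d)) ?msuppB_le // (@malg_liftEw D c) ?fsubsetUl //.
rewrite (@malg_liftEw D d) ?fsubsetUr // -sumrB.
by apply: eq_bigr => k _; rewrite mcoeffB raddfB.
Qed.

Definition malg_lift : {additive {malg M[K]} -> N} :=
  Additive malg_lift_zmod_morphism.

Lemma malg_liftU m k : malg_lift << m *g k >> = F k m.
Proof.
rewrite /= (@malg_liftEw [fset k]%fset) ?msuppU_le //.
by rewrite big_seq_fset1 mcoeffUU.
Qed.

End MalgLift.

Lemma malg_ext (K : choiceType) (M N : zmodType)
    (f h : {additive {malg M[K]} -> N}) :
  (forall m k, f << m *g k >> = h << m *g k >>) -> f =1 h.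
Proof.
by move=> fh c; rewrite [c]monalgE !raddf_sum; apply: eq_bigr => k _; apply: fh.
Qed.

Section MalgMap.
Variables (M : zmodType).

Definition malg_map (K L : choiceType) (h : K -> L) :
    {additive {malg M[K]} -> {malg M[L]}} :=
  malg_lift (fun k => mkmalgU (h k)).

Lemma malg_mapU (K L : choiceType) (h : K -> L) m k :
  malg_map h << m *g k >> = << m *g h k >>.
Proof. exact: malg_liftU. Qed.

Lemma malg_map_id (K : choiceType) (h : K -> K) c : h =1 id -> malg_map h c = c.
Proof.
move=> h1; apply: (malg_ext (f := malg_map h) (h := idfun)) => m k.
by rewrite malg_mapU h1.
Qed.

Lemma malg_map_comp (K L P : choiceType) (h : L -> P) (g : K -> L) (e : K -> P) c :
  h \o g =1 e -> malg_map h (malg_map g c) = malg_map e c.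
Proof.
move=> hg; apply: (malg_ext (f := malg_map h \o malg_map g) (h := malg_map e)).
move=> m k; rewrite -[LHS]/(malg_map h (malg_map g << m *g k >>)).
by rewrite !malg_mapU -hg.
Qed.

(* \sum_i (-1)^i d_i *)
Definition malg_alt_fun (K L : choiceType) n (d : 'I_n -> K -> L) (c : {malg M[K]}) :
    {malg M[L]} := \sum_(i < n) malg_map (d i) c *~ (-1) ^+ i.

Fact malg_alt_zmod_morphism (K L : choiceType) n (d : 'I_n -> K -> L) :
  zmod_morphism (malg_alt_fun d).
Proof.
move=> x y; rewrite /malg_alt_fun -sumrB; apply: eq_bigr => i _.
by rewrite raddfB mulrzBl.
Qed.

Definition malg_alt (K L : choiceType) n (d : 'I_n -> K -> L) :
    {additive {malg M[K]} -> {malg M[L]}} :=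
  Additive (malg_alt_zmod_morphism d).

Lemma malg_alt_map (K L K' L' : choiceType) n (d : 'I_n -> K -> L)
    (d' : 'I_n -> K' -> L') (h : K -> K') (h' : L -> L') c :
    (forall i k, d' i (h k) = h' (d i k)) ->
  malg_alt d' (malg_map h c) = malg_map h' (malg_alt d c).
Proof.
move=> dh; rewrite -[LHS]/(malg_alt_fun d' (malg_map h c)).
rewrite [malg_alt d c]/(malg_alt_fun d c) /malg_alt_fun raddf_sum.
apply: eq_bigr => i _; rewrite raddfMz.
rewrite (malg_map_comp (e := h' \o d i)) => [|k]; last exact: dh.
by rewrite (malg_map_comp (e := h' \o d i)).
Qed.

Lemma malg_alt_alt (K L P : choiceType) n (d : 'I_n -> L -> P)
    (e : 'I_n.+1 -> K -> L) c :
    (forall (i j : 'I_n) k, (i <= j)%N ->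
       d i (e (lift ord0 j) k) = d j (e (widen_ord (leqnSn n) i) k)) ->
  malg_alt d (malg_alt e c) = 0.
Proof.
move=> de; rewrite [malg_alt e c]/(malg_alt_fun e c) /malg_alt_fun raddf_sum.
under eq_bigr do rewrite raddfMz.
apply: (alt_sum_sum (F := fun i j => malg_map (d i) (malg_map (e j) c))).
move=> i j le_ij; rewrite (malg_map_comp c (e := d j \o e (widen_ord (leqnSn n) i))).
  by rewrite -(malg_map_comp _ (h := d j) (g := e (widen_ord (leqnSn n) i))).
by move=> k /=; rewrite de.
Qed.

End MalgMap.

Record complex := Complex {
  chain :> nat -> zmodType;
  bnd : forall n, {additive chain n.+1 -> chain n};
  bnd_bnd : forall n c, bnd n (bnd n.+1 c) = 0
}.

Record cmap (C D : complex) := Cmap {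
  cmap_fun :> forall n, {additive C n -> D n};
  cmap_bnd : forall n c, bnd D n (cmap_fun n.+1 c) = cmap_fun n (bnd C n c)
}.

Definition bnd_out (C : complex) (n : nat) : {additive C n -> C n.-1} :=
  if n is m.+1 then bnd C m else (\0 : {additive C 0 -> C 0}).

Definition cycle_group (C : complex) (n : nat) : zmodType := ker (bnd_out C n).

Definition is_boundary (C : complex) (n : nat) : set (cycle_group C n) :=
  [set z | exists c, bnd C n c = val z].

Definition homology (C : complex) (n : nat) : zmodType :=
  {quotz @is_boundary C n}.

Section HomologyMap.
Variables (C D : complex) (f : cmap C D) (n : nat).

Fact cmap_cycle (c : C n) : bnd_out C n c = 0 -> bnd_out D n (f n c) = 0.
Proof. by case: n c => //= m c; rewrite cmap_bnd => ->; rewrite raddf0. Qed.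

Definition cycle_map : {additive cycle_group C n -> cycle_group D n} :=
  ker_map cmap_cycle.

Fact cycle_map_boundary (z : cycle_group C n) :
  is_boundary z -> cycle_map z \in zspan (@is_boundary D n).
Proof.
case=> c cz; apply/zspanP/zspan_gen; exists (f n.+1 c).
by rewrite cmap_bnd cz.
Qed.

Definition homology_map : {additive homology C n -> homology D n} :=
  quot_map cycle_map_boundary.

End HomologyMap.

Section Cokernel.
Variables (C D : complex) (f : cmap C D).

Definition coker_chain (n : nat) : zmodType := {quotz range (f n)}.

Fact coker_bnd_range n (d : D n.+1) :
  range (f n.+1) d -> bnd D n d \in zspan (range (f n)).
Proof.
case=> c _ <-; apply/zspanP/zspan_gen; exists (bnd C n c) => //.
by rewrite cmap_bnd.
Qed.

Definition coker_bnd n : {additive coker_chain n.+1 -> coker_chain n} :=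
  quot_map (@coker_bnd_range n).

Fact coker_bnd_bnd n c : coker_bnd n (coker_bnd n.+1 c) = 0.
Proof.
by rewrite -[c]repr_qpi /coker_bnd !quot_mapE bnd_bnd raddf0.
Qed.

Definition coker_complex : complex := Complex coker_bnd_bnd.

End Cokernel.

Record gmodule (G : groupType) := Gmodule {
  gmod_sort :> zmodType;
  gact : G -> {additive gmod_sort -> gmod_sort};
  gact1 : forall m, gact 1%g m = m;
  gactM : forall g h m, gact (g * h)%g m = gact g (gact h m)
}.

Arguments gact {G} M g : rename.

Record gmor (G : groupType) (M N : gmodule G) := Gmor {
  gmor_fun :> {additive M -> N};
  gmor_act : forall g m, gmor_fun (gact M g m) = gact N g (gmor_fun m)
}.

Definition trivmod (G : groupType) (V : zmodType) : gmodule G :=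
  @Gmodule G V (fun=> idfun) (fun=> erefl) (fun _ _ _ => erefl).

(* H_0(G, M) *)
Section Coinvariants.
Variable G : groupType.

Definition coinv_rel (M : gmodule G) : set M :=
  [set x | exists g m, x = gact M g m - m].

Definition coinv (M : gmodule G) : zmodType := {quotz @coinv_rel M}.

Variables (M N : gmodule G) (f : gmor M N).

Fact coinv_map_rel (x : M) : coinv_rel x -> f x \in zspan (@coinv_rel N).
Proof.
case=> g [m ->]; apply/zspanP/zspan_gen; exists g, (f m).
by rewrite raddfB gmor_act.
Qed.

Definition coinv_map : {additive coinv M -> coinv N} := quot_map coinv_map_rel.

End Coinvariants.

Section PermModule.
Variables (G : groupType) (S : choiceType) (act : G -> S -> S).
Hypotheses (act1 : forall s, act 1%g s = s).
Hypotheses (actM : forall g h s, act (g * h)%g s = act g (act h s)).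

Definition perm_group : zmodType := {malg int[S]}.

Definition perm_act g : {additive perm_group -> perm_group} := malg_map int (act g).

Fact perm_act1 c : perm_act 1%g c = c.
Proof. exact: malg_map_id. Qed.

Fact perm_actM g h c : perm_act (g * h)%g c = perm_act g (perm_act h c).
Proof. by apply/esym/malg_map_comp => s /=. Qed.

Definition permmod : gmodule G := Gmodule perm_act1 perm_actM.

End PermModule.

Section KerModule.
Variables (G : groupType) (M N : gmodule G) (f : gmor M N).

Fact gker_act_subproof g m : f m = 0 -> f (gact M g m) = 0.
Proof. by move=> fm; rewrite gmor_act fm raddf0. Qed.

Definition gker_act g : {additive ker f -> ker f} :=
  ker_map (@gker_act_subproof g).

Fact gker_act1 m : gker_act 1%g m = m.
Proof. by apply/val_inj; rewrite /= gact1. Qed.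

Fact gker_actM g h m : gker_act (g * h)%g m = gker_act g (gker_act h m).
Proof. by apply/val_inj; rewrite /= gactM. Qed.

Definition gker : gmodule G := Gmodule gker_act1 gker_actM.

Definition gker_incl : gmor gker M :=
  @Gmor G gker M (ker_incl f) (fun _ _ => erefl).

End KerModule.

(* The inhomogeneous bar complex: C_n(G, M) = M (x) Z[G^n] with
     d (m (x) [g_1|...|g_n]) = g_1^-1 m (x) [g_2|...|g_n]
       + \sum_(0 < i < n) (-1)^i m (x) [g_1|...|g_i g_{i+1}|...|g_n]
       + (-1)^n m (x) [g_1|...|g_{n-1}].
   In [bar_face] and [bar_coef] tuples are indexed from 0. *)
Section Bar.
Variables (G : groupType) (M : gmodule G).

Definition bar_face n (i : nat) (g : n.+1.-tuple G) : n.-tuple G :=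
  [tuple of mkseq (fun j => if (j.+1 < i)%N then nth 1%g g j
                            else if j.+1 == i then (nth 1 g j * nth 1 g j.+1)%g
                            else nth 1%g g j.+1) n].

Definition bar_coef n (i : nat) (g : n.+1.-tuple G) : {additive M -> M} :=
  if i == 0 then gact M (thead g)^-1 else idfun.

Definition bar_chain (n : nat) : zmodType := {malg M[n.-tuple G]}.

Definition bar_term n (g : n.+1.-tuple G) (m : M) : bar_chain n :=
  \sum_(i < n.+2) << bar_coef i g m *g bar_face i g >> *~ (-1) ^+ i.

Fact bar_term_zmod_morphism n g : zmod_morphism (@bar_term n g).
Proof.
move=> x y; rewrite /bar_term -sumrB; apply: eq_bigr => i _.
by rewrite !raddfB mulrzBl.
Qed.

Definition bar_bnd n :
    {additive bar_chain n.+1 -> bar_chain n} :=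
  malg_lift (fun g => Additive (@bar_term_zmod_morphism n g)).

Lemma nth_bar_face n i (g : n.+1.-tuple G) k : (k < n)%N ->
  nth 1%g (bar_face i g) k =
    if (k.+1 < i)%N then nth 1%g g k
    else if k.+1 == i then (nth 1 g k * nth 1 g k.+1)%g else nth 1%g g k.+1.
Proof. by move=> lt_kn; rewrite nth_mkseq. Qed.

Lemma bar_face_face n (i j : nat) (g : n.+2.-tuple G) : (i <= j)%N ->
  bar_face i (bar_face j.+1 g) = bar_face j (bar_face i g).
Proof.
move=> le_ij; apply: eq_from_tnth => k; rewrite !(tnth_nth 1%g).
have lt_kn := ltn_ord k; have lt_kn1 : (k < n.+1)%N by lia.
rewrite !nth_bar_face // eqSS; move: (nth _ g) => p.
by case: (ltngtP k.+1 i) => ?; case: (ltngtP k.+1 j) => ?; try lia;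
  case: (ltngtP k.+2 i) => ?; try lia; case: (ltngtP k j) => ?; try lia;
  case: (ltngtP k.+2 j) => ?; try lia; case: (ltngtP k.+1 j.+1) => ?; try lia;
  case: (ltngtP k.+2 j.+1) => ?; try lia; rewrite /= ?mulgA.
Qed.

Lemma bar_coef_coef n (i j : nat) (g : n.+2.-tuple G) m : (i <= j)%N ->
  bar_coef i (bar_face j.+1 g) (bar_coef j.+1 g m) =
  bar_coef j (bar_face i g) (bar_coef i g m).
Proof.
rewrite /bar_coef; have theadE k (t : k.+1.-tuple G) : thead t = nth 1%g t 0.
  by rewrite /thead (tnth_nth 1%g).
case: i j => [|i] [|j] //= _; rewrite !theadE nth_bar_face //=.
by rewrite -gactM -invgM.
Qed.

Lemma bar_bndU n g m : bar_bnd n << m *g g >> =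
  \sum_(i < n.+2) << bar_coef i g m *g bar_face i g >> *~ (-1) ^+ i.
Proof. exact: malg_liftU. Qed.

Fact bar_bnd_bnd n c : bar_bnd n (bar_bnd n.+1 c) = 0.
Proof.
apply: (malg_ext (f := bar_bnd n \o bar_bnd n.+1) (h := \0)) => m g.
rewrite -[LHS]/(bar_bnd n (bar_bnd n.+1 << m *g g >>)) bar_bndU raddf_sum.
under eq_bigr do rewrite raddfMz bar_bndU.
apply: (alt_sum_sum (F := fun i j : 'I__ =>
  << bar_coef i (bar_face j g) (bar_coef j g m) *g bar_face i (bar_face j g) >>)).
move=> i j le_ij; rewrite lift0 -[nat_of_ord (widen_ord _ _)]/(nat_of_ord i).
by rewrite (bar_face_face g le_ij) (bar_coef_coef g m le_ij).
Qed.

Definition bar_complex : complex := Complex bar_bnd_bnd.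

End Bar.

Section BarMap.
Variables (G G' : groupType) (M : gmodule G) (M' : gmodule G').
Variables (phi : UMagmaMorphism.type G G') (f : {additive M -> M'}).
Hypothesis fP : forall g m, f (gact M g m) = gact M' (phi g) (f m).

Definition bar_map_term n (g : n.-tuple G) (m : M) : {malg M'[n.-tuple G']} :=
  << f m *g map_tuple phi g >>.

Fact bar_map_term_zmod_morphism n g : zmod_morphism (@bar_map_term n g).
Proof. by move=> x y; rewrite /bar_map_term !raddfB. Qed.

Definition bar_map_fun n : {additive bar_complex M n -> bar_complex M' n} :=
  malg_lift (fun g => Additive (@bar_map_term_zmod_morphism n g)).

Lemma bar_map_funU n g m :
  bar_map_fun n << m *g g >> = << f m *g map_tuple phi g >>.
Proof. exact: malg_liftU. Qed.

Lemma map_bar_face n i (g : n.+1.-tuple G) :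
  map_tuple phi (bar_face i g) = bar_face i (map_tuple phi g).
Proof.
apply: eq_from_tnth => k; rewrite tnth_map !(tnth_nth 1%g) !nth_bar_face //.
rewrite !(nth_map 1%g) ?size_tuple ?ltnS ?(ltnW (ltn_ord k)) //.
by case: ifP => // _; case: ifP => // _; rewrite gmulfM.
Qed.

Fact bar_map_bnd n c : bnd (bar_complex M') n (bar_map_fun n.+1 c) =
  bar_map_fun n (bnd (bar_complex M) n c).
Proof.
apply: (malg_ext (f := bnd _ n \o bar_map_fun n.+1)
                 (h := bar_map_fun n \o bnd _ n)) => m g.
rewrite -[LHS]/(bar_bnd M' n (bar_map_fun n.+1 << m *g g >>)).
rewrite -[RHS]/(bar_map_fun n (bar_bnd M n << m *g g >>)).
rewrite bar_map_funU !bar_bndU raddf_sum.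
apply: eq_bigr => i _; rewrite raddfMz bar_map_funU map_bar_face /bar_coef.
case: (i == 0 :> nat); last by [].
by rewrite fP /thead tnth_map gmulfV.
Qed.

Definition bar_map : cmap (bar_complex M) (bar_complex M') := Cmap bar_map_bnd.
End BarMap.

(* H_n(G, V) for a trivial G-module V *)
Definition group_complex (G : groupType) (V : zmodType) : complex :=
  bar_complex (trivmod G V).

Definition group_homology (G : groupType) (V : zmodType) (n : nat) : zmodType :=
  homology (group_complex G V) n.

Section TrivialCoefficients.
Variables (G G' : groupType) (phi : UMagmaMorphism.type G' G) (V : zmodType).

Definition group_cmap : cmap (group_complex G' V) (group_complex G V) :=
  @bar_map G' G (trivmod G' V) (trivmod G V) phi idfun (fun _ _ => erefl).

Definition group_homology_map (n : nat) :
    {additive group_homology G' V n -> group_homology G V n} :=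
  homology_map group_cmap n.

(* H_n(G, G'; V), for phi the inclusion of a subgroup G' of G *)
Definition rel_homology (n : nat) : zmodType :=
  homology (coker_complex group_cmap) n.

End TrivialCoefficients.

Section Generated.
Variables (G : groupType) (S : set G).

Inductive in_gspan : G -> Prop :=
| gspan_gen g of S g : in_gspan g
| gspan1 : in_gspan 1%g
| gspanM g h of in_gspan g & in_gspan h : in_gspan (g * h)%g
| gspanV g of in_gspan g : in_gspan g^-1%g.

Definition generates : Prop := forall g, in_gspan g.

End Generated.

Section Tensor.
Variables M N : zmodType.
Local Notation "m (x) n" := (<< 1%Z *g (m, n) >> : {malg int[(M * N)%type]})
  (at level 40).

Inductive tensor_rel : set {malg int[(M * N)%type]} :=
| tensorDl m m' n : tensor_rel ((m + m') (x) n - m (x) n - m' (x) n)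
| tensorDr m n n' : tensor_rel (m (x) (n + n') - m (x) n - m (x) n').

Definition tensor : zmodType := {quotz tensor_rel}.

End Tensor.

Definition dyadicb : {pred rat} :=
  fun x => `[< exists (m : int) (k : nat), x = m%:~R / 2%:R ^+ k >].

Fact dyadicb_closed : zmod_closed dyadicb.
Proof.
split=> [|x y /asboolP[m [k ->]] /asboolP[m' [k' ->]]]; apply/asboolP.
  by exists 0, 0; rewrite mul0r.
exists (m * 2 ^+ k' - m' * 2 ^+ k), (k + k')%N.
have nz i : (2%:R : rat) ^+ i != 0 by rewrite expf_neq0.
rewrite rmorphB !rmorphM !rmorphXn /= exprD mulrBl; congr (_ - _).
  by rewrite -mulf_div divff ?mulr1.
by rewrite [_ ^+ k * _]mulrC -mulf_div divff ?mulr1.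
Qed.
HB.instance Definition _ := GRing.isZmodClosed.Build rat dyadicb dyadicb_closed.

(* The additive group of the subring Z[1/2] of the rationals *)
Definition dyadic := {x : rat | x \in dyadicb}.
HB.instance Definition _ := SubChoice.on dyadic.
HB.instance Definition _ := [SubChoice_isSubZmodule of dyadic by <:].

Definition invert2 (M : zmodType) : zmodType := tensor M dyadic.

Section SL2.
Variable A : comUnitRingType.

Definition mx2 (a b c d : A) : 'M[A]_2 :=
  \matrix_(i, j) if i == 0 then if j == 0 then a else b
                 else if j == 0 then c else d.

Lemma det2 (M : 'M[A]_2) : \det M = M 0 0 * M 1 1 - M 0 1 * M 1 0.
Proof.
rewrite (expand_det_row _ 0) !big_ord_recl big_ord0 addr0 /cofactor /=.
have det1 (N : 'M[A]_1) : \det N = N 0 0 by rewrite {1}[N]mx11_scalar det_scalar1.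
rewrite !det1 !mxE /= expr0 expr1 mul1r mulN1r mulrN.
congr (_ * M _ _ - M _ _ * M _ _); exact/val_inj.
Qed.

Lemma sum2 (F : 'I_2 -> A) : \sum_i F i = F 0 + F 1.
Proof. by rewrite !big_ord_recl big_ord0 addr0; congr (_ + F _); exact/val_inj. Qed.

Definition SL2 := {M : 'M[A]_2 | \det M == 1}.
HB.instance Definition _ := SubChoice.on SL2.

Definition SL2_one : SL2 := Sub 1%:M (introT eqP (det1 A 2)).

Fact SL2_mul_subproof (g h : SL2) : \det (val g *m val h) == 1.
Proof. by rewrite det_mulmx (eqP (valP g)) (eqP (valP h)) mulr1. Qed.
Definition SL2_mul (g h : SL2) : SL2 := Sub (val g *m val h) (SL2_mul_subproof g h).

Fact SL2_inv_subproof (g : SL2) : \det (invmx (val g)) == 1.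
Proof. by rewrite det_inv (eqP (valP g)) invr1. Qed.
Definition SL2_inv (g : SL2) : SL2 := Sub (invmx (val g)) (SL2_inv_subproof g).

Lemma SL2_unit (g : SL2) : val g \in unitmx.
Proof. by rewrite unitmxE (eqP (valP g)) unitr1. Qed.

Fact SL2_mulA : associative SL2_mul.
Proof. by move=> f g h; apply/val_inj/mulmxA. Qed.
Fact SL2_mul1 : left_id SL2_one SL2_mul.
Proof. by move=> g; apply/val_inj/mul1mx. Qed.
Fact SL2_mulr1 : right_id SL2_one SL2_mul.
Proof. by move=> g; apply/val_inj/mulmx1. Qed.
Fact SL2_mulV : left_inverse SL2_one SL2_inv SL2_mul.
Proof. by move=> g; apply/val_inj/mulVmx/SL2_unit. Qed.
Fact SL2_mulrV : right_inverse SL2_one SL2_inv SL2_mul.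
Proof. by move=> g; apply/val_inj/mulmxV/SL2_unit. Qed.

HB.instance Definition _ := isGroup.Build SL2
  SL2_mulA SL2_mul1 SL2_mulr1 SL2_mulV SL2_mulrV.

Definition diagonal : {pred SL2} :=
  fun g => (val g 0 1 == 0) && (val g 1 0 == 0).
Definition upper_triangular : {pred SL2} := fun g => val g 1 0 == 0.

Lemma val_SL2V (g : SL2) :
  val (g^-1)%g = mx2 (val g 1 1) (- val g 0 1) (- val g 1 0) (val g 0 0).
Proof.
rewrite -[RHS]mulmx1 -(mulmxV (SL2_unit g)) mulmxA.
rewrite [X in _ = X *m _](_ : _ = 1%:M) ?mul1mx //.
have /eqP := valP g; rewrite det2; move: (val g) => m g1.
apply/matrixP=> i j; rewrite !mxE sum2 !mxE.
have [-> | ->] : i = 0 \/ i = 1.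
- by case: i => [[|[|//]] i2]; [left | right]; apply/val_inj.
- have [-> | ->] : j = 0 \/ j = 1.
  + by case: j => [[|[|//]] i2]; [left | right]; apply/val_inj.
  + by rewrite mulr1n -[RHS]g1 /=; ring.
  + by rewrite /=; ring.
- have [-> | ->] : j = 0 \/ j = 1.
  + by case: j => [[|[|//]] i2]; [left | right]; apply/val_inj.
  + by rewrite /=; ring.
  + by rewrite mulr1n -[RHS]g1 /=; ring.
Qed.

Lemma val_SL2F (g h : SL2) i j : val (g * h^-1)%g i j =
  (if j == 0 then val g i 0 * val h 1 1 - val g i 1 * val h 1 0
   else val g i 1 * val h 0 0 - val g i 0 * val h 0 1).
Proof.
rewrite -[val _]/(val g *m val (h^-1)%g) val_SL2V !mxE sum2 !mxE /=.
by case: ifP => _; ring.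
Qed.

Fact diagonal_closed : group_closed diagonal.
Proof.
split=> [|g h]; first by rewrite unfold_in /diagonal /= !mxE !eqxx.
rewrite !unfold_in /diagonal => /andP[/eqP g01 /eqP g10] /andP[/eqP h01 /eqP h10].
by rewrite !val_SL2F /= g01 g10 h01 h10 !mul0r !mulr0 subrr eqxx.
Qed.

Fact upper_triangular_closed : group_closed upper_triangular.
Proof.
split=> [|g h]; first by rewrite unfold_in /upper_triangular /= !mxE eqxx.
rewrite !unfold_in /upper_triangular => /eqP g10 /eqP h10.
by rewrite val_SL2F /= g10 h10 mul0r mulr0 subrr eqxx.
Qed.

Definition torus := {g : SL2 | g \in diagonal}.
HB.instance Definition _ := SubChoice.on torus.
HB.instance Definition _ :=
  SubChoice_isSubGroup.Build SL2 diagonal torus diagonal_closed.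

Definition borel := {g : SL2 | g \in upper_triangular}.
HB.instance Definition _ := SubChoice.on borel.
HB.instance Definition _ :=
  SubChoice_isSubGroup.Build SL2 upper_triangular borel upper_triangular_closed.

Fact torus_borel_subproof (t : torus) : val t \in upper_triangular.
Proof. by have /andP[] := valP t. Qed.
Definition torus_borel (t : torus) : borel := Sub (val t) (torus_borel_subproof t).

Fact torus_borel_morphism : {morph torus_borel : s t / (s / t)%g}.
Proof. by move=> s t; apply/val_inj. Qed.
HB.instance Definition _ := isGroupMorphism.Build torus borel torus_borel
  torus_borel_morphism.

Definition torus_SL2 : torus -> SL2 := val.
Fact torus_SL2_morphism : {morph torus_SL2 : s t / (s / t)%g}.
Proof. by []. Qed.
HB.instance Definition _ := isGroupMorphism.Build torus SL2 torus_SL2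
  torus_SL2_morphism.

Definition elementary : set SL2 :=
  [set g | exists i j (x : A), i != j /\ val g = 1%:M + x *: delta_mx i j].

Definition GE2_ring : Prop := generates elementary.

Fact ge2_subproof (x : A) : \det (mx2 x 1 (-1) 0) == 1.
Proof. by rewrite det2 !mxE /= mulr0 mul1r opprK add0r. Qed.
Definition SL2_E (x : A) : SL2 := Sub (mx2 x 1 (-1) 0) (ge2_subproof x).

(* Words in the letters E(x) (encoded by (x, true)) and E(x)^-1 (encoded by
   (x, false)): the elements of the free group on the symbols E(x). *)
Definition word : Type := seq (A * bool).

Definition eval_letter (l : A * bool) : SL2 := if l.2 then SL2_E l.1 else (SL2_E l.1)^-1%g.
Definition eval (w : word) : SL2 := (\prod_(l <- w) eval_letter l)%g.

Definition wE (x : A) : word := [:: (x, true)].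
Definition wD (a : A) : word := wE (- a) ++ wE (- a^-1) ++ wE (- a).

Inductive ge2_eq : word -> word -> Prop :=
| ge2_refl w : ge2_eq w w
| ge2_sym w1 w2 of ge2_eq w1 w2 : ge2_eq w2 w1
| ge2_trans w1 w2 w3 of ge2_eq w1 w2 & ge2_eq w2 w3 : ge2_eq w1 w3
| ge2_cat w1 w2 w1' w2' of ge2_eq w1 w1' & ge2_eq w2 w2' :
    ge2_eq (w1 ++ w2) (w1' ++ w2')
| ge2_cancel x b : ge2_eq [:: (x, b); (x, ~~ b)] [::]
| ge2_add x y : ge2_eq (wE x ++ wE 0 ++ wE y) (wD (-1) ++ wE (x + y))
| ge2_conj x a of a \is a GRing.unit :
    ge2_eq (wE x ++ wD a) (wD a^-1 ++ wE (a ^+ 2 * x))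
| ge2_mul a b of a \is a GRing.unit & b \is a GRing.unit :
    ge2_eq (wD a ++ wD b) (wD (a * b)).

Definition universal_GE2_ring : Prop :=
  generates (range SL2_E) /\
  forall w1 w2 : word, eval w1 = eval w2 <-> ge2_eq w1 w2.

Local Notation vect := 'cV[A]_2.

Definition unimodular (u : vect) : Prop :=
  exists2 M : 'M[A]_2, M \in unitmx & col 0 M = u.

Definition line (u : vect) : set vect := range (fun a : A => a *: u).

Definition is_simplex n (L : n.-tuple (set vect)) : Prop :=
  exists v : 'I_n -> vect,
    [/\ forall i, unimodular (v i), forall i, tnth L i = line (v i)
      & forall i j, i != j -> (row_mx (v i) (v j) : 'M[A]_2) \in unitmx].

Definition simplex n := {L : n.+1.-tuple (set vect) | `[< is_simplex L >]}.
HB.instance Definition _ n := SubChoice.on (simplex n).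

Lemma is_simplex_valP n (L : simplex n) : is_simplex (val L).
Proof. exact/asboolP/(valP L). Qed.

Definition line_act (g : SL2) (l : set vect) : set vect := (mulmx (val g) @` l)%classic.

Lemma line_act_line g u : line_act g (line u) = line (val g *m u).
Proof.
apply/seteqP; split=> w; first by case=> _ [a _ <-] <-; exists a; rewrite // scalemxAr.
by case=> a _ <-; exists (a *: u); [exists a | rewrite scalemxAr].
Qed.

Lemma line_act1 l : line_act 1%g l = l.
Proof.
rewrite /line_act (_ : mulmx _ = id) ?image_id //.
by apply/funext=> u; rewrite mul1mx.
Qed.

Lemma line_actM g h l : line_act (g * h)%g l = line_act g (line_act h l).
Proof.
rewrite /line_act image_comp; congr (image _ _).
by apply/funext=> u; rewrite /= -mulmxA.
Qed.

Fact simplex_act_subproof g n (L : simplex n) :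
  `[< is_simplex (map_tuple (line_act g) (val L)) >].
Proof.
have [v [v_uni Lv v_inv]] := is_simplex_valP L; apply/asboolP.
exists (fun i => val g *m v i); split=> [i|i|i j ne_ij].
- have [M uM <-] := v_uni i; exists (val g *m M); last by rewrite !colE mulmxA.
  by rewrite unitmx_mul SL2_unit.
- by rewrite tnth_map Lv line_act_line.
- have -> : row_mx (val g *m v i) (val g *m v j)
     = val g *m row_mx (v i) (v j) :> 'M[A]_2 by rewrite -mul_mx_row.
  by rewrite unitmx_mul SL2_unit v_inv.
Qed.

Definition simplex_act g n (L : simplex n) : simplex n :=
  Sub (map_tuple (line_act g) (val L)) (simplex_act_subproof g L).

Lemma simplex_act1 n (L : simplex n) : simplex_act 1%g L = L.
Proof.
by apply/val_inj/eq_from_tnth=> i; rewrite /= tnth_map line_act1.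
Qed.

Lemma simplex_actM g h n (L : simplex n) :
  simplex_act (g * h)%g L = simplex_act g (simplex_act h L).
Proof.
by apply/val_inj/eq_from_tnth=> i; rewrite /= !tnth_map line_actM.
Qed.

Definition X (n : nat) : gmodule SL2 :=
  @permmod SL2 (simplex n) (fun g => @simplex_act g n)
    (@simplex_act1 n) (fun g h => @simplex_actM g h n).

Definition X_gen n (L : simplex n) : X n := << 1%Z *g L >>.

Lemma gact_gen g n (L : simplex n) :
  gact (X n) g (X_gen L) = X_gen (simplex_act g L).
Proof. exact: malg_mapU. Qed.

Fact face_subproof n (i : 'I_n.+2) (L : simplex n.+1) :
  `[< is_simplex [tuple tnth (val L) (lift i j) | j < n.+1] >].
Proof.
have [v [v_uni Lv v_inv]] := is_simplex_valP L; apply/asboolP.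
exists (v \o lift i); split=> [j|j|j k ne_jk] //=; first by rewrite tnth_mktuple.
by apply: v_inv; rewrite (inj_eq lift_inj).
Qed.

Definition face n (i : 'I_n.+2) (L : simplex n.+1) : simplex n :=
  Sub [tuple tnth (val L) (lift i j) | j < n.+1] (face_subproof i L).

Lemma face_face n (i j : 'I_n.+2) (L : simplex n.+2) : (i <= j)%N ->
  face i (face (lift ord0 j) L) = face j (face (widen_ord (leqnSn n.+2) i) L).
Proof.
move=> le_ij; apply/val_inj/eq_from_tnth=> k; rewrite /= !tnth_mktuple.
congr (tnth _ _); apply/val_inj; rewrite /= /bump; lia.
Qed.

Lemma face_act n (i : 'I_n.+2) g (L : simplex n.+1) :
  face i (simplex_act g L) = simplex_act g (face i L).
Proof.
by apply/val_inj/eq_from_tnth=> k; rewrite /= !(tnth_mktuple, tnth_map).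
Qed.

Definition partial_add n : {additive X n.+1 -> X n} := malg_alt int (@face n).

Fact partial_act n g c :
  partial_add n (gact (X n.+1) g c) = gact (X n) g (partial_add n c).
Proof. by apply: malg_alt_map => i L; apply: face_act. Qed.

Definition partial n : gmor (X n.+1) (X n) := Gmor (@partial_act n).

Lemma partial_gen n (L : simplex n.+1) : partial n (X_gen L) =
  \sum_(i < n.+2) X_gen (face i L) *~ (-1) ^+ i.
Proof. by apply: eq_bigr => i _; rewrite malg_mapU. Qed.

Lemma partial_partial n c : partial n (partial n.+1 c) = 0.
Proof. by apply: malg_alt_alt => i j L; apply: face_face. Qed.

(* partial n starts in degree n.+1, so Z_i is the kernel of partial i.-1. *)
Definition Z1 : gmodule SL2 := gker (partial 0).
Definition Z2 : gmodule SL2 := gker (partial 1).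

Definition RP : zmodType := coinv Z2.

(* The target of the map is (X_2)_{SL_2}, which is identified with Z[G_A]. *)
Definition RP1 : zmodType := ker (coinv_map (gker_incl (partial 1))).

Definition GW : zmodType := coinv Z1.
Definition fundamental_ideal : zmodType :=
  ker (coinv_map (gker_incl (partial 0))).


Definition partial_Z1_fun (c : X 2) : Z1 := in_ker (partial_partial c).
Fact partial_Z1_zmod_morphism : zmod_morphism partial_Z1_fun.
Proof. by move=> x y; apply/val_inj; exact: (raddfB (partial 1)). Qed.
Definition partial_Z1_add : {additive X 2 -> Z1} :=
  Additive partial_Z1_zmod_morphism.
Fact partial_Z1_act g c :
  partial_Z1_add (gact (X 2) g c) = gact Z1 g (partial_Z1_add c).
Proof. by apply/val_inj/partial_act. Qed.
Definition partial_Z1 : gmor (X 2) Z1 := Gmor partial_Z1_act.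

Definition K1M := {a : A | a \is a GRing.unit}.
HB.instance Definition _ := SubChoice.on K1M.

Definition K1M_zero : K1M := Sub 1 (unitr1 A).
Fact K1M_add_subproof (a b : K1M) : val a * val b \is a GRing.unit.
Proof. by rewrite unitrM (valP a) (valP b). Qed.
Definition K1M_add (a b : K1M) : K1M := Sub (val a * val b) (K1M_add_subproof a b).
Fact K1M_opp_subproof (a : K1M) : (val a)^-1 \is a GRing.unit.
Proof. by rewrite unitrV (valP a). Qed.
Definition K1M_opp (a : K1M) : K1M := Sub (val a)^-1 (K1M_opp_subproof a).

Fact K1M_addA : associative K1M_add.
Proof. by move=> a b c; apply/val_inj/mulrA. Qed.
Fact K1M_addC : commutative K1M_add.
Proof. by move=> a b; apply/val_inj/mulrC. Qed.
Fact K1M_add0 : left_id K1M_zero K1M_add.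
Proof. by move=> a; apply/val_inj/mul1r. Qed.
Fact K1M_addN : left_inverse K1M_zero K1M_opp K1M_add.
Proof. by move=> a; apply/val_inj/mulVr/(valP a). Qed.
(* K_1^M(A) is the group of units of A, written additively. *)
HB.instance Definition _ := GRing.isZmodule.Build K1M
  K1M_addA K1M_addC K1M_add0 K1M_addN.

Lemma row_mx_l (u v : vect) i : (row_mx u v : 'M[A]_2) i 0 = u i 0.
Proof.
by rewrite -(row_mxEl u v i 0); congr (row_mx u v i _); apply/val_inj.
Qed.

Lemma row_mx_r (u v : vect) i : (row_mx u v : 'M[A]_2) i 1 = v i 0.
Proof.
by rewrite -(row_mxEr u v i 0); congr (row_mx u v i _); apply/val_inj.
Qed.

Lemma det_row_mx2 (u v : vect) :
  \det (row_mx u v : 'M[A]_2) = u 0 0 * v 1 0 - v 0 0 * u 1 0.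
Proof. by rewrite det2 !row_mx_l !row_mx_r. Qed.

Definition e1 : vect := delta_mx 0 0.
Definition e2 : vect := delta_mx 1 0.

(* The triple (oo, 0, a) *)
Definition std_vect (a : A) (i : 'I_3) : vect :=
  tnth [tuple e1; e2; e1 + a *: e2] i.

Lemma unimodular_row (u v : vect) :
  (row_mx u v : 'M[A]_2) \in unitmx -> unimodular u.
Proof.
move=> uv; exists (row_mx u v) => //; apply/colP => i; rewrite mxE.
exact: row_mx_l.
Qed.

Fact std_simplex_subproof (a : K1M) :
  `[< is_simplex [tuple line (std_vect (val a) i) | i < 3] >].
Proof.
have inv i j : i != j ->
    (row_mx (std_vect (val a) i) (std_vect (val a) j) : 'M[A]_2) \in unitmx.
  rewrite unitmxE det_row_mx2 /std_vect !(tnth_nth 0).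
  case: i => [[|[|[|//]]] i3]; case: j => [[|[|[|//]]] j3] //= _;
    rewrite !mxE /= ?(mulr0, mulr1, mul0r, mul1r, add0r, addr0, sub0r, subr0);
    by rewrite ?unitrN ?unitr1 ?(valP a).
apply/asboolP; exists (std_vect (val a)); split=> // i; last by rewrite tnth_mktuple.
have ne_i : i != (if i == 0 then 1 else 0) by case: i => [[|[|[|//]]] i3].
exact: unimodular_row (inv _ _ ne_i).
Qed.

Definition std_simplex (a : K1M) : simplex 2 :=
  Sub [tuple line (std_vect (val a) i) | i < 3] (std_simplex_subproof a).

(* The image in GW(A) of the class of (oo, 0, a) *)
Definition GW_class (a : K1M) : GW :=
  coinv_map partial_Z1 (qpi _ (X_gen (std_simplex a))).

Lemma edge_transitive (s : simplex 1) :
  exists g, simplex_act g (face ord_max (std_simplex 0)) = s.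
Proof.
have [v [_ sv v_inv]] := is_simplex_valP s.
have {v_inv} := v_inv 0 1 isT; rewrite unitmxE.
set d := \det _ => ud.
have g1 : \det (row_mx (v 0) (d^-1 *: v 1) : 'M[A]_2) == 1.
  rewrite -(mulVr ud) [X in _ == _ * X]det_row_mx2 det_row_mx2 !mxE.
  by apply/eqP; ring.
have gl : row_mx (v 0) (d^-1 *: v 1) *m e1 = v 0.
  apply/colP=> i; rewrite mxE sum2 row_mx_l [e1 0 0]mxE [e1 1 0]mxE /=.
  by rewrite mulr0 mulr1 addr0.
have gr : row_mx (v 0) (d^-1 *: v 1) *m e2 = d^-1 *: v 1.
  apply/colP=> i; rewrite mxE sum2 row_mx_r [e2 0 0]mxE [e2 1 0]mxE /=.
  by rewrite mulr0 mulr1 add0r.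
exists (Sub (row_mx (v 0) (d^-1 *: v 1)) g1).
apply/val_inj/eq_from_tnth => i.
rewrite /= tnth_map tnth_mktuple tnth_mktuple line_act_line sv SubK.
rewrite /std_vect !(tnth_nth 0).
have [->|->] : i = 0 \/ i = 1.
  by case: i => [[|[|//]] i2]; [left | right]; apply/val_inj.
  by rewrite /= gl.
rewrite /= gr; apply/seteqP; split=> w [x _ <-].
  by exists (x * d^-1); rewrite ?scalerA.
by exists (x * d); rewrite ?scalerA ?mulrK.
Qed.

Lemma coinv_edge (s : simplex 1) :
  qpi (@coinv_rel _ (X 1)) (X_gen s) =
  qpi (@coinv_rel _ (X 1)) (X_gen (face ord_max (std_simplex 0))).
Proof.
have [g <-] := edge_transitive s; move: (face _ _) => s0.
apply/eqP; rewrite quot_eq; apply/zspanP/zspan_gen.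
by exists g, (X_gen s0); rewrite gact_gen.
Qed.

Lemma partial_gen_const (V : zmodType) (F : {additive X 1 -> V}) (v : V) t :
  (forall s, F (X_gen s) = v) -> F (partial 1 (X_gen t)) = \sum_(i < 3) v *~ (-1) ^+ i.
Proof.
move=> Fv; rewrite partial_gen raddf_sum; apply: eq_bigr => i _.
by rewrite raddfMz Fv.
Qed.

Fact pfister_subproof (a : K1M) :
  coinv_map (gker_incl (partial 0)) (GW_class a - GW_class 0) = 0.
Proof.
have cls b : coinv_map (gker_incl (partial 0)) (GW_class b) =
    \sum_(i < 3) qpi (@coinv_rel _ (X 1))
      (X_gen (face ord_max (std_simplex 0))) *~ (-1) ^+ i.
  transitivity (qpi (@coinv_rel _ (X 1)) (partial 1 (X_gen (std_simplex b)))).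
    rewrite /GW_class [coinv_map partial_Z1 _]quot_mapE.
    exact: quot_mapE.
  exact: (partial_gen_const _ coinv_edge).
rewrite raddfB; apply/eqP; rewrite subr_eq0; apply/eqP.
exact: etrans (cls a) (esym (cls 0)).
Qed.

(* <<a>> = <a> - <1>; the zero of K1M is the unit 1 of A. *)
Definition pfister (a : K1M) : fundamental_ideal := in_ker (pfister_subproof a).

Definition bar_partial0 : cmap (bar_complex (X 1)) (bar_complex (X 0)) :=
  @bar_map SL2 SL2 (X 1) (X 0) idfun (partial 0) (gmor_act (partial 0)).

Definition E1_map : {additive homology (bar_complex (X 1)) 1 ->
  homology (bar_complex (X 0)) 1} := homology_map bar_partial0 1.

Definition E2_01 : zmodType := {quotz range E1_map}.

(* The graph of d^2_{2,0} : I(A) -> E^2_{0,1}: lift x to z in Z_1, write the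
   image of z in X_1 = C_0(SL_2, X_1) as the boundary of some c in C_1(SL_2, X_1),
   and take the class of the image of c in C_1(SL_2, X_0). *)
Definition d2_graph (x : fundamental_ideal) (w : E2_01) : Prop :=
  exists (z : Z1) (c : bar_complex (X 1) 1) (y : cycle_group (bar_complex (X 0)) 1),
    [/\ val x = qpi _ z,
        bnd (bar_complex (X 1)) 0 c = << (val z : X 1) *g [tuple] >>,
        val y = bar_partial0 1 c
      & w = qpi _ (qpi _ y)].

(* I^2(A), the kernel of d^2_{2,0} *)
Definition I2 : set fundamental_ideal := [set x | d2_graph x 0].

(* I(A)/I^2(A) *)
Definition I_mod_I2 : zmodType := {quotz I2}.

(* The fibre product of a |-> <<a>> mod I^2(A) and the projection of I(A). That
   the first map is a homomorphism depends on hypotheses on A, so it is passed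
   as an additive map s, to be specified by [pfister_mod_spec]. *)
Definition pfister_mod_spec (s : {additive K1M -> I_mod_I2}) : Prop :=
  forall a, s a = qpi I2 (pfister a).

Definition K1MW (s : {additive K1M -> I_mod_I2}) : zmodType :=
  fibprod s (qpi I2).

End SL2.

(* Main.v *)
(* Write G = SL_2(A), T for the torus and K for the kernel of the augmentation of X_0(A^2).
   By Shapiro's lemma and the hypothesis on the Borel subgroup, T -> G factors as
   H_i(T) = H_i(G, X_0) -> H_i(G), so that H_{n+1}(G, T) = H_n(G, K) for n = 1, 2.

   If A is a GE_2-ring, then 0 -> Z_1 -> X_1 -> K -> 0 is exact, H_1(G, X_1) = T and
   H_1(G, X_0) = T, and X_1 -> X_0 induces a |-> a^-2 on them. The long exact sequence
   presents H_1(G, K) as the fibre product of H_1(G, X_0) = A^* and I(A), with no extra kernel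
   because the 2-torsion -1 of T is killed by the boundary of (oo, 0, 1) (x) [-1].

   If A is a universal GE_2-ring, then moreover 0 -> Z_2 -> X_2 -> Z_1 -> 0 is exact, and up to
   2-torsion the connecting maps H_2(G, K) -> H_1(G, Z_1) -> H_0(G, Z_2) are isomorphisms onto
   RP_1(A): stabilizers of 2-simplices have exponent 2, and the edge (oo, 0) and its flip differ
   on H_2(T) by inversion, which is trivial, whereas their sum lies in Z_1. *)
Require Import Defs.
From HB Require Import structures.
From mathcomp Require Import all_boot all_order all_algebra.
From mathcomp Require Import boolp classical_sets.
From mathcomp Require Import finmap monalg zify ring.

Set Implicit Arguments.
Unset Strict Implicit.
Unset Printing Implicit Defensive.

Import GRing.Theory.
Local Open Scope ring_scope.

(** * Additive maps and homology classes *)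

(** Connecting homomorphisms are treated as additive relations: a class is related to every outcome
    of the diagram chase through the bar complexes. No lift has to be chosen additively, and
    injectivity and surjectivity become further chases. The comparison with A^* needs more than an
    abstract isomorphism, because the value of d^2 on <<a>> has to be computed. It is carried by a
    functional [phi] on C_1(G, X_0): a group element that moves w to x u contributes x, up to a term
    nu(w) - nu(u) that depends on the vectors chosen on the lines and cancels on cycles. In the
    universal case exactness at X_1 is a simple connectivity statement: edge paths from oo are words
    in the E(x), and the defining relations are homotopies across triangles. The map onto RP_1(A) is
    controlled only up to 2-power torsion: its kernel is killed by 4 and its cokernel by 2. So no
    isomorphism is built after tensoring. Both sides are recognised as localizations of one integral
    group, and such localizations are unique. *)

Lemma isomorphic_trans (U V W : zmodType) :
  isomorphic U V -> isomorphic V W -> isomorphic U W.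
Proof. by case=> f bf [g bg]; exists (g \o f); apply: bij_comp. Qed.

Section AdditiveRelation.
Variables (U V : zmodType) (R : U -> V -> Prop).
Hypothesis R_total : forall u, exists v, R u v.
Hypothesis R_sub : forall u u' v v', R u v -> R u' v' -> R (u - u') (v - v').
Hypothesis R_fun0 : forall v, R 0 v -> v = 0.

(** Two values of the same u differ by a value of 0, so closure under subtraction makes the relation
    single-valued and the resulting map additive. *)
Lemma additive_of_rel : exists f : {additive U -> V}, forall u v, R u v <-> f u = v.
Proof.
pose f u := projT1 (cid (R_total u)).
have fP u : R u (f u) by rewrite /f; case: cid.
have Rf u v : R u v -> f u = v.
  move=> Ruv; apply/eqP; rewrite -subr_eq0; apply/eqP/R_fun0.
  by rewrite -(subrr u); apply: R_sub.
have fB : zmod_morphism f by move=> x y; apply: Rf; apply: R_sub.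
by exists (Additive fB) => u v; split=> [/Rf //|<-]; apply: fP.
Qed.

Lemma isomorphic_of_rel : (forall u, R u 0 -> u = 0) ->
  (forall v, exists u, R u v) -> isomorphic U V.
Proof.
move=> inj surj; have [f fP] := additive_of_rel; exists f.
have /cid2[g _ gP] : exists2 g : V -> U, True & forall v, f (g v) = v.
  pose g v := projT1 (cid (surj v)); exists g => // v.
  by apply/fP; rewrite /g; case: cid.
exists g => // u; apply/eqP; rewrite -subr_eq0; apply/eqP/inj/fP.
by rewrite raddfB gP subrr.
Qed.

End AdditiveRelation.

Lemma in_zspan_closed (V : zmodType) (S : set V) (v : V) :
  S 0 -> (forall u v, S u -> S v -> S (u - v)) -> v \in zspan S -> S v.
Proof. by move=> S0 SB /zspanP; elim=> // u w _ Su _; apply: SB. Qed.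

Lemma qpi_eq0 (V : zmodType) (S : set V) (v : V) :
  S 0 -> (forall u v, S u -> S v -> S (u - v)) -> qpi S v = 0 <-> S v.
Proof.
move=> S0 SB; have -> : 0 = qpi S 0 by rewrite raddf0.
rewrite (rwP eqP) quot_eq subr0; split; first exact: in_zspan_closed.
by move=> Sv; apply/zspanP/zspan_gen.
Qed.

Lemma range_closed (U V : zmodType) (f : {additive U -> V}) :
  range f 0 /\ forall u v, range f u -> range f v -> range f (u - v).
Proof.
split; first by exists 0; rewrite ?raddf0.
by move=> _ _ [x _ <-] [y _ <-]; exists (x - y); rewrite ?raddfB.
Qed.

Lemma qpi_range_eq0 (U V : zmodType) (f : {additive U -> V}) v :
  qpi (range f) v = 0 <-> exists u, f u = v.
Proof.
have [f0 fB] := range_closed f.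
by rewrite qpi_eq0 //; split=> [[u _ <-]|[u <-]]; exists u.
Qed.

Section Boundaries.
Variable C : complex.

Definition cyc n (c : C n) : Prop := bnd_out C n c = 0.

Definition bdry n : {pred C n} := fun x => `[< exists d, bnd C n d = x >].
Arguments bdry n _ : clear implicits.

Lemma bdryP n (x : C n) : reflect (exists d, bnd C n d = x) (x \in bdry n).
Proof. exact: asboolP. Qed.

Fact bdry_closed n : zmod_closed (bdry n).
Proof.
split=> [|x y /bdryP[c <-] /bdryP[d <-]]; apply/bdryP.
  by exists 0; rewrite raddf0.
by exists (c - d); rewrite raddfB.
Qed.
HB.instance Definition _ n := GRing.isZmodClosed.Build (C n) (bdry n) (bdry_closed n).

Lemma bdry_bnd n c : bnd C n c \in bdry n.
Proof. by apply/bdryP; exists c. Qed.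

Lemma bdry_trans n (y x z : C n) :
  x - y \in bdry n -> y - z \in bdry n -> x - z \in bdry n.
Proof. by move=> xy yz; rewrite -(subrKA y) rpredD. Qed.

Lemma cycB n (c d : C n) : cyc c -> cyc d -> cyc (c - d).
Proof. by rewrite /cyc raddfB => -> ->; rewrite subrr. Qed.

Lemma cyc_bnd n (c : C n.+1) : cyc (bnd C n c).
Proof. by case: n c => // n c; rewrite /cyc /= bnd_bnd. Qed.

Definition hclass n (c : C n) (c0 : cyc c) : homology C n :=
  qpi (@is_boundary C n) (in_ker c0).

Lemma hclass_eq0 n (c : C n) (c0 : cyc c) : hclass c0 = 0 <-> c \in bdry n.
Proof.
rewrite /hclass qpi_eq0 /is_boundary /=; first by split=> /bdryP.
  by exists 0; rewrite raddf0.
by move=> u v [c1 <-] [c2 <-]; exists (c1 - c2); rewrite raddfB.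
Qed.

Lemma hclassP n (x : homology C n) : exists (c : C n) (c0 : cyc c), x = hclass c0.
Proof.
exists (val (repr x)), (kerP (repr x)); rewrite -[LHS]repr_qpi /hclass.
by congr (qpi _ _); apply: val_inj.
Qed.

Lemma hclass_sub n (c d : C n) (c0 : cyc c) (d0 : cyc d) (cd0 : cyc (c - d)) :
  hclass c0 - hclass d0 = hclass cd0.
Proof. by rewrite -raddfB; congr (qpi _ _); apply: val_inj. Qed.

Lemma hclass_eq n (c d : C n) (c0 : cyc c) (d0 : cyc d) :
  hclass c0 = hclass d0 <-> c - d \in bdry n.
Proof.
rewrite -(hclass_eq0 (cycB c0 d0)) -(hclass_sub c0 d0).
by split=> /eqP; [rewrite -subr_eq0|rewrite subr_eq0] => /eqP.
Qed.

End Boundaries.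
Arguments bdry C n _ : clear implicits.

Lemma cmap_cyc (C D : complex) (f : cmap C D) n (c : C n) : cyc c -> cyc (f n c).
Proof. exact: cmap_cycle. Qed.

Lemma cmap_bdry (C D : complex) (f : cmap C D) n (c : C n) :
  c \in bdry C n -> f n c \in bdry D n.
Proof. by move=> /bdryP[d <-]; rewrite -cmap_bnd bdry_bnd. Qed.

Lemma homology_mapE (C D : complex) (f : cmap C D) n (c : C n) (c0 : cyc c)
  (fc0 : cyc (f n c)) : homology_map f n (hclass c0) = hclass fc0.
Proof. by rewrite /homology_map quot_mapE; congr (qpi _ _); apply: val_inj. Qed.

(** Injectivity on homology, and below it surjectivity, phrased with cycles and boundaries so that
    chases stay inside the chain groups. *)
Definition hinj (C D : complex) (f : cmap C D) n :=
  forall c, cyc c -> f n c \in bdry D n -> c \in bdry C n.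

Definition hsurj (C D : complex) (f : cmap C D) n :=
  forall d, cyc d -> exists2 c, cyc c & d - f n c \in bdry D n.

Lemma hinj_homology_map (C D : complex) (f : cmap C D) n :
  injective (homology_map f n) -> hinj f n.
Proof.
move=> injf c c0 fc; apply/(hclass_eq0 c0)/injf.
by rewrite raddf0 (homology_mapE c0 (cmap_cyc f c0)); apply/hclass_eq0.
Qed.

Lemma hsurj_homology_map (C D : complex) (f : cmap C D) n :
  (forall y, exists x, homology_map f n x = y) -> hsurj f n.
Proof.
move=> surjf d d0; have [x] := surjf (hclass d0).
have [c [c0 ->]] := hclassP x; rewrite (homology_mapE c0 (cmap_cyc f c0)).
by move/esym/hclass_eq; exists c.
Qed.

Section CmapComp.
Variables (C D E : complex) (f : cmap C D) (g : cmap D E) (h : cmap C E).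
Hypothesis hE : forall n c, h n c = g n (f n c).

Lemma hinj_comp n : hinj f n -> hinj g n -> hinj h n.
Proof.
by move=> fi gi c c0; rewrite hE => /gi/fi; apply=> //; apply: cmap_cyc.
Qed.

Lemma hsurj_comp n : hsurj f n -> hsurj g n -> hsurj h n.
Proof.
move=> fs gs e /gs[d /fs[c c0 dc] ed]; exists c => //.
apply: bdry_trans ed _; rewrite hE -raddfB; exact: cmap_bdry.
Qed.
End CmapComp.

(* A cone argument: when j is a homology isomorphism T -> X, the quotient of Z
   by T has the homology of the shift of K. *)
Section RelativeHomology.
Variables (T K X Z : complex) (f : cmap T Z) (j : cmap T X).
Variables (i : cmap K X) (p : cmap X Z).
Hypothesis pj : forall n c, p n (j n c) = f n c.
Hypothesis f_inj : forall n c, f n c = 0 -> c = 0.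
Hypothesis i_inj : forall n c, i n c = 0 -> c = 0.
Hypothesis pi0 : forall n c, p n (i n c) = 0.
Hypothesis p_ker : forall n x, p n x = 0 -> exists k, i n k = x.
Hypothesis p_surj : forall n z, exists x, p n x = z.
Variable n : nat.
Hypothesis j_inj : hinj j n.
Hypothesis j_surj : hsurj j n.
Hypothesis j_surjS : hsurj j n.+1.

Let rel_bnd z : bnd (coker_complex f) n (qpi (range (f n.+1)) z) =
  qpi (range (f n)) (bnd Z n z).
Proof. exact: quot_mapE. Qed.

(** The cone zigzag: z is a relative cycle and u a lift of it to X. The boundary of z comes from T,
    so the boundary of u agrees with a chain of T up to a chain k of K, and k represents the
    image. *)
Let R (x : homology (coker_complex f) n.+1) (y : homology K n) : Prop :=
  exists z t u k (z0 : cyc (qpi (range (f n.+1)) z : coker_complex f n.+1))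
    (k0 : cyc k),
  [/\ x = hclass z0, y = hclass k0, bnd Z n z = f n t, p n.+1 u = z
    & bnd X n u = j n t + i n k].

Let cmap_out (C D : complex) (g : cmap C D) (c : C n) :
  bnd_out D n (g n c) = g n.-1 (bnd_out C n c).
Proof. by case: n c => [|m] c /=; rewrite ?raddf0 ?cmap_bnd. Qed.

Lemma rel_homology_shift : isomorphic (homology (coker_complex f) n.+1) (homology K n).
Proof.
have lift (z : Z n.+1) (t : T n) : bnd Z n z = f n t -> cyc t /\ exists u k,
    [/\ cyc k, p n.+1 u = z & bnd X n u = j n t + i n k].
  move=> zt; have t0 : cyc t.
    by apply: (f_inj (n := n.-1)); rewrite -(cmap_out f) -zt; apply: cyc_bnd.
  split=> //; have [u uz] := p_surj z.
  have [|k ik] := p_ker (x := bnd X n u - j n t).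
    by rewrite raddfB pj -cmap_bnd uz zt subrr.
  exists u, k; split=> //; last by rewrite ik addrC subrK.
  apply: (i_inj (n := n.-1)); rewrite -cmap_out ik.
  by apply: (cycB (cyc_bnd _)); apply: cmap_cyc.
have cycR (z : Z n.+1) : cyc (qpi (range (f n.+1)) z : coker_complex f n.+1) <->
    exists t, bnd Z n z = f n t.
  rewrite /cyc [bnd_out _ _ _]rel_bnd qpi_range_eq0.
  by split=> -[t zt]; exists t.
apply: (isomorphic_of_rel (R := R)).
- move=> x; have [c [c0 ->]] := hclassP x.
  pose z := repr (c : {quotz range (f n.+1)}).
  have cz : c = qpi (range (f n.+1)) z by rewrite repr_qpi.
  move: c0; rewrite cz => c0; have /cycR[t zt] := c0.
  have [t0 [u [k [k0 uz uk]]]] := lift _ _ zt.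
  by exists (hclass k0), z, t, u, k, c0, k0.
- move=> x x' y y' [z [t [u [k [z0 [k0 [-> -> zt uz uk]]]]]]].
  move=> [z' [t' [u' [k' [z0' [k0' [-> -> zt' uz' uk']]]]]]].
  have zz0 : cyc (qpi (range (f n.+1)) (z - z') : coker_complex f n.+1).
    by rewrite raddfB; apply: (cycB z0 z0').
  exists (z - z'), (t - t'), (u - u'), (k - k'), zz0, (cycB k0 k0').
  rewrite -(hclass_sub k0 k0'); split=> //.
  + rewrite -raddfB; congr (qpi _ _); apply: val_inj; exact/esym/raddfB.
  + by rewrite !raddfB zt zt'.
  + by rewrite raddfB uz uz'.
  + by rewrite !raddfB uk uk' addrACA opprD.
- move=> y [z [t [u [k [z0 [k0 [/esym/hclass_eq0 zb -> zt uz uk]]]]]]].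
  apply/hclass_eq0; move: zb => /bdryP[d].
  pose w := repr (d : {quotz range (f n.+2)}).
  rewrite -(repr_qpi (d : {quotz range (f n.+2)})) -/w [bnd _ _ _]quot_mapE => /esym/eqP.
  rewrite -subr_eq0 -raddfB => /eqP/qpi_range_eq0[s fs].
  have [v vw] := p_surj w.
  (* Since z differs from the boundary of w by a chain s of T, correcting u by s and by a lift v of
     w lands in K, and the boundary of the result is k. *)
  have [|l il] := p_ker (x := u - j n.+1 s - bnd X n.+1 v).
    by rewrite !raddfB pj uz -cmap_bnd vw fs subKr subrr.
  have /f_inj/eqP : f n (bnd T n s - t) = 0.
    by rewrite raddfB -cmap_bnd fs raddfB bnd_bnd subr0 zt subrr.
  rewrite subr_eq0 => /eqP st; apply/bdryP; exists l.
  apply/eqP; rewrite -subr_eq0; apply/eqP/i_inj; rewrite raddfB -cmap_bnd il.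
  by rewrite !raddfB bnd_bnd subr0 uk cmap_bnd st [j n t + _]addrC addrK subrr.
- move=> x [z [t [u [k [z0 [k0 [-> /esym/hclass_eq0/bdryP[l lk] zt uz uk]]]]]]].
  have [t0 _] := lift _ _ zt; apply/hclass_eq0.
  have uE : bnd X n (u - i n.+1 l) = j n t.
    by rewrite raddfB cmap_bnd lk uk addrK.
  (* Injectivity of [j] in degree n makes t bound. Surjectivity one degree higher then replaces the
     remaining cycle of X by one from T, which vanishes in the quotient. *)
  have /bdryP[t' t't] : t \in bdry T n.
    by apply: j_inj => //; apply/bdryP; eexists; exact: uE.
  have [|s s0 /bdryP[w wE]] := j_surjS (d := u - i n.+1 l - j n.+1 t').
    by rewrite /cyc /= raddfB uE cmap_bnd t't subrr.
  apply/bdryP; exists (qpi (range (f n.+2)) (p n.+2 w)).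
  have pE : p n.+1 (bnd X n.+1 w) = z - f n.+1 t' - f n.+1 s.
    by rewrite wE !raddfB pi0 subr0 uz !pj.
  rewrite [LHS]quot_mapE cmap_bnd pE; apply/eqP; rewrite -subr_eq0 -raddfB.
  apply/eqP/qpi_range_eq0; exists (- t' - s).
  by rewrite raddfB raddfN -[z - _ - _]addrA [z + _]addrC addrK.
- move=> y; have [k [k0 ->]] := hclassP y.
  have [t t0 /bdryP[u uE]] := j_surj (cmap_cyc i k0).
  have zt : bnd Z n (p n.+1 u) = f n (- t).
    by rewrite cmap_bnd uE raddfB pi0 pj raddfN sub0r.
  have z0 : cyc (qpi (range (f n.+1)) (p n.+1 u) : coker_complex f n.+1).
    by apply/cycR; exists (- t).
  exists (hclass z0), (p n.+1 u), (- t), u, k, z0, k0; split=> //.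
  by rewrite uE raddfN addrC.
Qed.

End RelativeHomology.

(** * The bar complex as an exact functor of its coefficients *)

Section BarFunctor.
Variable G : groupType.

Definition bmap (M N : gmodule G) (f : gmor M N) :
    cmap (bar_complex M) (bar_complex N) :=
  @bar_map G G M N idfun f (gmor_act f).

Lemma bmapU (M N : gmodule G) (f : gmor M N) n m (g : n.-tuple G) :
  bmap f n << m *g g >> = << f m *g g >>.
Proof. by rewrite [LHS]bar_map_funU; congr << _ *g _ >>; apply/val_inj/map_id. Qed.

Lemma bmap_coeff (M N : gmodule G) (f : gmor M N) n (c : bar_complex M n) g :
  (bmap f n c)@_g = f c@_g.
Proof.
apply: (malg_ext (f := mcoeff g \o bmap f n) (h := gmor_fun f \o mcoeff g)) => m k.
rewrite -[LHS]/((bmap f n << m *g k >>)@_g) -[RHS]/(f (<< m *g k >>@_g)).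
rewrite bmapU !mcoeffU.
by case: eqP => _; rewrite ?mulr1n // !mulr0n raddf0.
Qed.

(** Chains in degree n form a direct sum of copies of the coefficients indexed by n-tuples, and
    [bmap f] acts copy by copy. Surjectivity, injectivity and exactness of coefficient maps
    therefore pass to chains. *)
Lemma bmap_lift (M N : gmodule G) (f : gmor M N) n (d : bar_complex N n) :
  (forall g, exists m, f m = d@_g) -> exists c, bmap f n c = d.
Proof.
move=> fd; pose m g := projT1 (cid (fd g)).
have mP g : f (m g) = d@_g by rewrite /m; case: cid.
exists (\sum_(g <- msupp d) << m g *g g >>); rewrite raddf_sum [RHS]monalgE.
by apply: eq_bigr => g _; rewrite bmapU mP.
Qed.

Lemma bmap_surj (M N : gmodule G) (f : gmor M N) n (d : bar_complex N n) :
  (forall y, exists x, f x = y) -> exists c, bmap f n c = d.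
Proof. by move=> fs; apply: bmap_lift => g; apply: fs. Qed.

Lemma bmap_inj (M N : gmodule G) (f : gmor M N) n (c : bar_complex M n) :
  (forall x, f x = 0 -> x = 0) -> bmap f n c = 0 -> c = 0.
Proof.
by move=> fi fc; apply/malgP => g; rewrite mcoeff0; apply: fi; rewrite -bmap_coeff fc mcoeff0.
Qed.

Lemma bmap_exact (L M N : gmodule G) (e : gmor L M) (f : gmor M N) n
    (c : bar_complex M n) :
    (forall x, f x = 0 -> exists y, e y = x) ->
  bmap f n c = 0 -> exists b, bmap e n b = c.
Proof.
by move=> ef fc; apply: bmap_lift => g; apply: ef; rewrite -bmap_coeff fc mcoeff0.
Qed.

Lemma bmap_comp (L M N : gmodule G) (e : gmor L M) (f : gmor M N) (h : gmor L N)
    n (c : bar_complex L n) :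
  (forall x, f (e x) = h x) -> bmap f n (bmap e n c) = bmap h n c.
Proof. by move=> feh; apply/malgP => g; rewrite !bmap_coeff feh. Qed.

Lemma bmap0 (L M N : gmodule G) (e : gmor L M) (f : gmor M N) n (c : bar_complex L n) :
  (forall x, f (e x) = 0) -> bmap f n (bmap e n c) = 0.
Proof. by move=> fe; apply/malgP => g; rewrite !bmap_coeff fe mcoeff0. Qed.

Lemma gker_exact (M N : gmodule G) (f : gmor M N) x :
  f x = 0 -> exists y, gker_incl f y = x.
Proof. by move=> fx; exists (in_ker fx). Qed.

Lemma gker_incl_inj (M N : gmodule G) (f : gmor M N) x : gker_incl f x = 0 -> x = 0.
Proof. by move=> x0; apply: val_inj. Qed.

Lemma bar_bnd1 (M : gmodule G) m (g : 1.-tuple G) :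
  bnd (bar_complex M) 0 << m *g g >> =
    << gact M (thead g)^-1 m - m *g [tuple] >>.
Proof.
rewrite [LHS]bar_bndU !big_ord_recl big_ord0 addr0 /bar_coef /= mulr1z.
rewrite mulrN1z !(tuple0 (bar_face _ _)) -raddfB.
by congr (<< _ *g _ >>); apply/val_inj.
Qed.

Lemma bar0E (M : gmodule G) (c : bar_complex M 0) : c = << c@_[tuple] *g [tuple] >>.
Proof.
by apply/malgP => g; rewrite (tuple0 g) mcoeffUU.
Qed.

Lemma bdry_coinv (M : gmodule G) (m : M) :
  (<< m *g [tuple] >> \in bdry (bar_complex M) 0) = (m \in zspan (@coinv_rel G M)).
Proof.
apply/idP/idP => [/bdryP[d]|/zspanP]; last first.
  elim=> [_ [g [u ->]]||u v _ bu _ bv].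
  - apply/bdryP; exists << u *g [tuple g^-1%g] >>; rewrite bar_bnd1.
    by rewrite [thead _](tnth_nth 1%g) /= invgK.
  - by rewrite monalgU0; apply: rpred0.
  - by rewrite monalgUB; apply: rpredB.
pose q := qpi (@coinv_rel G M) \o mcoeff [tuple] \o bnd (bar_complex M) 0.
have q0 : q =1 \0.
  apply: (malg_ext (f := q) (h := \0)) => u g.
  rewrite -[LHS]/(qpi _ ((bnd (bar_complex M) 0 << u *g g >>)@_[tuple])).
  rewrite bar_bnd1 mcoeffUU; apply/eqP.
  rewrite -[X in _ == X]/(0 : {quotz @coinv_rel G M}).
  rewrite -(raddf0 (qpi (@coinv_rel G M))) quot_eq subr0.
  by apply/zspanP/zspan_gen; exists (thead g)^-1%g, u.
move=> dm; have /eqP := q0 d; rewrite -[q d]/(qpi _ ((bnd _ 0 d)@_[tuple])) dm mcoeffUU.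
rewrite -[X in _ == X]/(0 : {quotz @coinv_rel G M}).
by rewrite -(raddf0 (qpi (@coinv_rel G M))) quot_eq subr0.
Qed.

End BarFunctor.

(** The combinatorics of a prism: [F i j] stands for the i-th face of the j-th simplex of the prism,
    [H j i] for the j-th simplex of the prism over the i-th face. Off-diagonal terms cancel between
    the two sums, and the diagonal ones telescope to bottom minus top. *)
Lemma prism_sum (V : zmodType) (N : nat) (F H : nat -> nat -> V) :
    (forall i j, (i < j)%N -> F i j = H j.-1 i) ->
    (forall i j, (j.+1 < i)%N -> F i j = H j i.-1) ->
    (forall j, F j.+1 j = F j.+1 j.+1) ->
  \sum_(j < N.+1) (\sum_(i < N.+2) F i j *~ (-1) ^+ i) *~ (-1) ^+ j
  + \sum_(i < N.+1) (\sum_(j < N) H j i *~ (-1) ^+ j) *~ (-1) ^+ i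
  = F 0%N 0%N - F N.+1 N.+1.
Proof.
move=> Flt Fgt Fdiag.
pose e i j (v : V) := v *~ (-1) ^+ (i + j).
have eE i j v : v *~ (-1) ^+ i *~ (-1) ^+ j = e i j v.
  by rewrite /e -mulrzA -exprD.
have row j : (j < N.+1)%N ->
    (\sum_(i < N.+2) F i j *~ (-1) ^+ i) *~ (-1) ^+ j =
    \sum_(0 <= i < j) e i j (H j.-1 i) + (F j j - F j.+1 j.+1)
      - \sum_(j.+1 <= i < N.+1) e i j (H j i).
  move=> lt_jN; rewrite mulrz_suml.
  rewrite (eq_bigr (fun i : 'I_ _ => e i j (F i j))); last by move=> i _; apply: eE.
  rewrite -(big_mkord xpredT (fun i => e i j (F i j))).
  rewrite (big_cat_nat (n := j)) //=; last by lia.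
  rewrite (big_cat_nat (m := j) (n := j.+2)) //=; [|lia..].
  rewrite addrA; congr (_ + _ + _).
  - rewrite big_nat [RHS]big_nat; apply: eq_bigr => i /andP[_ lt_ij].
    by rewrite Flt.
  - rewrite !big_nat_recl // big_geq // addr0 /e addnn -mul2n exprM sqrrN !expr1n.
    rewrite addSn exprS addnn -mul2n exprM sqrrN !expr1n mulr1 mulr1z mulrN1z.
    by rewrite Fdiag.
  - rewrite big_add1 /= -sumrN big_nat [RHS]big_nat.
    apply: eq_bigr => i /andP[lt_ji _].
    by rewrite Fgt // /e addSn exprS mulN1r mulrNz.
rewrite (eq_bigr _ (fun (j : 'I_N.+1) _ => row j (ltn_ord j))) sumrB big_split /=.
have -> : \sum_(j < N.+1) (F j j - F j.+1 j.+1) = F 0%N 0%N - F N.+1 N.+1.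
  rewrite -(big_mkord xpredT (fun j => F j j - F j.+1 j.+1)).
  rewrite (eq_bigr (fun j => - F j.+1 j.+1 - - F j j)); last first.
    by move=> j _; rewrite opprK addrC.
  by rewrite (telescope_sumr (fun j => - F j j)) // opprK addrC.
rewrite big_ord_recl big_geq // add0r.
rewrite [X in _ - X + _]big_ord_recr [X in _ - (_ + X) + _]big_geq //= addr0.
set d := F 0%N 0%N - _; rewrite [_ + d - _]addrAC [_ + d + _]addrAC.
rewrite [X in X + d](_ : _ = 0) ?add0r // addrC.
under [X in X + _]eq_bigr do rewrite mulrz_suml.
rewrite exchange_big -sumrN -big_split -big_split big1 //= => j _.
rewrite /bump leq0n add1n add0n.
rewrite -(big_mkord xpredT (fun i => H j i *~ (-1) ^+ j *~ (-1) ^+ i)) /=.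
rewrite (big_cat_nat (n := j.+1)) //=; last by have := ltn_ord j; lia.
rewrite addrACA -sumrB [X in _ + X]big1 ?addr0 => [|i _]; last first.
  by rewrite mulrzAC eE subrr.
rewrite -big_split big1 //= => i _.
by rewrite mulrzAC eE /e addnS exprS mulN1r mulrNz subrr.
Qed.

(** * Chains with coefficients in a permutation module *)

Definition zmulr (V : zmodType) (v : V) : {additive int -> V} :=
  Additive (fun x y => mulrzBr v x y).

Section PermBar.
Variables (G : groupType) (S : choiceType) (act : G -> S -> S).
Hypotheses (act1 : forall s, act 1%g s = s).
Hypotheses (actM : forall g h s, act (g * h)%g s = act g (act h s)).
Local Notation M := (permmod act1 actM).

Lemma actKV g s : act g (act g^-1%g s) = s.
Proof. by rewrite -actM mulgV act1. Qed.

Lemma actK g s : act g^-1%g (act g s) = s.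
Proof. by rewrite -actM mulVg act1. Qed.

Definition pgen (s : S) : M := << 1%Z *g s >>.

Lemma pgen_act g s : gact M g (pgen s) = pgen (act g s).
Proof. exact: malg_mapU. Qed.

Definition cell n (s : S) (g : n.-tuple G) : bar_complex M n := << pgen s *g g >>.

Lemma cellZ n (s : S) (g : n.-tuple G) (z : int) :
  << (<< z *g s >> : M) *g g >> = cell s g *~ z :> bar_complex M n.
Proof.
by rewrite /cell /pgen -(raddfMz (mkmalgU g)) -(raddfMz (mkmalgU s)) intz.
Qed.

Lemma perm_ext n (V : zmodType) (f h : {additive bar_complex M n -> V}) :
  (forall s g, f (cell s g) = h (cell s g)) -> f =1 h.
Proof.
move=> fh; apply: malg_ext => m g.
apply: (malg_ext (f := f \o mkmalgU g) (h := h \o mkmalgU g)) => z s.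
by rewrite /= !cellZ !raddfMz fh.
Qed.

Section Lift.
Variables (n : nat) (V : zmodType) (F : S -> n.-tuple G -> V).

Definition perm_lift : {additive bar_complex M n -> V} :=
  malg_lift (fun g => malg_lift (fun s => zmulr (F s g))).

Lemma perm_liftE s g : perm_lift (cell s g) = F s g.
Proof.
rewrite [LHS]malg_liftU [LHS]malg_liftU; exact: mulr1z.
Qed.
End Lift.

(* The simplex with homogeneous coordinates x_0, ..., x_n, based at s: its faces
   delete one of the coordinates. *)
Definition verts n (x : nat -> G) (s : S) : bar_complex M n :=
  cell (act (x 0%N)^-1%g s) [tuple ((x j)^-1 * x j.+1)%g | j < n].

Lemma eq_verts n x y s : (forall k, (k <= n)%N -> x k = y k) ->
  verts n x s = verts n y s.
Proof.
move=> xy; rewrite /verts (xy 0%N (leq0n n)); congr cell.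
by apply: eq_from_tnth => j; rewrite !tnth_mktuple !xy // ltnW.
Qed.

Lemma verts_act n u x s : verts n (fun k => u * x k)%g (act u s) = verts n x s.
Proof.
rewrite /verts /= invgM actM actK; congr cell.
apply: eq_from_tnth => j; rewrite !tnth_mktuple.
by rewrite invgM -mulgA mulKg.
Qed.

(** Deleting x_0 turns the coefficient x_0^-1 s into x_1^-1 s, which is the action of the inverse of
    the first bar entry in the zeroth face. *)
Lemma bnd_verts n x s : bnd (bar_complex M) n (verts n.+1 x s) =
  \sum_(i < n.+2) verts n (x \o bump i) s *~ (-1) ^+ i.
Proof.
set g := [tuple ((x j)^-1 * x j.+1)%g | j < n.+1].
set m := pgen (act (x 0%N)^-1%g s).
have faceE (i : 'I_n.+2) :
    bar_face i g = [tuple (((x \o bump i) j)^-1 * (x \o bump i) j.+1)%g | j < n].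
  apply: eq_from_tnth => j; rewrite tnth_mktuple (tnth_nth 1%g) nth_bar_face //.
  have lt_j := ltn_ord j; have lt_j1 := ltnW lt_j.
  have nthE k (lt_k : (k < n.+1)%N) :
      nth 1%g [tuple ((x j)^-1 * x j.+1)%g | j < n.+1] k = ((x k)^-1 * x k.+1)%g.
    by rewrite -[k]/(nat_of_ord (Ordinal lt_k)) -tnth_nth tnth_mktuple.
  rewrite !nthE ?ltnS // /= /bump.
  case: (ltngtP j.+1 i) => [lt_ji|lt_ij|<-].
  - by have -> : (i <= j)%N = false by lia.
  - by have -> : (i <= j)%N by lia.
  - by rewrite ltnn add0n add1n mulgA mulgK.
have coefE (i : 'I_n.+2) : bar_coef M i g m = pgen (act ((x \o bump i) 0%N)^-1%g s).
  case: i => [[|i] lt_i] //=; rewrite [LHS]pgen_act.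
  by rewrite /thead tnth_mktuple -actM invgM invgK -mulgA mulgV mulg1.
apply: (etrans (bar_bndU g m)); apply: eq_bigr => i _.
by rewrite faceE coefE.
Qed.

(** The homogeneous coordinates 1, g_1, g_1 g_2, ... of a bar simplex, normalised to start at 1. *)
Definition left_prod n (g : n.-tuple G) (k : nat) : G :=
  iteri k (fun j y => y * nth 1 g j)%g 1%g.

Lemma left_prodS n (g : n.-tuple G) k : left_prod g k.+1 = (left_prod g k * nth 1 g k)%g.
Proof. by []. Qed.

Lemma verts_left_prod n s (g : n.-tuple G) : verts n (left_prod g) s = cell s g.
Proof.
rewrite /verts /left_prod /= invg1 act1; congr cell.
by apply: eq_from_tnth => j; rewrite tnth_mktuple /= mulKg (tnth_nth 1%g).
Qed.

Lemma left_prod_verts n (x : nat -> G) k : (k <= n)%N ->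
  left_prod [tuple ((x j)^-1 * x j.+1)%g | j < n] k = ((x 0%N)^-1 * x k)%g.
Proof.
elim: k => [|k IHk] lt_kn; first by rewrite mulVg.
rewrite left_prodS IHk ?(ltnW lt_kn) //.
rewrite -[k in nth _ _ k]/(nat_of_ord (Ordinal lt_kn)) -tnth_nth tnth_mktuple /=.
by rewrite -mulgA mulVKg.
Qed.

Section Equivariant.
Variables (n : nat) (V : zmodType) (E : (nat -> G) -> S -> V).
Hypothesis E_loc : forall x y s, (forall k, (k <= n)%N -> x k = y k) -> E x s = E y s.
Hypothesis E_act : forall u x s, E (fun k => u * x k)%g (act u s) = E x s.

(** Lets a map be defined on homogeneous coordinates although chains are stored inhomogeneously:
    invariance under G reduces every simplex to the one with first vertex 1. *)
Lemma perm_lift_verts x s :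
  perm_lift (fun s (g : n.-tuple G) => E (left_prod g) s) (verts n x s) = E x s.
Proof.
rewrite /verts perm_liftE -[RHS](E_act (x 0%N)^-1%g).
by apply: E_loc => k le_kn; rewrite left_prod_verts.
Qed.
End Equivariant.

Section Retraction.
Variables (r : S -> S) (sigma : S -> G).
Hypothesis sigmaE : forall s, act (sigma s) (r s) = s.

(** The vertex x_k is replaced by an element that carries the representative of x_k^-1 s to s. If r
    is constant on orbits, quotients of consecutive new vertices stabilize the representative. *)
Let Y (x : nat -> G) (s : S) (k : nat) := (x k * sigma (act (x k)^-1 s))%g.
Let prism (i : nat) (x y : nat -> G) (k : nat) := if (k <= i)%N then y k else x k.-1.

Let Y_act u x s : Y (fun k => u * x k)%g (act u s) =1 (fun k => u * Y x s k)%g.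
Proof. by move=> k; rewrite /Y invgM actM actK mulgA. Qed.

Definition straighten n : {additive bar_complex M n -> bar_complex M n} :=
  perm_lift (fun s (g : n.-tuple G) => verts n (Y (left_prod g) s) s).

Let straighten_verts n x s : straighten n (verts n x s) = verts n (Y x s) s.
Proof.
apply: (perm_lift_verts (E := fun x s => verts n (Y x s) s)) => [{}x y {}s xy|u {}x {}s].
  by apply: eq_verts => k le_kn; rewrite /Y xy.
by rewrite -[RHS](verts_act _ u); apply: eq_verts => k _; apply: Y_act.
Qed.

(** The bar entries Y_j^-1 Y_(j+1) of the straightened simplex, expressed by the entries of g. *)
Definition straight n s (g : n.-tuple G) : n.-tuple G :=
  [tuple let s' := act (left_prod g j)^-1%g s in
         ((sigma s')^-1 * tnth g j * sigma (act (tnth g j)^-1 s'))%g | j < n].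

Lemma straighten_cell n s (g : n.-tuple G) :
  straighten n (cell s g) = cell (r s) (straight s g).
Proof.
rewrite -verts_left_prod straighten_verts /verts; congr cell.
  by rewrite /Y invg1 act1 mul1g -{2}(sigmaE s) actK.
apply: eq_from_tnth => j; rewrite !tnth_mktuple /Y left_prodS (tnth_nth 1%g).
by rewrite !invgM actM !mulgA -!mulgA mulKg.
Qed.

Lemma straighten_bnd n c :
  bnd (bar_complex M) n (straighten n.+1 c) = straighten n (bnd (bar_complex M) n c).
Proof.
apply: (perm_ext (f := bnd _ n \o straighten n.+1) (h := straighten n \o bnd _ n)).
move=> s g; rewrite -[LHS]/(bnd (bar_complex M) n (straighten n.+1 (cell s g))).
rewrite -[RHS]/(straighten n (bnd (bar_complex M) n (cell s g))).
rewrite -verts_left_prod straighten_verts !bnd_verts raddf_sum.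
by apply: eq_bigr => i _; rewrite raddfMz straighten_verts.
Qed.

(** The prism operator; its i-th simplex has the vertices Y_0, ..., Y_i, x_i, ..., x_n. *)
Let htpy n : {additive bar_complex M n -> bar_complex M n.+1} :=
  perm_lift (fun s (g : n.-tuple G) =>
    \sum_(i < n.+1) verts n.+1 (prism i (left_prod g) (Y (left_prod g) s)) s *~ (-1) ^+ i).

Let htpy_verts n x s : htpy n (verts n x s) =
  \sum_(i < n.+1) verts n.+1 (prism i x (Y x s)) s *~ (-1) ^+ i.
Proof.
pose E x s := \sum_(i < n.+1) verts n.+1 (prism i x (Y x s)) s *~ (-1) ^+ i.
have E_loc x' y' s' : (forall k, (k <= n)%N -> x' k = y' k) -> E x' s' = E y' s'.
  move=> xy; apply: eq_bigr => i _; have lt_in := ltn_ord i.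
  rewrite (eq_verts (y := prism i y' (Y y' s'))) // => k le_kn.
  by rewrite /prism /Y; case: ifP => le_ki; rewrite xy //; lia.
have E_act u x' s' : E (fun k => u * x' k)%g (act u s') = E x' s'.
  apply: eq_bigr => i _; rewrite -[verts _ _ s'](verts_act _ u).
  rewrite (eq_verts (y := fun k => u * prism i x' (Y x' s') k)%g) // => k _.
  by rewrite /prism; case: ifP => // _; apply: Y_act.
exact: (perm_lift_verts E_loc E_act).
Qed.

Lemma straighten_htpy n (c : bar_complex M n.+1) :
  bnd (bar_complex M) n.+1 (htpy n.+1 c) + htpy n (bnd (bar_complex M) n c) =
  c - straighten n.+1 c.
Proof.
have f1 : zmod_morphism (fun c : bar_complex M n.+1 =>
    bnd (bar_complex M) n.+1 (htpy n.+1 c) + htpy n (bnd (bar_complex M) n c)).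
  by move=> x y; rewrite !raddfB addrACA opprD.
have f2 : zmod_morphism (fun c : bar_complex M n.+1 => c - straighten n.+1 c).
  by move=> x y; rewrite raddfB !opprB [LHS]addrACA [RHS]addrACA [- y - _]addrC.
apply: (perm_ext (f := Additive f1) (h := Additive f2)) => s g.
rewrite -[LHS]/(bnd (bar_complex M) n.+1 (htpy n.+1 (cell s g)) +
  htpy n (bnd (bar_complex M) n (cell s g))).
rewrite -[RHS]/(cell s g - straighten n.+1 (cell s g)).
rewrite -verts_left_prod straighten_verts; set x := left_prod g.
rewrite htpy_verts bnd_verts !raddf_sum.
under eq_bigr do rewrite raddfMz bnd_verts.
under [X in _ + X]eq_bigr do rewrite raddfMz htpy_verts.
pose F i j := verts n.+1 (prism j x (Y x s) \o bump i) s.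
pose H j i := verts n.+1 (prism j (x \o bump i) (Y (x \o bump i) s)) s.
have F_lt i j : (i < j)%N -> F i j = H j.-1 i.
  move=> lt_ij; apply: eq_verts => k _; rewrite /= /prism /Y /bump /=.
  by case: ifP => h1; case: ifP => h2;
    first [by [] | lia | congr x; lia | congr (x _ * sigma (act (x _)^-1 s))%g; lia].
have F_gt i j : (j.+1 < i)%N -> F i j = H j i.-1.
  move=> lt_ji; apply: eq_verts => k _; rewrite /= /prism /Y /bump /=.
  by case: ifP => h1; case: ifP => h2;
    first [by [] | lia | congr x; lia | congr (x _ * sigma (act (x _)^-1 s))%g; lia].
have F_diag j : F j.+1 j = F j.+1 j.+1.
  apply: eq_verts => k _; rewrite /= /prism /bump.
  by case: ifP => h1; case: ifP => h2;
    first [by [] | lia | congr x; lia | congr (x _ * sigma (act (x _)^-1 s))%g; lia].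
apply: (etrans (prism_sum n.+1 F_lt F_gt F_diag)); congr (_ - _).
apply: eq_verts => k le_kn; rewrite /= /prism /bump.
by rewrite ltnNge le_kn add0n (leq_trans le_kn).
Qed.

Lemma straighten_homologous n (c : bar_complex M n.+1) :
  cyc c -> c - straighten n.+1 c \in bdry (bar_complex M) n.+1.
Proof.
move=> c0; apply/bdryP; exists (htpy n.+1 c).
by rewrite -straighten_htpy [bnd _ n c]c0 raddf0 addr0.
Qed.

End Retraction.
End PermBar.

(** * Shapiro's lemma for a transitive action *)

Section Shapiro.
Variables (G H : groupType) (S : choiceType) (act : G -> S -> S).
Hypotheses (act1 : forall s, act 1%g s = s).
Hypotheses (actM : forall g h s, act (g * h)%g s = act g (act h s)).
Local Notation M := (permmod act1 actM).
Variables (phi : UMagmaMorphism.type H G) (tau : G -> H) (s0 : S).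
Hypothesis act_trans : forall s, exists g, act g s0 = s.
Hypothesis phi_stab : forall h, act (phi h) s0 = s0.
Hypothesis tau_phi : forall h, tau (phi h) = h.
Hypothesis phi_tau : forall g, act g s0 = s0 -> phi (tau g) = g.

Fact shapiro_act h (z : int) :
  mkmalgU s0 z = gact M (phi h) (mkmalgU s0 z).
Proof. by rewrite [RHS]malg_mapU phi_stab. Qed.

(** The map makes sense for any group that fixes [s0]. It is also applied to the torus at oo, where
    the full stabilizer is the Borel subgroup. *)
Definition shapiro : cmap (group_complex H int) (bar_complex M) :=
  @bar_map H G (trivmod H int) M phi (mkmalgU s0) shapiro_act.

Lemma shapiroE n (h : n.-tuple H) :
  shapiro n << 1%Z *g h >> = cell act1 actM s0 (map_tuple phi h).
Proof. exact: bar_map_funU. Qed.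

(** The value at [s0] is fixed to be 1 so that [unshapiro] is a left inverse of [shapiro] already on
    chains. *)
Definition transport (s : S) : G :=
  if s == s0 then 1%g else projT1 (cid (act_trans s)).

Lemma transportE s : act (transport s) s0 = s.
Proof.
by rewrite /transport; case: eqP => [->|_]; [rewrite act1 | case: cid].
Qed.

Lemma transport0 : transport s0 = 1%g.
Proof. by rewrite /transport eqxx. Qed.

Definition unshapiro n : {additive bar_complex M n -> group_complex H int n} :=
  perm_lift act1 actM (fun s (g : n.-tuple G) =>
    << 1%Z *g map_tuple tau (straight act transport s g) >>).

Lemma unshapiroE n s (g : n.-tuple G) : unshapiro n (cell act1 actM s g) =
  << 1%Z *g map_tuple tau (straight act transport s g) >>.
Proof. exact: perm_liftE. Qed.

Lemma int_ext n (V : zmodType) (f h : {additive group_complex H int n -> V}) :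
  (forall g, f << 1%Z *g g >> = h << 1%Z *g g >>) -> f =1 h.
Proof.
move=> fh; apply: malg_ext => m g.
have -> : << m *g g >> = << 1%Z *g g >> *~ m :> {malg int[n.-tuple H]}.
  by rewrite -(raddfMz (mkmalgU g)) intz.
by rewrite [LHS]raddfMz [RHS]raddfMz fh.
Qed.

Lemma shapiroK n (c : group_complex H int n) : unshapiro n (shapiro n c) = c.
Proof.
apply: (int_ext (f := unshapiro n \o shapiro n) (h := idfun)) => g.
rewrite -[LHS]/(unshapiro n (shapiro n << 1%Z *g g >>)) shapiroE unshapiroE.
congr mkmalgU; apply: eq_from_tnth => j; rewrite tnth_map tnth_mktuple !tnth_map.
have prefix_stab k : act (left_prod (map_tuple phi g) k)^-1%g s0 = s0.
  have stabV x : act x s0 = s0 -> act x^-1%g s0 = s0.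
    by move=> xs; rewrite -{1}xs -actM mulVg act1.
  apply: stabV; elim: k => [|k IHk]; first exact: act1.
  rewrite left_prodS actM (_ : act (nth _ _ _) s0 = s0) //.
  case: (ltnP k n) => [lt_kn|le_nk]; last by rewrite nth_default ?act1 ?size_tuple.
  by rewrite -[k]/(nat_of_ord (Ordinal lt_kn)) -tnth_nth tnth_map.
have phiV : act (phi (tnth g j))^-1%g s0 = s0.
  by rewrite -{1}(phi_stab (tnth g j)) -actM mulVg act1.
by rewrite prefix_stab /= phiV transport0 invg1 mul1g mulg1 tau_phi.
Qed.

Lemma unshapiroK n (c : bar_complex M n) :
  shapiro n (unshapiro n c) = straighten act1 actM transport n c.
Proof.
pose f := shapiro n \o unshapiro n.
apply: (perm_ext (f := f) (h := straighten act1 actM transport n)) => s g.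
rewrite -[LHS]/(shapiro n (unshapiro n (cell act1 actM s g))).
rewrite unshapiroE shapiroE (straighten_cell act1 actM transportE).
congr cell; apply: eq_from_tnth => j; rewrite !tnth_map phi_tau // tnth_ord_tuple /=.
set s' := act _ s; rewrite actM transportE actM (actKV act1 actM).
by rewrite -{2}(transportE s') (actK act1 actM).
Qed.

(** No computation with tuples: [shapiro] is a chain map with a left inverse, and its composite with
    [unshapiro] is the chain map [straighten]. *)
Lemma unshapiro_bnd n (c : bar_complex M n.+1) :
  bnd (group_complex H int) n (unshapiro n.+1 c) = unshapiro n (bnd (bar_complex M) n c).
Proof.
by rewrite -[LHS]shapiroK -cmap_bnd unshapiroK straighten_bnd -unshapiroK shapiroK.
Qed.

Lemma unshapiro_homologous n (c : bar_complex M n.+1) :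
  cyc c -> c - shapiro n.+1 (unshapiro n.+1 c) \in bdry (bar_complex M) n.+1.
Proof.
by rewrite unshapiroK; apply: straighten_homologous.
Qed.

Lemma unshapiro_cyc n (c : bar_complex M n.+1) : cyc c -> cyc (unshapiro n.+1 c).
Proof. by move=> c0; apply: (etrans (unshapiro_bnd c)); rewrite [bnd _ n c]c0 raddf0. Qed.

Lemma unshapiro_bdry n (c : bar_complex M n) :
  c \in bdry (bar_complex M) n -> unshapiro n c \in bdry (group_complex H int) n.
Proof. by move=> /bdryP[d <-]; rewrite -unshapiro_bnd bdry_bnd. Qed.

Lemma shapiro_inj n : hinj shapiro n.
Proof. by move=> c _ /unshapiro_bdry; rewrite shapiroK. Qed.

Lemma shapiro_surj n : hsurj shapiro n.+1.
Proof.
move=> d d0; exists (unshapiro n.+1 d); first exact: unshapiro_cyc.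
exact: unshapiro_homologous.
Qed.

End Shapiro.

(** * Unimodular vectors and simplices *)

Section ImagePredicate.
Variables (U V : zmodType) (f : {additive U -> V}).

Definition im_pred : {pred V} := fun y => `[< exists x, f x = y >].

Lemma im_predP y : reflect (exists x, f x = y) (y \in im_pred).
Proof. exact: asboolP. Qed.

Fact im_pred_closed : zmod_closed im_pred.
Proof.
split=> [|x y /im_predP[c <-] /im_predP[d <-]]; apply/im_predP.
  by exists 0; rewrite raddf0.
by exists (c - d); rewrite raddfB.
Qed.
HB.instance Definition _ := GRing.isZmodClosed.Build V im_pred im_pred_closed.
End ImagePredicate.

Section GmoduleAdditive.
Variables (G : groupType) (M : gmodule G) (g : G) (x y : M).

Lemma gact0 : gact M g 0 = 0. Proof. exact: raddf0. Qed.
Lemma gactD : gact M g (x + y) = gact M g x + gact M g y. Proof. exact: raddfD. Qed.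
Lemma gactB : gact M g (x - y) = gact M g x - gact M g y. Proof. exact: raddfB. Qed.

End GmoduleAdditive.

Section Geometry.
Variable A : comUnitRingType.
Local Notation vect := 'cV[A]_2.
Local Notation SL2 := (SL2 A).
Local Notation X := (X A).

Definition vec (a b : A) : vect := \col_i if i == 0 then a else b.

Lemma vec0 a b : vec a b 0 0 = a. Proof. by rewrite mxE. Qed.
Lemma vec1 a b : vec a b 1 0 = b. Proof. by rewrite mxE. Qed.

Lemma vecE (u : vect) : u = vec (u 0 0) (u 1 0).
Proof.
apply/colP => i; rewrite mxE; case: i => [[|[|//]] lt_i] /=; congr (u _ _);
  exact/val_inj.
Qed.

Lemma e1E : e1 A = vec 1 0.
Proof. by rewrite [e1 A]vecE !mxE. Qed.

Lemma e2E : e2 A = vec 0 1.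
Proof. by rewrite [e2 A]vecE !mxE. Qed.

Lemma vecZ c a b : c *: vec a b = vec (c * a) (c * b).
Proof. by rewrite [LHS]vecE !mxE. Qed.

Lemma vecD a b c d : vec a b + vec c d = vec (a + c) (b + d).
Proof. by rewrite [LHS]vecE !mxE. Qed.

Lemma mul_vec (M : 'M[A]_2) a b :
  M *m vec a b = vec (M 0 0 * a + M 0 1 * b) (M 1 0 * a + M 1 1 * b).
Proof. by rewrite [LHS]vecE !mxE !sum2 !vec0 !vec1. Qed.

Lemma E_vec x a b : val (SL2_E x) *m vec a b = vec (x * a + b) (- a).
Proof. by rewrite mul_vec !mxE /= mul1r mul0r addr0 mulN1r. Qed.

Lemma SL2_eq (g h : SL2) :
  val g *m e1 A = val h *m e1 A -> val g *m e2 A = val h *m e2 A -> g = h.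
Proof.
rewrite e1E e2E !mul_vec !mulr1 !mulr0 !addr0 !add0r => g1 g2; apply/val_inj.
have := congr1 (fun u : vect => u 0 0) g1; have := congr1 (fun u : vect => u 1 0) g1.
have := congr1 (fun u : vect => u 0 0) g2; have := congr1 (fun u : vect => u 1 0) g2.
rewrite !vec0 !vec1 => h1 h2 h3 h4; apply/matrixP => i j.
have I2 (k : 'I_2) : k = 0 \/ k = 1.
  by case: k => [[|[|//]] lt_k]; [left | right]; apply/val_inj.
by case: (I2 i) => ->; case: (I2 j) => ->.
Qed.

Definition dt (u v : vect) : A := u 0 0 * v 1 0 - v 0 0 * u 1 0.

Lemma dt_unitmx (u v : vect) : ((row_mx u v : 'M[A]_2) \in unitmx) = (dt u v \is a GRing.unit).
Proof. by rewrite unitmxE det_row_mx2. Qed.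

Lemma dt_vec a b c d : dt (vec a b) (vec c d) = a * d - c * b.
Proof. by rewrite /dt !vec0 !vec1. Qed.

Lemma dtC u v : dt u v = - dt v u.
Proof. by rewrite /dt opprB. Qed.

Lemma dt_act (g : SL2) u v : dt (val g *m u) (val g *m v) = dt u v.
Proof.
have /eqP := valP g; rewrite det2; move: (val g) => M g1.
by rewrite [u]vecE [v]vecE !mul_vec !dt_vec -[RHS]mul1r -g1; ring.
Qed.

Lemma dt_unitC u v : (dt u v \is a GRing.unit) = (dt v u \is a GRing.unit).
Proof. by rewrite dtC unitrN. Qed.

Lemma dt_unimodular (u v : vect) : dt u v \is a GRing.unit -> unimodular u.
Proof. by rewrite -dt_unitmx; apply: unimodular_row. Qed.

Lemma line_scale c (u : vect) : c \is a GRing.unit -> line (c *: u) = line u.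
Proof.
move=> uc; apply/seteqP; split=> w [a _ <-]; first by exists (a * c); rewrite ?scalerA.
by exists (a / c); rewrite // scalerA divrK.
Qed.

Lemma line_mem (u v : vect) : line u = line v -> exists c, u = c *: v.
Proof.
move=> uv; have : line v u by rewrite -uv; exists 1; rewrite ?scale1r.
by case=> c _ <-; exists c.
Qed.

(** Total in the vectors, with value 0 on families that do not span a simplex. Chains can thus be
    rewritten through their vectors without transporting proofs. *)
Definition simp n (v : 'I_n.+1 -> vect) : X n :=
  oapp (@X_gen A n) 0 (insub [tuple line (v i) | i < n.+1]).

Definition admissible n (v : 'I_n.+1 -> vect) :=
  (forall i, unimodular (v i)) /\
  forall i j, i != j -> dt (v i) (v j) \is a GRing.unit.

Lemma simpE n (v : 'I_n.+1 -> vect) : admissible v ->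
  exists2 s : simplex A n, simp v = X_gen s & forall i, tnth (val s) i = line (v i).
Proof.
move=> [v1 v2]; rewrite /simp; case: insubP => [s _ sE|].
  by exists s => // i; rewrite sE tnth_mktuple.
case/negP; apply/asboolP; exists v; split=> // [i|i j ne_ij].
  by rewrite tnth_mktuple.
by rewrite dt_unitmx v2.
Qed.

Lemma simp_lines n (s : simplex A n) (v : 'I_n.+1 -> vect) :
  (forall i, tnth (val s) i = line (v i)) -> simp v = X_gen s.
Proof.
move=> sv; rewrite /simp (_ : [tuple line (v i) | i < n.+1] = val s) ?valK //.
by apply: eq_from_tnth => i; rewrite tnth_mktuple sv.
Qed.

Lemma simp_surj n (s : simplex A n) :
  exists2 v : 'I_n.+1 -> vect, admissible v & X_gen s = simp v.
Proof.
have [v [v1 sv v2]] := is_simplex_valP s; exists v; last by rewrite (simp_lines sv).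
by split=> // i j ne_ij; rewrite -dt_unitmx v2.
Qed.

Lemma eq_simp n (v w : 'I_n.+1 -> vect) :
  (forall i, line (v i) = line (w i)) -> simp v = simp w.
Proof. by move=> vw; rewrite /simp; under eq_mktuple do rewrite vw. Qed.

Lemma simp_act n (v : 'I_n.+1 -> vect) g : admissible v ->
  gact (X n) g (simp v) = simp (fun i => val g *m v i).
Proof.
move=> /simpE[s -> sv]; rewrite gact_gen (simp_lines (s := simplex_act g s)) // => i.
by rewrite tnth_map sv line_act_line.
Qed.

Lemma partial_simp n (v : 'I_n.+2 -> vect) : admissible v ->
  partial A n (simp v) = \sum_(i < n.+2) simp (v \o lift i) *~ (-1) ^+ i.
Proof.
move=> /simpE[s -> sv]; rewrite partial_gen; apply: eq_bigr => i _.
by rewrite (simp_lines (s := face i s)) // => j; rewrite tnth_mktuple sv.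
Qed.

Lemma X_ext n (V : zmodType) (f h : {additive X n -> V}) :
  (forall s, f (X_gen s) = h (X_gen s)) -> f =1 h.
Proof.
move=> fh; apply: malg_ext => m s.
have -> : << m *g s >> = X_gen s *~ m by rewrite -(raddfMz (mkmalgU s)) intz.
by rewrite [LHS]raddfMz [RHS]raddfMz fh.
Qed.

Definition X_lift n (V : zmodType) (F : simplex A n -> V) : {additive X n -> V} :=
  malg_lift (fun s => zmulr (F s)).

Lemma X_liftE n (V : zmodType) (F : simplex A n -> V) s : X_lift F (X_gen s) = F s.
Proof. by rewrite [LHS]malg_liftU; apply: mulr1z. Qed.

Definition pt (u : vect) : X 0 := simp (fun=> u).
Definition edge (u v : vect) : X 1 := simp (fun i : 'I_2 => nth 0 [:: u; v] i).
Definition tri (u v w : vect) : X 2 := simp (fun i : 'I_3 => nth 0 [:: u; v; w] i).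

Lemma pt_admissible u : unimodular u -> @admissible 0 (fun=> u).
Proof. by move=> u1; split=> // i j; rewrite !ord1. Qed.

Lemma edge_admissible u v : dt u v \is a GRing.unit ->
  @admissible 1 (fun i => nth 0 [:: u; v] i).
Proof.
move=> uv; have vu := uv; rewrite dt_unitC in vu.
split=> [[[|[|//]] lt_i]|[[|[|//]] lt_i] [[|[|//]] lt_j] //=].
  exact: dt_unimodular uv.
exact: dt_unimodular vu.
Qed.

Lemma tri_admissible u v w : dt u v \is a GRing.unit -> dt u w \is a GRing.unit ->
  dt v w \is a GRing.unit -> @admissible 2 (fun i => nth 0 [:: u; v; w] i).
Proof.
move=> uv uw vw; have vu := uv; rewrite dt_unitC in vu.
have wu := uw; rewrite dt_unitC in wu; have wv := vw; rewrite dt_unitC in wv.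
split=> [[[|[|[|//]]] lt_i]|[[|[|[|//]]] lt_i] [[|[|[|//]]] lt_j] //=].
- exact: dt_unimodular uv.
- exact: dt_unimodular vu.
- exact: dt_unimodular wu.
Qed.

Lemma eq_pt (u v : vect) : line u = line v -> pt u = pt v.
Proof. by move=> uv; apply: eq_simp. Qed.

Lemma eq_edge (u v u' v' : vect) : line u = line u' -> line v = line v' -> edge u v = edge u' v'.
Proof. by move=> uu vv; apply: eq_simp => -[[|[|//]] lt_i]. Qed.

Lemma pt_act g u : unimodular u -> gact (X 0) g (pt u) = pt (val g *m u).
Proof. by move=> u1; rewrite simp_act //; apply: pt_admissible. Qed.

Lemma edge_act g u v : dt u v \is a GRing.unit ->
  gact (X 1) g (edge u v) = edge (val g *m u) (val g *m v).
Proof.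
move=> uv; rewrite simp_act; last exact: edge_admissible.
by apply: eq_simp => -[[|[|//]] lt_i].
Qed.

Lemma partial_edge u v : dt u v \is a GRing.unit -> partial A 0 (edge u v) = pt v - pt u.
Proof.
move=> /edge_admissible/partial_simp ->; rewrite !big_ord_recl big_ord0 addr0.
by rewrite mulr1z mulrN1z; congr (_ - _); apply: eq_simp => -[[|//] lt_i].
Qed.

Lemma partial_tri u v w : dt u v \is a GRing.unit -> dt u w \is a GRing.unit ->
  dt v w \is a GRing.unit ->
  partial A 1 (tri u v w) = edge v w - edge u w + edge u v.
Proof.
move=> uv uw vw; have /partial_simp -> := tri_admissible uv uw vw.
rewrite !big_ord_recl big_ord0 addr0 mulr1z mulrN1z sqrrN expr1n mulr1z addrA.
by congr (_ - _ + _); apply: eq_simp => -[[|[|//]] lt_i].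
Qed.

Lemma edge_surj (s : simplex A 1) :
  exists u v, dt u v \is a GRing.unit /\ X_gen s = edge u v.
Proof.
have [v [_ v2] ->] := simp_surj s; exists (v 0), (v 1); split; first exact: v2.
by apply: eq_simp => -[[|[|//]] lt_i] /=; congr (line (v _)); apply/val_inj.
Qed.

Lemma pt_surj (s : simplex A 0) : exists2 u, unimodular u & X_gen s = pt u.
Proof.
have [v [v1 _] ->] := simp_surj s; exists (v 0) => //.
by apply: eq_simp => i; rewrite ord1.
Qed.

Lemma unimodular_act (g : SL2) (u : vect) : unimodular u -> unimodular (val (g : SL2) *m u).
Proof.
by move=> [M uM <-]; exists (val g *m M); rewrite ?unitmx_mul ?SL2_unit // !colE mulmxA.
Qed.

Lemma unimodular_e1 : unimodular (e1 A).
Proof. by apply: (@dt_unimodular _ (e2 A)); rewrite e1E e2E dt_vec mulr0 mulr1 subr0 unitr1. Qed.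

Lemma unimodular_trans (u : vect) : unimodular u -> exists g : SL2, val g *m e1 A = u.
Proof.
move=> [M]; rewrite unitmxE => uM <-; set d := \det M in uM *.
pose N : 'M[A]_2 := mx2 (M 0 0) (M 0 1 / d) (M 1 0) (M 1 1 / d).
have N1 : \det N == 1.
  by rewrite det2 !mxE /= -(mulrV uM) /d det2; apply/eqP; ring.
exists (Sub N N1); rewrite SubK e1E mul_vec !mxE /= !mulr0 !mulr1 !addr0.
by rewrite [RHS]vecE !mxE.
Qed.

End Geometry.

(** * Crossed homomorphisms on words in the E(x) *)

Section CrossedHom.
Variable A : comUnitRingType.
Local Notation SL2 := (SL2 A).

Lemma SL2_valM (g h : SL2) : val (g * h)%g = val g *m val h.
Proof. by []. Qed.

Lemma eval_nil : eval ([::] : word A) = 1%g.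
Proof. exact: big_nil. Qed.

Lemma eval_cons l (w : word A) : eval (l :: w) = (eval_letter l * eval w)%g.
Proof. exact: big_cons. Qed.

Lemma eval_cat (w1 w2 : word A) : eval (w1 ++ w2) = (eval w1 * eval w2)%g.
Proof. by rewrite /eval big_cat. Qed.

Lemma eval_seq1 (l : A * bool) : eval ([:: l] : word A) = eval_letter l.
Proof. exact: big_seq1. Qed.

Lemma eval_E (x : A) : eval (wE x) = SL2_E x.
Proof. exact: eval_seq1. Qed.

Lemma eval_letterN (x : A) : eval_letter (x, false) = (SL2_E x)^-1%g.
Proof. by []. Qed.

Lemma eval_letterE (x : A) : eval_letter (x, true) = SL2_E x.
Proof. by []. Qed.

Variables (M : gmodule SL2) (u : A -> M).

(* The value on a word of the crossed homomorphism with values u x on E(x) *)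
Fixpoint crossed (w : word A) : M :=
  if w is (x, b) :: w' then
    if b then u x + gact M (SL2_E x) (crossed w')
    else gact M (SL2_E x)^-1%g (crossed w' - u x)
  else 0.

Lemma crossed_cat w1 w2 : crossed (w1 ++ w2) = crossed w1 + gact M (eval w1) (crossed w2).
Proof.
elim: w1 => [|[x []] w1 IHw]; first by rewrite eval_nil gact1 add0r.
  by rewrite cat_cons /= IHw gactD addrA eval_cons eval_letterE gactM.
by rewrite cat_cons /= IHw eval_cons eval_letterN gactM -gactD [in RHS]addrAC.
Qed.

Lemma crossed_E x : crossed (wE x) = u x.
Proof. by rewrite /= gact0 addr0. Qed.

Lemma crossed_DE (a : A) : crossed (wD a) =
  u (- a) + gact M (SL2_E (- a)) (u (- a^-1))
  + gact M (SL2_E (- a) * SL2_E (- a^-1))%g (u (- a)).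
Proof. by rewrite /= gact0 addr0 gactD gactM addrA. Qed.

Variable P : zmodClosed M.
Hypothesis P_act : forall g m, m \in P -> gact M g m \in P.
Hypothesis crossed_D : forall a, a \is a GRing.unit -> crossed (wD a) \in P.
Hypothesis crossed_add : forall x y,
  u x + gact M (SL2_E x) (u 0) + gact M (SL2_E x * SL2_E 0)%g (u y)
    - gact M (eval (wD (-1))) (u (x + y)) \in P.
Hypothesis crossed_conj : forall x a, a \is a GRing.unit ->
  u x - gact M (eval (wD a^-1)) (u (a ^+ 2 * x)) \in P.
Hypothesis eval_ge2 : forall w1 w2 : word A, ge2_eq w1 w2 -> eval w1 = eval w2.

(** As in Fox calculus, it is enough to test the defining relations: concatenation is handled by the
    stability of P under G and by the equality of the values of equivalent words. The words [wD a]
    have values in P, so only the contributions of the letters E(x) outside them have to be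
    compared. *)
Lemma crossed_ge2 w1 w2 : ge2_eq w1 w2 -> crossed w1 - crossed w2 \in P.
Proof.
elim=> {w1 w2} [w|w1 w2 _ w12|w1 w2 w3 _ w12 _ w23|w1 w2 w1' w2' e1 w11 _ w22|x b|x y|x a ua|a b ua ub].
- by rewrite subrr rpred0.
- by rewrite -opprB rpredN.
- by rewrite -(subrKA (crossed w2)) rpredD.
- rewrite !crossed_cat (eval_ge2 e1) opprD addrACA -gactB.
  by rewrite rpredD // P_act.
- case: b => /=; rewrite ?subr0 ?gact0 ?addr0 ?sub0r.
    by rewrite -gactM mulgV gact1 subrr rpred0.
  by rewrite subrr gact0 rpred0.
- rewrite (crossed_cat (wE x)) (crossed_cat (wE 0)) (crossed_cat (wD (-1))).
  rewrite !crossed_E !eval_E gactD addrA -gactM.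
  rewrite opprD addrA addrAC; apply: rpredB (crossed_add x y) (crossed_D _).
  by rewrite unitrN unitr1.
- rewrite (crossed_cat (wE x)) (crossed_cat (wD a^-1)) !crossed_E !eval_E.
  rewrite opprD addrA addrAC.
  apply: rpredB; last by rewrite crossed_D ?unitrV.
  by rewrite addrAC; apply: rpredD (crossed_conj _ ua) (P_act _ (crossed_D ua)).
- rewrite (crossed_cat (wD a)); apply: rpredB; last by rewrite crossed_D ?unitrM ?ua.
  by apply: rpredD (crossed_D ua) (P_act _ (crossed_D ub)).
Qed.

End CrossedHom.

(** * Exactness of the complex of unimodular lines *)

Section Exactness.
Variable A : comUnitRingType.
Local Notation vect := 'cV[A]_2.
Local Notation SL2 := (SL2 A).
Local Notation X := (X A).

Definition aug_add : {additive X 0 -> int} := X_lift (fun=> 1%Z).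

Lemma aug_gen s : aug_add (X_gen s) = 1.
Proof. exact: X_liftE. Qed.

Fact aug_act (g : SL2) (x : X 0) : aug_add (gact (X 0) g x) = aug_add x.
Proof.
apply: (X_ext (f := aug_add \o gact (X 0) g) (h := aug_add)) => s.
by rewrite -[LHS]/(aug_add (gact (X 0) g (X_gen s))) gact_gen [RHS]aug_gen [LHS]aug_gen.
Qed.

Definition aug : gmor (X 0) (trivmod SL2 int) :=
  @Gmor SL2 (X 0) (trivmod SL2 int) aug_add aug_act.

Lemma aug_pt u : unimodular u -> aug (pt u) = 1.
Proof.
by move=> /pt_admissible/simpE[s sE _]; rewrite /pt sE; apply: aug_gen.
Qed.

Lemma aug_surj (z : int) : exists x, aug x = z.
Proof.
exists (pt (e1 A) *~ z); rewrite raddfMz aug_pt ?intz //; exact: unimodular_e1.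
Qed.

Lemma aug_partial x : aug (partial A 0 x) = 0.
Proof.
apply: (X_ext (f := aug \o partial A 0) (h := \0)) => s.
have [u [v [uv ->]]] := edge_surj s; rewrite -[LHS]/(aug (partial A 0 (edge u v))).
rewrite partial_edge // raddfB !aug_pt ?subrr //; first exact: dt_unimodular uv.
by apply: (@dt_unimodular _ _ u); rewrite dt_unitC.
Qed.

Definition connected (g : SL2) := pt (val g *m e1 A) - pt (e1 A) \in im_pred (partial A 0).

Lemma im_partial_act n g x :
  x \in im_pred (partial A n) -> gact (X n) g x \in im_pred (partial A n).
Proof.
move=> /im_predP[y yx]; apply/im_predP; exists (gact (X n.+1) g y).
by rewrite -yx; apply: partial_act.
Qed.

(** A path from oo to h oo, translated by g, continues a path from oo to g oo; translating by g^-1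
    reverses the roles of the ends. *)
Lemma connected_gspan (S : set SL2) : (forall g, S g -> connected g) ->
  forall g, in_gspan S g -> connected g.
Proof.
have e1u := unimodular_e1 A.
have ptM (g h : SL2) : pt (val (g * h)%g *m e1 A) = gact (X 0) g (pt (val h *m e1 A)).
  by rewrite pt_act -?mulmxA //; apply: unimodular_act.
move=> Sc g; elim=> [{}g /Sc //||{}g h _ cg _ ch|{}g _ cg].
- by rewrite /connected mul1mx subrr rpred0.
- rewrite /connected -(subrKA (pt (val g *m e1 A))) rpredD //.
  by rewrite ptM -[X in _ - X]pt_act // -raddfB; apply: im_partial_act.
- have := im_partial_act g^-1%g cg; rewrite raddfB -ptM mulVg mul1mx.
  by rewrite pt_act // -rpredN opprB.
Qed.

Lemma X0_exact : (forall g : SL2, connected g) ->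
  forall x, aug x = 0 -> exists y, partial A 0 y = x.
Proof.
move=> con; have sP (s : simplex A 0) : exists y, partial A 0 y = X_gen s - pt (e1 A).
  have [u u1 ->] := pt_surj s; have [g <-] := unimodular_trans u1.
  by have /im_predP := con g.
pose c s := projT1 (cid (sP s)).
have cP s : partial A 0 (c s) = X_gen s - pt (e1 A) by rewrite /c; case: cid.
move=> x x0; exists (X_lift c x).
have fB : zmod_morphism (fun x => x - pt (e1 A) *~ aug x).
  by move=> y z; rewrite raddfB mulrzBr !opprB [LHS]addrACA [RHS]addrACA [- z - _]addrC.
transitivity (x - pt (e1 A) *~ aug x); last by rewrite x0 mulr0z subr0.
apply: (X_ext (f := partial A 0 \o X_lift c) (h := Additive fB)) => s.
rewrite -[LHS]/(partial A 0 (X_lift c (X_gen s))) X_liftE cP.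
by rewrite -[RHS]/(X_gen s - pt (e1 A) *~ aug_add (X_gen s)) aug_gen.
Qed.

Lemma edge_connected (g : SL2) u :
  dt (e1 A) u \is a GRing.unit -> dt u (val g *m e1 A) \is a GRing.unit -> connected g.
Proof.
move=> e1u ug; apply/im_predP; exists (edge (e1 A) u + edge u (val g *m e1 A)).
by rewrite raddfD !partial_edge // addrC subrKA.
Qed.

Lemma GE2_connected : GE2_ring A -> forall g : SL2, connected g.
Proof.
move=> ge2 g; apply: connected_gspan (ge2 g) => {}g [i [j [x [ne_ij gE]]]].
have [i1|i0] := eqVneq i 1.
  have j0 : j = 0 by apply/val_inj; move: ne_ij; rewrite i1; case: j {gE} => [[|[|//]] //].
  (* The line of (1, x) is adjacent to oo only when x is a unit, but both lines are adjacent to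
     0. *)
  apply: (@edge_connected _ (e2 A)); rewrite e1E e2E ?dt_vec ?mulr1 ?mul0r ?mul1r ?subr0 ?unitr1 //.
  have -> : val g *m vec 1 0 = vec 1 x.
    by rewrite gE i1 j0 mul_vec !mxE /= ?mulr1n ?mulr0n; congr vec; ring.
  by rewrite dt_vec mul0r mulr1 sub0r unitrN unitr1.
have {}i0 : i = 0 by apply/val_inj; move: i0; case: i {gE ne_ij} => [[|[|//]] //].
have j1 : j = 1 by apply/val_inj; move: ne_ij; rewrite i0; case: j {gE} => [[|[|//]] //].
have ge1 : val g *m vec 1 0 = vec 1 0.
  by rewrite gE i0 j1 mul_vec !mxE /= ?mulr1n ?mulr0n; congr vec; ring.
by rewrite /connected e1E ge1 subrr rpred0.
Qed.

Section Universal.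
Hypothesis A_univ : universal_GE2_ring A.

Lemma universal_connected (g : SL2) : connected g.
Proof.
apply: connected_gspan (proj1 A_univ g) => {}g [x _ <-].
rewrite /connected e1E E_vec mulr1 addr0.
have dx : dt (vec 1 0) (vec x (-1)) \is a GRing.unit.
  by rewrite dt_vec mulr0 subr0 mul1r unitrN unitr1.
by apply/im_predP; exists (edge (vec 1 0) (vec x (-1))); rewrite partial_edge.
Qed.

Lemma eval_surj (g : SL2) : exists w : word A, eval w = g.
Proof.
elim: (proj1 A_univ g) => [_ [x _ <-]||{}g h _ [w1 <-] _ [w2 <-]|_ _ [w <-]].
- by exists (wE x); rewrite eval_E.
- by exists [::]; rewrite eval_nil.
- by exists (w1 ++ w2); rewrite eval_cat.
elim: w => [|[x b] w [w' w'E]]; first by exists [::]; rewrite eval_nil invg1.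
exists (w' ++ [:: (x, ~~ b)]); rewrite eval_cat w'E eval_seq1 eval_cons invgM.
by case: b; rewrite ?eval_letterE ?eval_letterN ?invgK.
Qed.

Local Notation "x ~ y" := (x - y \in im_pred (partial A 1)) (at level 70).

Lemma tri_image u v w : dt u v \is a GRing.unit -> dt u w \is a GRing.unit ->
  dt v w \is a GRing.unit -> edge v w - edge u w + edge u v \in im_pred (partial A 1).
Proof. by move=> uv uw vw; apply/im_predP; exists (tri u v w); apply: partial_tri. Qed.

(** With w = u + v, which is in general position to both vectors, the boundaries of (u, v, w) and
    (v, u, w) add up to the two orientations of the edge. *)
Lemma edge_flip u v : dt u v \is a GRing.unit ->
  edge u v + edge v u \in im_pred (partial A 1).
Proof.
move=> uv; have vu := uv; rewrite dt_unitC in vu; pose w := u + v.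
have wE (z : vect) : dt z w = dt z u + dt z v by rewrite /dt !mxE; ring.
have dtzz (z : vect) : dt z z = 0 by rewrite /dt subrr.
have uw : dt u w \is a GRing.unit by rewrite wE dtzz add0r.
have vw : dt v w \is a GRing.unit by rewrite wE dtzz addr0.
have := rpredD (tri_image uv uw vw) (tri_image vu vw uw).
by rewrite addrACA [X in X + _](_ : _ = 0) ?add0r // -opprB addNr.
Qed.

Lemma line_vecN (a b : A) : line (vec (- a) (- b)) = line (vec a b).
Proof.
by rewrite -[RHS](line_scale _ (unitrN1 A)) vecZ !mulN1r.
Qed.

Lemma eval_D_vec (a x y : A) : a \is a GRing.unit ->
  val (eval (wD a)) *m vec x y = vec (a * x) (a^-1 * y).
Proof.
move=> ua; rewrite /wD !eval_cat !eval_E -!mulmxA !E_vec.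
have ab := mulrV ua; move: (a^-1) ab => b ab; congr vec.
  transitivity (a * b * (y - a * x) + a * x + a * x - y); first by ring.
  by rewrite ab; ring.
transitivity (b * y - a * b * x + x); first by ring.
by rewrite ab; ring.
Qed.

(* The edge from oo to E(x) oo. A word thus gives a path from oo to its image of oo, and by the
   defining relations homotopic words give paths that differ by a boundary. *)
Definition step (x : A) : X 1 := edge (vec 1 0) (vec x (-1)).

Lemma dt_step (x : A) : dt (vec 1 0) (vec x (-1)) \is a GRing.unit.
Proof. by rewrite dt_vec mulr0 subr0 mul1r unitrN unitr1. Qed.

Lemma step_act (g : SL2) (x : A) :
  gact (X 1) g (step x) = edge (val g *m vec 1 0) (val g *m vec x (-1)).
Proof. exact: edge_act (dt_step x). Qed.

Local Notation theta := (crossed step).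

(** The path of [wD a] is the closed walk oo, p, 0, oo with p the line of (-a, -1). It is the
    boundary of the triangle (oo, p, 0) plus both orientations of the edge (oo, 0). *)
Lemma theta_D (a : A) : a \is a GRing.unit -> theta (wD a) \in im_pred (partial A 1).
Proof.
move=> ua; have ub : a^-1 \is a GRing.unit by rewrite unitrV.
rewrite crossed_DE [X in _ + X + _]step_act [X in _ + X]step_act.
rewrite -!mulmxA !E_vec.
have -> : vec (- a * 1 + 0) (- (1 : A)) = vec (- a) (-1) by rewrite mulr1 addr0.
have -> : vec (- a * - a^-1 + -1) (- - a^-1) = vec 0 a^-1 by rewrite mulrNN mulrV // subrr opprK.
have -> : vec (- a * (- a^-1 * 1 + 0) + - 1) (- (- a^-1 * 1 + 0)) = vec 0 a^-1.
  by rewrite mulr1 addr0 mulrNN mulrV // subrr opprK.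
have -> : vec (- a * (- a^-1 * - a + -1) + - - a) (- (- a^-1 * - a + -1)) = vec a 0.
  by rewrite mulrNN mulVr // subrr mulr0 add0r opprK oppr0.
have l1 : line (vec a 0) = line (vec (1 : A) 0).
  by rewrite -(line_scale (vec 1 0) ua) vecZ mulr1 mulr0.
have l2 (c : A) : c \is a GRing.unit -> line (vec 0 c) = line (vec (0 : A) 1).
  by move=> uc; rewrite -(line_scale (vec 0 1) uc) vecZ mulr1 mulr0.
rewrite (eq_edge (v' := vec 0 1) (erefl (line (vec (- a) (-1)))) (l2 _ ub)).
rewrite (eq_edge (l2 _ ub) l1).
have d1 : dt (vec 1 0) (vec (- a) (-1)) \is a GRing.unit by apply: dt_step.
have d2 : dt (vec 1 0) (vec 0 (1 : A)) \is a GRing.unit.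
  by rewrite dt_vec mulr1 mul0r subr0 unitr1.
have d3 : dt (vec (- a) (-1)) (vec 0 1) \is a GRing.unit.
  by rewrite dt_vec mulr1 mul0r subr0 unitrN.
have := rpredD (tri_image d1 d2 d3) (edge_flip d2).
by rewrite addrACA subrK addrCA addrA.
Qed.

Lemma line_vec0 (a b : A) : a \is a GRing.unit -> b = 0 -> line (vec a b) = line (vec 1 0).
Proof. by move=> ua ->; rewrite -(line_scale (vec 1 0) ua) vecZ mulr1 mulr0. Qed.

Lemma step_E0 (x : A) :
  gact (X 1) (SL2_E x) (step 0) = edge (vec x (-1)) (vec 1 0).
Proof.
rewrite step_act !E_vec mulr1 addr0 mulr0 add0r oppr0; apply: eq_edge => //.
by apply: line_vec0; rewrite ?unitrN ?unitr1.
Qed.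

Lemma step_EE (x y : A) :
  gact (X 1) (SL2_E x * SL2_E 0)%g (step y) = step (x + y).
Proof.
rewrite step_act -!mulmxA !E_vec; apply: eq_edge.
  by apply: line_vec0; rewrite ?mulr1 ?addr0 ?mulr0 ?oppr0 ?add0r ?unitrN ?unitr1.
by rewrite -[RHS]line_vecN; congr (line (vec _ _)); ring.
Qed.

Lemma step_DN (x : A) : gact (X 1) (eval (wD (-1))) (step x) = step x.
Proof.
rewrite step_act !eval_D_vec ?unitrN ?unitr1 // invrN invr1; apply: eq_edge.
  by apply: line_vec0; rewrite ?mulr1 ?mulr0 ?unitrN ?unitr1.
by rewrite -[RHS]line_vecN; congr (line (vec _ _)); ring.
Qed.

Lemma step_D (x a : A) : a \is a GRing.unit ->
  gact (X 1) (eval (wD a^-1)) (step (a ^+ 2 * x)) = step x.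
Proof.
move=> ua; rewrite step_act !eval_D_vec ?unitrV // invrK; apply: eq_edge.
  by apply: line_vec0; rewrite ?mulr1 ?mulr0 ?unitrV.
rewrite -[RHS](line_scale _ ua) vecZ; congr (line (vec _ _)).
by rewrite expr2 -mulrA mulKr.
Qed.

(** In E(x)E(0)E(y) the letter E(0) walks back along the first edge, so that this relation amounts
    to an edge and its flip. In the relation with D(a) the two steps coincide, because D(a^-1) fixes
    oo. *)
Lemma theta_ge2 w1 w2 : ge2_eq w1 w2 -> theta w1 - theta w2 \in im_pred (partial A 1).
Proof.
apply: crossed_ge2.
- exact: im_partial_act.
- exact: theta_D.
- move=> x y; rewrite [X in _ + X + _ - _]step_E0 [X in _ + X - _]step_EE.
  rewrite [X in _ - X]step_DN addrK; apply: edge_flip (dt_step x).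
- by move=> x a ua; rewrite [X in _ - X]step_D // subrr rpred0.
- by move=> {}w1 {}w2 /(proj2 A_univ).
Qed.

(** The two group elements differ by an upper triangular b. A word for b whose path is a boundary is
    appended to w, after which the words have the same value and are equivalent by universality. *)
Lemma theta_line w w' :
    line (val (eval w) *m e1 A) = line (val (eval w') *m e1 A) ->
  theta w - theta w' \in im_pred (partial A 1).
Proof.
set g := eval w; set g' := eval w' => ll; pose b := (g^-1 * g')%g.
have [c gc] := line_mem (esym ll).
have be1 : val b *m vec 1 0 = vec c 0.
  rewrite -e1E -mulmxA gc -scalemxAr mulmxA -[_ *m val g]/(val (g^-1 * g)%g) mulVg.
  by rewrite mul1mx e1E vecZ mulr1 mulr0.
have [z [t be2]] : exists z t, val b *m vec 0 1 = vec z t.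
  by eexists; eexists; rewrite [LHS]vecE; reflexivity.
have ct : c * t = 1.
  have := dt_act b (vec 1 0) (vec 0 1).
  by rewrite be1 be2 !dt_vec !mulr0 !subr0 mulr1.
have uc : c \is a GRing.unit by apply/unitrPr; exists t.
have tE : t = c^-1 by rewrite -[LHS](mulKr uc) ct mulr1.
(* E(y)E(0) is minus the unipotent upper triangular matrix with entry -y; the sign is compensated by
   D(-c), and y = -z/c produces the entry z of b. *)
pose wb := wD (- c) ++ wE (- z / c) ++ wE 0.
have wbE : eval wb = b.
  rewrite (eval_cat (wD _)) (eval_cat (wE _)) !eval_E.
  have uNc : - c \is a GRing.unit by rewrite unitrN.
  apply: SL2_eq; rewrite ?e1E ?e2E ?be1 ?be2 -!mulmxA !E_vec (eval_D_vec _ _ uNc) invrN.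
    by congr vec; ring.
  congr vec; rewrite ?tE; last by ring.
  by transitivity (z * (c / c)); [ring | rewrite divrr ?mulr1].
have wwb : ge2_eq (w ++ wb) w'.
  by apply/(proj2 A_univ); rewrite eval_cat wbE mulVKg.
rewrite -(subrKA (theta (w ++ wb))); apply: rpredD (theta_ge2 wwb).
rewrite crossed_cat opprD addrA subrr sub0r rpredN; apply: im_partial_act.
rewrite (crossed_cat _ (wD _)) rpredD ?theta_D ?unitrN //; apply: im_partial_act.
rewrite crossed_cat !crossed_E eval_E [X in _ + X]step_E0.
exact: edge_flip (dt_step _).
Qed.

(** A cone construction: [Th] sends each line to the path of a chosen word that leads to it. The
    word of u followed by one letter leads to v, so by [theta_line] an edge (u, v) is, up to
    boundaries, the difference of the paths to v and to u. *)
Lemma X1_exact (x : X 1) : partial A 0 x = 0 -> exists y, partial A 1 y = x.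
Proof.
have sW (s : simplex A 0) : exists w : word A, tnth (val s) ord0 = line (val (eval w) *m e1 A).
  have [v [v1 sv _]] := is_simplex_valP s; have [g gv] := unimodular_trans (v1 ord0).
  by have [w wg] := eval_surj g; exists w; rewrite wg gv.
pose W s := projT1 (cid (sW s)).
have WP s : tnth (val s) ord0 = line (val (eval (W s)) *m e1 A) by rewrite /W; case: cid.
pose Th : {additive X 0 -> X 1} := X_lift (fun s => theta (W s)).
have ThP u : unimodular u -> exists2 w, Th (pt u) = theta w &
    line (val (eval w) *m e1 A) = line u.
  move=> /pt_admissible/simpE[s sE su]; exists (W s); last by rewrite -WP su.
  by rewrite /pt sE; apply: X_liftE.
have cP (s : simplex A 1) : exists y, partial A 1 y = X_gen s - Th (partial A 0 (X_gen s)).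
  have [u [v [uv ->]]] := edge_surj s; rewrite partial_edge // raddfB.
  have [w -> wu] := ThP _ (dt_unimodular uv).
  have [w' -> w'v] : exists2 w, Th (pt v) = theta w & line (val (eval w) *m e1 A) = line v.
    by apply: ThP; apply: (@dt_unimodular _ _ u); rewrite dt_unitC.
  set g := eval w in wu; pose v' := val (g^-1)%g *m v.
  have gv' : val g *m v' = v by rewrite mulmxA -SL2_valM mulgV mul1mx.
  have [c uE] := line_mem (esym wu); pose y := v' 0 0; pose z := v' 1 0.
  have v'E : v' = vec y z by apply: vecE.
  have uz : z \is a GRing.unit.
    have : dt u v = c * z.
      transitivity (c * dt (val g *m e1 A) v); first by rewrite {1}uE /dt !mxE; ring.
      by rewrite -gv' dt_act e1E v'E dt_vec mul1r mulr0 subr0.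
    by move=> dE; move: uv; rewrite dE unitrM => /andP[].
  (* Translated back by g, the line of v is adjacent to oo and spanned by (y, z) with z a unit.
     Hence it is E(-y/z) oo. *)
  pose w2 := w ++ wE (- y / z).
  have lv : line (val g *m vec (- y / z) (-1)) = line v.
    have uNz : - z \is a GRing.unit by rewrite unitrN.
    rewrite -(line_scale _ uNz) scalemxAr vecZ -gv' v'E.
    congr (line (_ *m vec _ _)); last by rewrite mulrNN mulr1.
    by rewrite mulrA mulrNN mulrC mulKr.
  have w2w' : line (val (eval w2) *m e1 A) = line (val (eval w') *m e1 A).
    by rewrite w'v -lv eval_cat -mulmxA eval_E e1E E_vec mulr1 addr0.
  have -> : edge u v = theta w2 - theta w.
    rewrite crossed_cat crossed_E addrAC subrr add0r step_act.
    by apply: eq_edge; rewrite ?lv // -e1E wu.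
  by rewrite opprB addrA subrK; apply/im_predP/theta_line.
pose c s := projT1 (cid (cP s)).
have cE s : partial A 1 (c s) = X_gen s - Th (partial A 0 (X_gen s)) by rewrite /c; case: cid.
move=> x0; exists (X_lift c x).
have fB : zmod_morphism (fun x => x - Th (partial A 0 x)).
  by move=> y z; rewrite (raddfB (partial A 0)) (raddfB Th) !opprB [LHS]addrACA [RHS]addrACA [- z - _]addrC.
transitivity (x - Th (partial A 0 x)); last by rewrite x0 raddf0 subr0.
apply: (X_ext (f := partial A 1 \o X_lift c) (h := Additive fB)) => s.
by rewrite -[LHS]/(partial A 1 (X_lift c (X_gen s))) X_liftE cE.
Qed.

End Universal.
End Exactness.

(** * The second homology group of an abelian group *)

Lemma alt_sum3 (V : zmodType) (F : nat -> V) :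
  \sum_(i < 3) F i *~ (-1) ^+ i = F 0%N - F 1%N + F 2%N.
Proof. by rewrite !big_ord_recl big_ord0 addr0 mulr1z mulrN1z sqrrN expr1n mulr1z addrA. Qed.

Lemma alt_sum4 (V : zmodType) (F : nat -> V) :
  \sum_(i < 4) F i *~ (-1) ^+ i = F 0%N - F 1%N + F 2%N - F 3%N.
Proof.
rewrite !big_ord_recl big_ord0 addr0 mulr1z mulrN1z sqrrN expr1n mulr1z.
by rewrite exprS sqrrN expr1n mulr1 mulrN1z !addrA.
Qed.

Lemma subr_interchange (V : zmodType) (a b c d : V) : a - b - (c - d) = a - c - (b - d).
Proof. by rewrite !opprB [LHS]addrACA [RHS]addrACA [- b - _]addrC. Qed.

Lemma raddf3 (U V : zmodType) (f : {additive U -> V}) x y z :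
  f (x - y + z) = f x - f y + f z.
Proof. by rewrite raddfD raddfB. Qed.

Lemma qpi_eq (V : zmodType) (S : set V) x y : x - y \in zspan S -> qpi S x = qpi S y.
Proof. by move=> xy; apply/eqP; rewrite quot_eq. Qed.

Lemma qpi_eq2 (V : zmodType) (S : set V) x y z t :
  x + y - (z + t) \in zspan S -> qpi S x + qpi S y = qpi S z + qpi S t.
Proof. by move/qpi_eq; rewrite !raddfD. Qed.

(* The extension of an abelian group H by S defined by a symmetric cocycle. *)
Section SymmetricCocycle.
Variables (H : groupType) (S : zmodType) (u : H -> H -> S).
Hypothesis mulgC : forall a b : H, (a * b = b * a)%g.
Hypothesis uC : forall a b, u a b = u b a.
Hypothesis u_cocycle : forall a b c, u b c + u a (b * c)%g = u (a * b)%g c + u a b.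

Let u1 a : u 1%g a = u 1%g 1%g.
Proof. by have := u_cocycle 1%g 1%g a; rewrite !mul1g => /addrI. Qed.

Local Notation E := (S * H)%type.
Let E_add (p q : E) : E := (p.1 + q.1 + u p.2 q.2, (p.2 * q.2)%g).
(** The cocycle is not assumed normalised, hence the shift by u(1, 1) here, in the inverse and in
    the embedding of S. *)
Let E_zero : E := (- u 1%g 1%g, 1%g).
Let E_opp (p : E) : E := (- p.1 - u p.2 p.2^-1%g - u 1%g 1%g, p.2^-1%g).

Let E_addC : commutative E_add.
Proof. by move=> p q; rewrite /E_add uC mulgC [p.1 + _]addrC. Qed.
Let E_addA : associative E_add.
Proof.
move=> [x a] [y b] [z c]; rewrite /E_add /= mulgA; congr (_, _).
rewrite addrA -!addrA; congr (_ + _); congr (_ + _).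
by rewrite [RHS]addrCA [u a b + _]addrC -u_cocycle.
Qed.
Let E_add0 : left_id E_zero E_add.
Proof. by move=> [x a]; rewrite /E_add /= mul1g u1 addrAC addNr add0r. Qed.
Let E_addN : left_inverse E_zero E_opp E_add.
Proof.
move=> [x a]; rewrite E_addC /E_add /E_zero /= mulgV; congr (_, _).
by rewrite addrA addrA addrN add0r addrAC addNr add0r.
Qed.
Let V : zmodType := HB.pack E (GRing.isZmodule.Build E E_addA E_addC E_add0 E_addN).

Lemma symmetric_cocycle_extension :
  exists (V : zmodType) (J : H -> V) (L : {additive S -> V}),
    injective L /\ forall a b, L (u a b) = J b - J (a * b)%g + J a.
Proof.
pose L (s : S) : V := (s - u 1%g 1%g, 1%g).
have LB : zmod_morphism L.
  move=> x y; apply/eqP; rewrite eq_sym subr_eq; apply/eqP.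
  by rewrite -[RHS]/(E_add _ _) /E_add /L /= mulg1 addrA subrK addrAC subrK.
exists V, (fun a => (0, a) : V), (Additive LB); split; first by move=> x y [/addIr].
move=> a b; rewrite addrAC; apply/eqP; rewrite eq_sym subr_eq; apply/eqP.
rewrite -[LHS]/(E_add _ _) -[RHS]/(E_add _ _) /E_add /L /= mul1g !addr0 add0r.
by rewrite u1 subrK uC (mulgC b).
Qed.
End SymmetricCocycle.

Lemma alternating_bilinear_invg (H : groupType) (V : zmodType) (P : zmodClosed V)
    (f : H -> H -> V) :
    (forall a b c, f a (b * c)%g - (f a b + f a c) \in P) ->
    (forall a b, f b a = - f a b) ->
  forall a b, f a^-1%g b^-1%g - f a b \in P.
Proof.
move=> fM fN a b.
have f1 x : f x 1%g \in P.
  by have := fM x 1%g 1%g; rewrite mulg1 opprD addrA subrr sub0r rpredN.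
have fV x y : f x y^-1%g + f x y \in P.
  have := rpredB (f1 x) (fM x y y^-1%g).
  by rewrite mulgV opprB addrC subrK addrC.
by have := rpredD (fV a^-1%g b) (fV b a); rewrite ![f b _]fN addrA addrK.
Qed.

Section AbelianGroup.
Variable H : groupType.
Hypothesis mulgC : forall a b : H, (a * b = b * a)%g.
Local Notation C := (group_complex H int).

Definition barg n (g : n.-tuple H) : C n := << 1%Z *g g >>.

Lemma bnd_barg n (g : n.+1.-tuple H) :
  bnd C n (barg g) = \sum_(i < n.+2) barg (bar_face i g) *~ (-1) ^+ i.
Proof.
apply: (etrans (bar_bndU g _)); apply: eq_bigr => i _.
by rewrite /bar_coef; case: ifP.
Qed.

Definition bar1 (a : H) : C 1 := barg [tuple a].
Definition bar2 (a b : H) : C 2 := barg [tuple a; b].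
Definition bar3 (a b c : H) : C 3 := barg [tuple a; b; c].

Lemma tuple1E (g : 1.-tuple H) : exists a, g = [tuple a].
Proof. by case: g => [[|a [|//]] //= s1]; exists a; apply/val_inj. Qed.

Lemma tuple2E (g : 2.-tuple H) : exists a b, g = [tuple a; b].
Proof. by case: g => [[|a [|b [|//]]] //= s1]; exists a, b; apply/val_inj. Qed.

Lemma bnd_bar1 a : bnd C 0 (bar1 a) = 0.
Proof. by rewrite [LHS]bar_bnd1 subrr monalgU0. Qed.

Lemma bnd_bar2 a b : bnd C 1 (bar2 a b) = bar1 b - bar1 (a * b)%g + bar1 a.
Proof.
rewrite /bar2 bnd_barg; set g := [tuple a; b].
have -> : bar1 b = barg (bar_face 0 g) by congr barg; apply/val_inj.
have -> : bar1 (a * b)%g = barg (bar_face 1 g) by congr barg; apply/val_inj.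
have -> : bar1 a = barg (bar_face 2 g) by congr barg; apply/val_inj.
exact: (alt_sum3 (fun i => barg (bar_face i g))).
Qed.

Lemma bnd_bar3 a b c : bnd C 2 (bar3 a b c) =
  bar2 b c - bar2 (a * b)%g c + bar2 a (b * c)%g - bar2 a b.
Proof.
rewrite /bar3 bnd_barg; set g := [tuple a; b; c].
have -> : bar2 b c = barg (bar_face 0 g) by congr barg; apply/val_inj.
have -> : bar2 (a * b)%g c = barg (bar_face 1 g) by congr barg; apply/val_inj.
have -> : bar2 a (b * c)%g = barg (bar_face 2 g) by congr barg; apply/val_inj.
have -> : bar2 a b = barg (bar_face 3 g) by congr barg; apply/val_inj.
exact: (alt_sum4 (fun i => barg (bar_face i g))).
Qed.

Lemma inv_bar2 (f : H -> H) (F : {additive C 2 -> C 2}) :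
    (forall g, F (barg g) = barg (map_tuple f g)) ->
  forall a b, F (bar2 a b) = bar2 (f a) (f b).
Proof. by move=> FE a b; rewrite /bar2 FE; congr barg; apply/val_inj. Qed.

Lemma bar1_lift (V : zmodType) (F : H -> V) a :
  malg_lift (fun g : 1.-tuple H => zmulr (F (thead g))) (bar1 a) = F a.
Proof. by rewrite [LHS]malg_liftU; apply: mulr1z. Qed.

Lemma bar1_surj (g : 1.-tuple H) : exists a, << 1%Z *g g >> = bar1 a.
Proof. by have [a ->] := tuple1E g; exists a. Qed.

Lemma bar2_surj (g : 2.-tuple H) : exists a b, << 1%Z *g g >> = bar2 a b.
Proof. by have [a [b ->]] := tuple2E g; exists a, b. Qed.

Opaque bar1 bar2 bar3.

Definition alt2 a b : C 2 := bar2 a b - bar2 b a.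

Let rels : set (C 2) := [set x | x \in bdry C 2 \/ exists a b, x = alt2 a b].
Let u a b := qpi rels (bar2 a b).

Let u_cocycle a b c : u b c + u a (b * c)%g = u (a * b)%g c + u a b.
Proof.
apply/qpi_eq2/zspanP/zspan_gen; left; apply/bdryP; exists (bar3 a b c).
rewrite bnd_bar3; move: (bar2 b c) (bar2 (a * b)%g c) => x y.
move: (bar2 a (b * c)%g) (bar2 a b) => z t.
by rewrite opprD [RHS]addrACA addrA.
Qed.

Let uC a b : u a b = u b a.
Proof. by apply/eqP; rewrite quot_eq; apply/zspanP/zspan_gen; right; exists a, b. Qed.

(** The surjectivity of the exterior square onto H_2 of an abelian group. Modulo boundaries and
    alternating chains the symbol [a|b] is a symmetric cocycle, so in the extension it is the
    coboundary of [J]. The injective map [L] after the quotient map thus factors through the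
    boundary and vanishes on cycles. *)
Lemma cyc2_rels (c : C 2) : cyc c -> c \in zspan rels.
Proof.
have [V [J [L [L_inj LE]]]] := symmetric_cocycle_extension mulgC uC u_cocycle.
pose J1 : {additive C 1 -> V} := malg_lift (fun g : 1.-tuple H => zmulr (J (thead g))).
have J1E a : J1 (bar1 a) = J a by apply: bar1_lift.
have JL : J1 \o bnd C 1 =1 L \o qpi rels.
  apply: (int_ext (f := J1 \o bnd C 1) (h := L \o qpi rels)) => g.
  have [a [b ->]] := bar2_surj g.
  rewrite -[LHS]/(J1 (bnd C 1 (bar2 a b))) -[RHS]/(L (u a b)) bnd_bar2 LE.
  by rewrite -!J1E raddfD raddfB.
move=> c0; have : L (qpi rels c) = L (qpi rels 0).
  transitivity (J1 (bnd C 1 c)); first exact/esym/JL.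
  by rewrite (c0 : bnd C 1 c = 0) !raddf0.
by move=> /L_inj/eqP; rewrite quot_eq subr0.
Qed.

Let alt2_expand (V : zmodType) (p q r s t v w x y d1 d2 d3 : V) :
    d1 = p - q + r - s -> d2 = t - q + v - w -> d3 = x - y + v - p ->
  d1 - d2 + d3 = r - y - ((s - w) + (t - x)).
Proof.
move=> -> -> ->; rewrite !opprD !opprK !addrA.
rewrite [LHS](ACl (3*10*4*8*5*9*(1*12)*(2*6)*(7*11)))%AC /=.
by rewrite subrr !addNr !addr0.
Qed.

Lemma alt2Mr a b c : alt2 a (b * c)%g - (alt2 a b + alt2 a c) \in bdry C 2.
Proof.
(* The witness is the shuffle product of [a] with [b|c]. *)
apply/bdryP; exists (bar3 a b c - bar3 b a c + bar3 b c a).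
apply: (etrans (raddf3 (bnd C 2) (bar3 a b c) (bar3 b a c) (bar3 b c a))).
have e2 := bnd_bar3 b a c; have e3 := bnd_bar3 b c a.
rewrite (mulgC b a) in e2; rewrite (mulgC c a) in e3.
exact: alt2_expand (bnd_bar3 a b c) e2 e3.
Qed.

Lemma alt2V a b : alt2 a^-1%g b^-1%g - alt2 a b \in bdry C 2.
Proof.
by apply: alternating_bilinear_invg => [x y z|x y]; [apply: alt2Mr | rewrite /alt2 opprB].
Qed.

Fact inv_morphism : {morph (fun a : H => a^-1%g) : s t / (s / t)%g}.
Proof. by move=> s t /=; rewrite invgM mulgC. Qed.

Definition inv_hom : UMagmaMorphism.type H H :=
  HB.pack (fun a : H => a^-1%g) (isGroupMorphism.Build H H (fun a : H => a^-1%g) inv_morphism).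

Definition inv_cmap : cmap C C := @group_cmap H H inv_hom int.

Lemma inv_cmapE n (g : n.-tuple H) :
  inv_cmap n (barg g) = barg (map_tuple (fun a : H => a^-1%g) g).
Proof. exact: bar_map_funU. Qed.

(** Alternating chains are bilinear up to boundaries, so inverting both entries changes the sign
    twice. *)
Lemma inv_cyc2 (c : C 2) : cyc c -> inv_cmap 2 c - c \in bdry C 2.
Proof.
move/cyc2_rels/zspanP; elim=> [v|| v w _ IHv _ IHw].
- case=> [v0|[a [b ->]]]; first by rewrite rpredB ?cmap_bdry.
  have altV : inv_cmap 2 (alt2 a b) = alt2 a^-1%g b^-1%g.
    apply: (etrans (raddfB (inv_cmap 2) (bar2 a b) (bar2 b a))).
    by congr (_ - _); apply: (inv_bar2 (@inv_cmapE 2)).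
  by rewrite altV; apply: alt2V.
- by rewrite raddf0 subrr; apply: rpred0.
- by rewrite raddfB subr_interchange; apply: rpredB.
Qed.
End AbelianGroup.

(** * Characters and the first homology group *)

Section FirstHomology.
Variables (H : groupType) (V : zmodType) (chi : H -> V).
Hypothesis chiM : forall a b, chi (a * b)%g = chi a + chi b.
Local Notation C := (group_complex H int).

Definition chi_chain : {additive C 1 -> V} :=
  malg_lift (fun g : 1.-tuple H => zmulr (chi (thead g))).

Lemma chi_chain1 a : chi_chain (bar1 a) = chi a.
Proof. exact: bar1_lift. Qed.

Lemma chi_chain_bdry c : c \in bdry C 1 -> chi_chain c = 0.
Proof.
move=> /bdryP[d <-].
apply: (int_ext (f := chi_chain \o bnd C 1) (h := \0)) => g.
have [a [b ->]] := bar2_surj g.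
rewrite -[LHS]/(chi_chain (bnd C 1 (bar2 a b))) bnd_bar2.
apply: (etrans (raddf3 chi_chain (bar1 b) (bar1 (a * b)%g) (bar1 a))).
have chiE (x y z : V) : x = chi b -> y = chi (a * b)%g -> z = chi a -> x - y + z = 0.
  by rewrite chiM => -> -> ->; rewrite opprD addrCA subrr addr0 addNr.
by apply: chiE; apply: chi_chain1.
Qed.

Variable D : V -> H.
Hypothesis D_add : forall x y, D (x + y) = (D x * D y)%g.
Hypothesis D_chi : forall h, D (chi h) = h.

(** Modulo boundaries x |-> [D x] is additive, so both terms are additive in c and need only be
    compared on the generators [a]. *)
Lemma homologous_bar1 c : c - bar1 (D (chi_chain c)) \in bdry C 1.
Proof.
pose S : set (C 1) := fun x => x \in bdry C 1.
have inS x : (x \in zspan S) -> x \in bdry C 1.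
  by apply: in_zspan_closed; [apply: rpred0 | move=> y z; apply: rpredB].
pose f x := qpi S (bar1 (D x)).
have fB : zmod_morphism f.
  move=> x y; apply/eqP; rewrite eq_sym subr_eq; apply/eqP.
  rewrite /f -raddfD; apply: qpi_eq; apply/zspanP/zspan_gen; apply/bdryP.
  exists (- bar2 (D (x - y)) (D y)); apply: (etrans (raddfN (bnd C 1) _)).
  rewrite bnd_bar2 -D_add subrK; move: (bar1 _) (bar1 _) (bar1 _) => p q r.
  by rewrite opprD opprB opprD addrA [RHS]addrAC.
have key a : qpi S (bar1 a) = f (chi_chain (bar1 a)).
  by rewrite (chi_chain1 a) /f D_chi.
apply: inS; rewrite -quot_eq; apply/eqP; rewrite -[RHS]/(f (chi_chain c)).
clearbody f; have gB : zmod_morphism (fun c => f (chi_chain c)).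
  by move=> x y; rewrite (raddfB chi_chain); apply: fB.
apply: (int_ext (f := qpi S) (h := Additive gB)) => g.
have [a ->] := bar1_surj g.
exact: key.
Qed.
End FirstHomology.

(** * Inverting 2 *)

Section Localization.
(** An elementwise characterisation of M -> M[1/2]. It can be checked on chains as well as on tensor
    products, which makes the two constructions comparable. *)
Definition localizes2 (M L : zmodType) (u : {additive M -> L}) : Prop :=
  [/\ forall x, u x = 0 -> exists k : nat, x *+ 2 ^ k = 0,
      forall y, exists (k : nat) x, y *+ 2 ^ k = u x,
      forall y : L, exists z, z *+ 2 = y
    & forall y : L, y *+ 2 = 0 -> y = 0].

Lemma divisible2X (L : zmodType) : (forall y : L, exists z, z *+ 2 = y) ->
  forall k (y : L), exists z, z *+ 2 ^ k = y.
Proof.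
move=> div; elim=> [|k IHk] y; first by exists y.
by have [z <-] := div y; have [t <-] := IHk z; exists t; rewrite -mulrnA expnSr.
Qed.

Lemma torsion_free2X (L : zmodType) : (forall y : L, y *+ 2 = 0 -> y = 0) ->
  forall k (y : L), y *+ 2 ^ k = 0 -> y = 0.
Proof.
by move=> tf; elim=> [|k IHk] y //; rewrite expnSr mulrnA => /tf/IHk.
Qed.

Lemma mulrn2X_sub (V : zmodType) (p q a b : V) k j :
  p *+ 2 ^ k = a -> q *+ 2 ^ j = b -> (p - q) *+ 2 ^ (k + j) = a *+ 2 ^ j - b *+ 2 ^ k.
Proof.
by move=> <- <-; rewrite mulrnBl -!mulrnA -!expnD [(j + k)%N]addnC.
Qed.

(** Elements of L and L' correspond when their multiples by a common power of 2 come from the same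
    element of M. *)
Lemma localizes2_unique (M L L' : zmodType) (u : {additive M -> L})
    (v : {additive M -> L'}) :
  localizes2 u -> localizes2 v -> isomorphic L L'.
Proof.
have half (L1 L2 : zmodType) (u1 : {additive M -> L1}) (v1 : {additive M -> L2}) :
    localizes2 u1 -> localizes2 v1 -> forall l,
    exists l' (k : nat) x, l *+ 2 ^ k = u1 x /\ l' *+ 2 ^ k = v1 x.
  move=> [_ us _ _] [_ _ vd _] l; have [k [x lx]] := us l.
  by have [l' l'x] := divisible2X vd k (v1 x); exists l', k, x.
have zero (L1 L2 : zmodType) (u1 : {additive M -> L1}) (v1 : {additive M -> L2}) :
    localizes2 u1 -> localizes2 v1 -> forall l' (k : nat) x,
    0 *+ 2 ^ k = u1 x -> l' *+ 2 ^ k = v1 x -> l' = 0.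
  move=> [uk _ _ _] [_ _ _ vt] l' k x; rewrite mul0rn => /esym/uk[m xm] l'x.
  by apply: (torsion_free2X vt (k := k + m)); rewrite expnD mulrnA l'x -raddfMn xm raddf0.
move=> lu lv; apply: (isomorphic_of_rel (R := fun l l' =>
  exists (k : nat) x, l *+ 2 ^ k = u x /\ l' *+ 2 ^ k = v x)).
- exact: half.
- move=> l m l' m' [k [x [lx l'x]]] [j [y [my m'y]]].
  exists (k + j)%N, (x *+ 2 ^ j - y *+ 2 ^ k).
  rewrite (raddfB u) (raddfB v) (raddfMn u) (raddfMn u) (raddfMn v) (raddfMn v).
  by split; apply: mulrn2X_sub.
- by move=> l' [k [x [lx l'x]]]; apply: zero lu lv _ _ _ lx l'x.
- by move=> l [k [x [lx l'x]]]; apply: zero lv lu _ _ _ l'x lx.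
- move=> l'; have [l [k [x [l'x lx]]]] := half _ _ _ _ lv lu l'.
  by exists l, k, x.
Qed.

Lemma localizes2_comp (M N L : zmodType) (f : {additive M -> N}) (v : {additive N -> L}) :
    (forall x, f x = 0 -> exists k : nat, x *+ 2 ^ k = 0) ->
    (forall y, exists (k : nat) x, y *+ 2 ^ k = f x) ->
  localizes2 v -> localizes2 (v \o f).
Proof.
move=> fk fs [vk vs vd vt]; split=> // [x /vk[k]|y].
  rewrite -raddfMn => /fk[m xm]; exists (k + m)%N; by rewrite expnD mulrnA.
have [k [n yn]] := vs y; have [m [x nx]] := fs n; exists (k + m)%N, x.
by rewrite expnD mulrnA yn -raddfMn nx.
Qed.

(** Exactness of localization: every chase is carried out after multiplying by a power of 2, and
    unique divisibility of the chains of D passes to its homology. *)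
Lemma localizes2_homology (C D : complex) (f : cmap C D) n :
  (forall n, localizes2 (f n)) -> localizes2 (homology_map f n).
Proof.
move=> lf.
have hclassMn (E : complex) m (c : E m) (c0 : cyc c) k (kc0 : cyc (c *+ k)) :
    hclass c0 *+ k = hclass kc0.
  by rewrite -raddfMn; congr (qpi _ _); apply: val_inj; rewrite raddfMn.
have cycMn (E : complex) m (c : E m) k : cyc c -> cyc (c *+ k).
  by rewrite /cyc raddfMn => ->; rewrite mul0rn.
have fout m (c : C m) : f m.-1 (bnd_out C m c) = bnd_out D m (f m c).
  by case: m c => [|m] c /=; rewrite ?raddf0 ?cmap_bnd.
have fM m k (c : C m) : f m (c *+ k) = f m c *+ k by rewrite raddfMn.
split.
- move=> x; have [c [c0 ->]] := hclassP x; rewrite (homology_mapE c0 (cmap_cyc f c0)).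
  move=> /hclass_eq0/bdryP[d dc]; have [_ /(_ d)[k [c' dc']] _ _] := lf n.+1.
  have [fk _ _ _] := lf n; have [|m cm] := fk (c *+ 2 ^ k - bnd C n c').
    by rewrite raddfB fM -cmap_bnd -dc' raddfMn dc subrr.
  exists (k + m)%N; rewrite (hclassMn _ _ _ _ _ (cycMn _ _ _ _ c0)); apply/hclass_eq0/bdryP.
  exists (c' *+ 2 ^ m); apply/esym/eqP; rewrite raddfMn expnD mulrnA -subr_eq0.
  by rewrite -mulrnBl cm.
- move=> y; have [d [d0 ->]] := hclassP y; have [_ /(_ d)[k [c dc]] _ _] := lf n.
  have [m cm] : exists m : nat, bnd_out C n c *+ 2 ^ m = 0.
    have [/(_ (bnd_out C n c)) fk _ _ _] := lf n.-1; apply: fk.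
    by rewrite fout -dc raddfMn (d0 : bnd_out D n d = 0) mul0rn.
  have cm0 : cyc (c *+ 2 ^ m) by rewrite /cyc raddfMn.
  exists (k + m)%N, (hclass cm0).
  rewrite (hclassMn _ _ _ _ _ (cycMn _ _ _ _ d0)) (homology_mapE cm0 (cmap_cyc f cm0)).
  by apply/hclass_eq; rewrite fM -dc expnD mulrnA subrr rpred0.
- move=> y; have [d [d0 ->]] := hclassP y; have [_ _ /(_ d)[z zd] _] := lf n.
  have z0 : cyc z.
    have [_ _ _ ft] := lf n.-1; apply: ft.
    by rewrite -raddfMn zd.
  by exists (hclass z0); rewrite (hclassMn _ _ _ _ _ (cycMn _ _ _ _ z0)); apply/hclass_eq; rewrite zd subrr rpred0.
- move=> y; have [d [d0 ->]] := hclassP y.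
  rewrite (hclassMn _ _ _ _ _ (cycMn _ _ _ _ d0)) => /hclass_eq0/bdryP[e ed].
  have [_ _ /(_ e)[e' ee'] _] := lf n.+1; have [_ _ _ ft] := lf n.
  apply/hclass_eq0/bdryP; exists e'; apply/eqP; rewrite -subr_eq0; apply/eqP/ft.
  by rewrite mulrnBl -raddfMn ee' ed subrr.
Qed.

Lemma localizes2_coker (T U T' U' : zmodType) (f : {additive T -> U})
    (f' : {additive T' -> U'}) (a : {additive T -> T'}) (b : {additive U -> U'})
    (h : {additive {quotz range f} -> {quotz range f'}}) :
    (forall t, b (f t) = f' (a t)) ->
    (forall x, h (qpi (range f) x) = qpi (range f') (b x)) ->
  localizes2 a -> localizes2 b -> localizes2 h.
Proof.
move=> ba hE [_ ax ad _] [bk bs bd bt]; split=> [x|y|y|y].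
- rewrite -[x]repr_qpi hE; move: (repr x) => c /qpi_range_eq0[t tb].
  have [k [t' tt']] := ax t; have : b (c *+ 2 ^ k - f t') = 0.
    by rewrite raddfB raddfMn -tb -raddfMn tt' ba subrr.
  move=> /bk[m cm]; exists (k + m)%N; rewrite -raddfMn; apply/qpi_range_eq0.
  exists (t' *+ 2 ^ m); rewrite raddfMn expnD mulrnA; apply/eqP.
  by rewrite eq_sym -subr_eq0 -mulrnBl cm.
- rewrite -[y]repr_qpi; have [k [x yx]] := bs (repr y); exists k, (qpi _ x).
  by rewrite hE -yx raddfMn.
- rewrite -[y]repr_qpi; have [z zy] := bd (repr y); exists (qpi _ z).
  by rewrite -raddfMn zy.
- rewrite -[y]repr_qpi -raddfMn => /qpi_range_eq0[t tE].
  have [t' tt'] := ad t; apply/qpi_range_eq0; exists t'; apply/eqP.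
  by rewrite -subr_eq0; apply/eqP/bt; rewrite mulrnBl -raddfMn tt' tE subrr.
Qed.

(** A chain has finite support, so one power of 2 clears the denominators of all its
    coefficients. *)
Lemma localizes2_bmap (G : groupType) (M N : gmodule G) (f : gmor M N) n :
  (forall x, f x = 0 -> x = 0) -> localizes2 f -> localizes2 (bmap f n).
Proof.
move=> f0 [_ fs fd ft]; split.
- by move=> x /(bmap_inj f0) ->; exists 0%N.
- move=> y.
  pose P (d : bar_complex N n) := exists (k : nat) x, d *+ 2 ^ k = bmap f n x.
  have P0 : P 0 by exists 0%N, 0; rewrite raddf0.
  have PD d e : P d -> P e -> P (d + e).
    move=> [k [x dx]] [j [x' ex]]; exists (k + j)%N, (x *+ 2 ^ j + x' *+ 2 ^ k).
    rewrite raddfD !raddfMn -dx -ex mulrnDl -!mulrnA -!expnD.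
    by rewrite [(j + k)%N]addnC.
  suff : P y by []; rewrite [y]monalgE; apply: (big_ind P) => // g _.
  have [k [m mE]] := fs y@_g; exists k, << m *g g >>.
  by rewrite bmapU -mE (raddfMn (mkmalgU g)).
- move=> y; have [h hP] : exists h : N -> N, forall m, h m *+ 2 = m.
    by exists (fun m => projT1 (cid (fd m))) => m; case: cid.
  exists (\sum_(g <- msupp y) << h y@_g *g g >>); rewrite [RHS]monalgE -sumrMnl.
  by apply: eq_bigr => g _; rewrite -(raddfMn (mkmalgU g)) hP.
- move=> y y2; apply/malgP => g; rewrite mcoeff0; apply: ft.
  by rewrite -(raddfMn (mcoeff g)) y2 raddf0.
Qed.

Lemma raddfBB (U V : zmodType) (f : {additive U -> V}) x y z x' y' z' :
  f x = x' -> f y = y' -> f z = z' -> f (x - y - z) = x' - y' - z'.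
Proof. by move=> <- <- <-; rewrite !raddfB. Qed.

Section Tensor.
Variables N L : zmodType.
Local Notation rel := (@tensor_rel N L).
Local Notation gen n d := (<< 1%Z *g (n, d) >> : {malg int[(N * L)%type]}).

Definition tens (n : N) (d : L) : tensor N L := qpi rel (gen n d).

Lemma tensDl n n' d : tens (n + n') d = tens n d + tens n' d.
Proof.
rewrite /tens -raddfD; apply/qpi_eq/zspanP/zspan_gen; rewrite opprD addrA.
exact: tensorDl.
Qed.

Lemma tensDr n d d' : tens n (d + d') = tens n d + tens n d'.
Proof.
rewrite /tens -raddfD; apply/qpi_eq/zspanP/zspan_gen; rewrite opprD addrA.
exact: tensorDr.
Qed.

Fact tensl_zmod_morphism d : zmod_morphism (fun n => tens n d).
Proof. by move=> x y; apply/eqP; rewrite eq_sym subr_eq -tensDl subrK. Qed.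
Definition tensl d : {additive N -> tensor N L} := Additive (tensl_zmod_morphism d).

Fact tensr_zmod_morphism n : zmod_morphism (tens n).
Proof. by move=> x y; apply/eqP; rewrite eq_sym subr_eq -tensDr subrK. Qed.
Definition tensr n : {additive L -> tensor N L} := Additive (tensr_zmod_morphism n).

Lemma tens_ind (P : tensor N L -> Prop) :
    P 0 -> (forall x y, P x -> P y -> P (x + y)) -> (forall x, P x -> P (- x)) ->
  (forall n d, P (tens n d)) -> forall x, P x.
Proof.
move=> P0 PD PN Pt x; rewrite -[x]repr_qpi; move: (repr x) => c.
rewrite [c]monalgE raddf_sum; apply: (big_ind P) => // -[n d] _.
have -> : << c@_(n, d) *g (n, d) >> = gen n d *~ c@_(n, d).
  by rewrite -(raddfMz (mkmalgU (n, d))) intz.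
have PMn y k : P y -> P (y *+ k).
  by move=> Py; elim: k => [|k IHk]; rewrite ?mulr0n // mulrS; apply: PD.
rewrite raddfMz; case: (c@_(n, d)) => k; first by rewrite -pmulrn; apply/PMn/Pt.
by rewrite NegzE mulrNz -pmulrn; apply/PN/PMn/Pt.
Qed.

Section Map.
Variable h : {additive L -> L}.

Fact tens_map_rel (v : {malg int[(N * L)%type]}) : rel v ->
  malg_map int (fun p : N * L => (p.1, h p.2)) v \in zspan rel.
Proof.
set F := malg_map int _; have FE p q : F (gen p q) = gen p (h q) by apply: malg_mapU.
case=> [n n' d|n d d']; apply/zspanP/zspan_gen.
  by rewrite (raddfBB (f := F) (FE _ _) (FE _ _) (FE _ _)); apply: tensorDl.
by rewrite (raddfBB (f := F) (FE _ _) (FE _ _) (FE _ _)) raddfD; apply: tensorDr.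
Qed.

Definition tens_map : {additive tensor N L -> tensor N L} := quot_map tens_map_rel.

Lemma tens_mapE n d : tens_map (tens n d) = tens n (h d).
Proof. by rewrite /tens [LHS]quot_mapE malg_mapU. Qed.
End Map.

(* To detect nonzero tensors it is enough to have maps that are bilinear in the limit. *)
Lemma tens_eq0 (V : zmodType) (F : nat -> N -> L -> V) n d :
    (forall k n n' d, F k (n + n') d = F k n d + F k n' d) ->
    (forall n d d', exists j, forall k, (j <= k)%N ->
       F k n (d + d') = F k n d + F k n d') ->
  tens n d = 0 -> exists k, F k n d = 0.
Proof.
move=> FDl FDr; pose f k : {additive {malg int[(N * L)%type]} -> V} :=
  malg_lift (fun p : N * L => zmulr (F k p.1 p.2)).
have fE k p q : f k (gen p q) = F k p q by rewrite [LHS]malg_liftU; apply: mulr1z.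
have H v : v \in zspan rel -> exists j, forall k, (j <= k)%N -> f k v = 0.
  move/zspanP; elim=> {v} [_ [p p' q|p q q']||v w _ [i vi] _ [j wj]].
  - exists 0%N => k _; rewrite (raddfBB (f := f k) (fE _ _ _) (fE _ _ _) (fE _ _ _)).
    by rewrite FDl addrAC addrK subrr.
  - have [j jP] := FDr p q q'; exists j => k /jP kP.
    rewrite (raddfBB (f := f k) (fE _ _ _) (fE _ _ _) (fE _ _ _)).
    by rewrite kP addrAC addrK subrr.
  - by exists 0%N => k _; rewrite raddf0.
  - exists (i + j)%N => k le_k; rewrite raddfB vi ?wj ?subrr //.
      exact: leq_trans (leq_addl _ _) le_k.
    exact: leq_trans (leq_addr _ _) le_k.
move/eqP; rewrite -(raddf0 (qpi rel)) quot_eq subr0 => /H[j jP].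
by exists j; rewrite -fE jP.
Qed.
End Tensor.

Lemma dyadicP (x : dyadic) : exists (m : int) (k : nat), val x * 2%:R ^+ k = m%:~R.
Proof.
have /asboolP[m [k xE]] := valP x; exists m, k.
transitivity (m%:~R / 2%:R ^+ k * 2%:R ^+ k : rat); first by rewrite -xE.
by rewrite divfK // expf_neq0.
Qed.

Fact dyadic_one_subproof : (1 : rat) \in dyadicb.
Proof. by apply/asboolP; exists 1, 0; rewrite expr0 divr1. Qed.
Definition dyadic_one : dyadic := Sub 1 dyadic_one_subproof.

Fact dyadic_half_subproof (x : dyadic) : val x / 2%:R \in dyadicb.
Proof.
have /asboolP[m [k xE]] := valP x; apply/asboolP; exists m, k.+1.
by rewrite xE exprSr invfM mulrA.
Qed.
Definition dyadic_half (x : dyadic) : dyadic := Sub (val x / 2%:R) (dyadic_half_subproof x).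

Lemma dyadic_halfK (x : dyadic) : dyadic_half x *+ 2 = x.
Proof.
have halfK (r : rat) : r / 2%:R *+ 2 = r by rewrite -mulr_natr divfK.
by apply: val_inj; rewrite raddfMn; apply: halfK.
Qed.

Definition int_dyadic : {additive int -> dyadic} := zmulr dyadic_one.

Lemma val_int_dyadic z : val (int_dyadic z) = z%:~R.
Proof. by rewrite [LHS]raddfMz. Qed.

Lemma int_dyadic_inj z : int_dyadic z = 0 -> z = 0.
Proof.
by move/(congr1 val); rewrite val_int_dyadic => /eqP; rewrite intr_eq0 => /eqP.
Qed.

Lemma dyadic_int (x : dyadic) : exists (k : nat) (z : int), x *+ 2 ^ k = int_dyadic z.
Proof.
have [m [k xE]] := dyadicP x; exists k, m; apply: val_inj.
by rewrite val_int_dyadic -xE raddfMn -natrX mulr_natr.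
Qed.

Lemma localizes2_int_dyadic : localizes2 int_dyadic.
Proof.
split.
- by move=> x /int_dyadic_inj ->; exists 0%N.
- exact: dyadic_int.
- by move=> y; exists (dyadic_half y); apply: dyadic_halfK.
- have tf (r : rat) : r *+ 2 = 0 -> r = 0.
    by move/eqP; rewrite -mulr_natr mulf_eq0 orbF => /eqP.
  by move=> y /(congr1 val); rewrite raddfMn => /tf y0; apply: val_inj.
Qed.

Section Invert2.
Variable N : zmodType.

Lemma dyadic_half_zmod_morphism : zmod_morphism dyadic_half.
Proof. by move=> x y; apply: val_inj; apply: mulrBl. Qed.

Definition invert2_half : {additive invert2 N -> invert2 N} :=
  tens_map N (Additive dyadic_half_zmod_morphism).

Lemma invert2_halfK x : invert2_half x *+ 2 = x.
Proof.
apply: (tens_ind (P := fun x => invert2_half x *+ 2 = x)) => {x} [|x y hx hy|x hx|n d].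
- by rewrite raddf0 mul0rn.
- by rewrite raddfD mulrnDl hx hy.
- by rewrite raddfN mulNrn hx.
rewrite [invert2_half _]tens_mapE.
by rewrite -[tens _ _]/(@tensr N _ n (dyadic_half d)) -raddfMn dyadic_halfK.
Qed.

Lemma dyadic_integral (d : dyadic) : exists j : nat, forall k, (j <= k)%N ->
  exists m : int, val d * 2%:R ^+ k = m%:~R.
Proof.
have [m [j dE]] := dyadicP d; exists j => k le_jk; exists (m * 2%:R ^+ (k - j)).
by rewrite -{1}(subnKC le_jk) exprD mulrA dE intrM; congr (_ * _); rewrite rmorphXn.
Qed.

Lemma tens1_eq0 (n : N) : tens n dyadic_one = 0 -> exists k : nat, n *+ 2 ^ k = 0.
Proof.
move=> n0; have [||k] := tens_eq0
  (* For large k the numerator is the integer 2^k d, which is additive in d; smaller k give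
     meaningless values, which bilinearity in the limit permits. At d = 1 the value is p multiplied
     by 2^k. *)
  (F := fun k (p : N) (d : dyadic) => p *~ numq (val d * 2%:R ^+ k)) _ _ n0.
- by move=> k p p' d; rewrite mulrzDl.
- move=> p d d'; have [i iP] := dyadic_integral d; have [j jP] := dyadic_integral d'.
  exists (i + j)%N => k le_k; rewrite raddfD /= mulrDl.
  have [m ->] := iP k (leq_trans (leq_addr _ _) le_k).
  have [m' ->] := jP k (leq_trans (leq_addl _ _) le_k).
  by rewrite -rmorphD /= !numq_int mulrzDr.
rewrite /= mul1r -natrX -[_%:R]/((2 ^ k)%:Z%:~R) numq_int => kn.
by exists k.
Qed.

Lemma localizes2_tens : localizes2 (@tensl N _ dyadic_one).
Proof.
split=> [n|y|y|y y2].
- exact: tens1_eq0.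
- apply: (tens_ind (P := fun y => exists (k : nat) x, y *+ 2 ^ k = @tensl N _ dyadic_one x)).
  + by exists 0%N, 0; rewrite raddf0.
  + move=> x x' [k [n xn]] [j [n' x'n']]; exists (k + j)%N, (n *+ 2 ^ j + n' *+ 2 ^ k).
    rewrite raddfD !raddfMn -xn -x'n' mulrnDl -!mulrnA -!expnD.
    by rewrite [(j + k)%N]addnC.
  + by move=> x [k [n xn]]; exists k, (- n); rewrite raddfN -xn mulNrn.
  + move=> n d; have [k [z dz]] := dyadic_int d; exists k, (n *~ z).
    rewrite -[tens n d]/(@tensr N _ n d) -raddfMn dz [RHS]raddfMz.
    by rewrite -[@tensl N _ _ n]/(@tensr N _ n dyadic_one) -raddfMz.
- by exists (invert2_half y); apply: invert2_halfK.
- by rewrite -[y]invert2_halfK -raddfMn y2 raddf0.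
Qed.
End Invert2.

End Localization.

(** * The torus and the Borel subgroup *)

Section Torus.
Variable A : comUnitRingType.
Local Notation vect := 'cV[A]_2.
Local Notation SL2 := (SL2 A).
Local Notation T := (torus A).
Local Notation B := (borel A).
Local Notation U := (K1M A).

Definition borel_SL2 : B -> SL2 := val.
Fact borel_SL2_morphism : {morph borel_SL2 : s t / (s / t)%g}.
Proof. by []. Qed.
HB.instance Definition _ := isGroupMorphism.Build B SL2 borel_SL2 borel_SL2_morphism.

Lemma SL2_vec (g : SL2) a b :
  val g *m vec a b = vec (val g 0 0 * a + val g 0 1 * b) (val g 1 0 * a + val g 1 1 * b).
Proof. exact: mul_vec. Qed.

Lemma SL2_det (g : SL2) : val g 0 0 * val g 1 1 - val g 0 1 * val g 1 0 = 1.
Proof. by rewrite -det2; apply/eqP/(valP g). Qed.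

Lemma borel_unit (b : B) : val (val b) 0 0 \is a GRing.unit.
Proof.
apply/unitrPr; exists (val (val b) 1 1).
by have := SL2_det (val b); rewrite (eqP (valP b)) mulr0 subr0.
Qed.

Definition borel_chi (b : B) : U := Sub (val (val b) 0 0) (borel_unit b).

Lemma borel_chiM (a b : B) : borel_chi (a * b)%g = borel_chi a + borel_chi b.
Proof.
apply: val_inj => /=; rewrite mxE sum2; have /eqP -> := valP b.
by rewrite mulr0 addr0.
Qed.

Definition torus_chi (t : T) : U := borel_chi (torus_borel t).

Lemma torus_chiM (a b : T) : torus_chi (a * b)%g = torus_chi a + torus_chi b.
Proof. by rewrite -borel_chiM; congr borel_chi; apply: val_inj. Qed.

Fact diag_subproof (a : U) : \det (mx2 (val a) 0 0 (val a)^-1) == 1.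
Proof. by rewrite det2 !mxE /= mulr0 subr0 mulrV // (valP a). Qed.
Definition SL2_diag (a : U) : SL2 := Sub (mx2 (val a) 0 0 (val a)^-1) (diag_subproof a).
Fact SL2_diag_subproof (a : U) : SL2_diag a \in @Defs.diagonal A.
Proof. by rewrite unfold_in /Defs.diagonal /= !mxE /= eqxx. Qed.
Definition torus_diag (a : U) : T := Sub (SL2_diag a) (SL2_diag_subproof a).

Lemma torus_vec (t : T) x y :
  val (val t) *m vec x y = vec (val (torus_chi t) * x) ((val (torus_chi t))^-1 * y).
Proof.
have /andP[/eqP t01 /eqP t10] := valP t; rewrite SL2_vec t01 t10 !mul0r addr0 add0r.
congr vec; congr (_ * _); have := SL2_det (val t); rewrite t01 t10 mulr0 subr0 => t1.
by rewrite -[LHS](mulKr (borel_unit (torus_borel t))) [X in _ * X]t1 mulr1.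
Qed.

Lemma torus_chi_diag (a : U) : torus_chi (torus_diag a) = a.
Proof. by apply: val_inj; rewrite /= mxE. Qed.

Lemma torus_diagK (t : T) : torus_diag (torus_chi t) = t.
Proof.
by apply: val_inj; apply: SL2_eq; rewrite ?e1E ?e2E !torus_vec torus_chi_diag.
Qed.

Lemma torus_diagD (a b : U) : torus_diag (a + b) = (torus_diag a * torus_diag b)%g.
Proof. by rewrite -[RHS]torus_diagK torus_chiM !torus_chi_diag. Qed.

Lemma torus_diag0 : torus_diag 0 = 1%g.
Proof. by apply: (mulgI (torus_diag 0)); rewrite -torus_diagD addr0 mulg1. Qed.

Lemma torus_mulC (s t : T) : (s * t)%g = (t * s)%g.
Proof. by rewrite -[LHS]torus_diagK torus_chiM addrC -torus_chiM torus_diagK. Qed.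

Lemma torus_chiV (t : T) : torus_chi t^-1%g = - torus_chi t.
Proof.
apply/eqP; rewrite -addr_eq0 -torus_chiM mulVg -torus_diag0 torus_chi_diag //.
Qed.

(** A set-theoretic retraction onto the torus, as [unshapiro] asks for; it is only evaluated at
    stabilizing elements. *)
Definition in_torus (g : SL2) : T := insubd (1%g : T) g.
Definition in_borel (g : SL2) : B := insubd (1%g : B) g.

Lemma in_torus_val (t : T) : in_torus (torus_SL2 t) = t.
Proof. exact: valKd. Qed.

Lemma in_borel_val (b : B) : in_borel (borel_SL2 b) = b.
Proof. exact: valKd. Qed.

(** The zero of [K1M] is the unit 1, so the simplex is the triangle (oo, 0, 1); deleting its last
    entry twice leaves oo. *)
Definition oo : simplex A 0 := face ord_max (face ord_max (std_simplex (0 : U))).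
Definition edge0 : simplex A 1 := face ord_max (std_simplex (0 : U)).

Lemma tnth_edge0 i : tnth (val edge0) i = line (nth 0 [:: e1 A; e2 A] i).
Proof. by rewrite !tnth_mktuple; case: i => [[|[|//]] lt_i]. Qed.

Lemma tnth_oo i : tnth (val oo) i = line (e1 A).
Proof. by rewrite tnth_mktuple tnth_edge0; case: i => [[|//] lt_i]. Qed.

Lemma pt_oo : X_gen oo = pt (e1 A).
Proof. by rewrite /pt (simp_lines (s := oo)) //; apply: tnth_oo. Qed.

Lemma edge_edge0 : X_gen edge0 = edge (e1 A) (e2 A).
Proof. by rewrite /edge (simp_lines (s := edge0)) //; apply: tnth_edge0. Qed.

Lemma simplex_eq n (s t : simplex A n) :
  (forall i, tnth (val s) i = tnth (val t) i) -> s = t.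
Proof. by move=> st; apply/val_inj/eq_from_tnth. Qed.

Lemma line_e1_eq (u : vect) : line u = line (e1 A) -> u 1 0 = 0.
Proof. by move/line_mem=> [c ->]; rewrite !mxE mulr0. Qed.

Lemma line_e2_eq (u : vect) : line u = line (e2 A) -> u 0 0 = 0.
Proof. by move/line_mem=> [c ->]; rewrite !mxE mulr0. Qed.

Lemma torus_edge0 (t : T) : simplex_act (torus_SL2 t) edge0 = edge0.
Proof.
have ut := valP (torus_chi t).
apply: simplex_eq => i; rewrite tnth_map tnth_edge0 line_act_line /torus_SL2.
case: i => [[|[|//]] lt_i] /=; rewrite ?e1E ?e2E torus_vec !mulr0 !mulr1.
  by rewrite -[RHS](line_scale _ ut) vecZ mulr1 mulr0.
by rewrite -unitrV in ut; rewrite -[RHS](line_scale _ ut) vecZ mulr1 mulr0.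
Qed.

Lemma torus_oo (t : T) : simplex_act (torus_SL2 t) oo = oo.
Proof. by rewrite -face_act torus_edge0. Qed.

Lemma borel_oo (b : B) : simplex_act (borel_SL2 b) oo = oo.
Proof.
apply: simplex_eq => i; rewrite tnth_map tnth_oo line_act_line /borel_SL2 e1E SL2_vec.
have /eqP -> := valP b; rewrite !mulr0 mulr1 mul0r !addr0.
by rewrite -[RHS](line_scale _ (borel_unit b)) vecZ mulr1 mulr0.
Qed.

Lemma oo_trans (s : simplex A 0) : exists g, simplex_act g oo = s.
Proof.
have [v [v1 sv _]] := is_simplex_valP s; have [g gv] := unimodular_trans (v1 ord0).
exists g; apply: simplex_eq => i; rewrite tnth_map tnth_oo line_act_line gv sv.
by rewrite [i]ord1.
Qed.

Lemma stab_oo (g : SL2) : simplex_act g oo = oo -> borel_SL2 (in_borel g) = g.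
Proof.
move=> goo; rewrite /borel_SL2 /in_borel insubdK //.
have : line (val g *m e1 A) = line (e1 A).
  have := congr1 (fun s : simplex A 0 => tnth (val s) ord0) goo.
  by rewrite tnth_map !tnth_oo line_act_line.
by move/line_e1_eq; rewrite e1E SL2_vec vec1 mulr1 mulr0 addr0 => /eqP.
Qed.

Lemma stab_edge0 (g : SL2) : simplex_act g edge0 = edge0 -> torus_SL2 (in_torus g) = g.
Proof.
move=> ge; rewrite /torus_SL2 /in_torus insubdK //.
have lE (i : 'I_2) :
    line (val g *m nth 0 [:: e1 A; e2 A] i) = line (nth 0 [:: e1 A; e2 A] i).
  have := congr1 (fun s : simplex A 1 => tnth (val s) i) ge.
  by rewrite tnth_map !tnth_edge0 line_act_line.
have /line_e1_eq := lE ord0; have /line_e2_eq := lE ord_max.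
rewrite /= e1E e2E !SL2_vec vec0 vec1 !mulr1 !mulr0 addr0 add0r => g01 g10.
by apply/andP; split; apply/eqP; [exact: g01 | exact: g10].
Qed.

End Torus.

(** * Shapiro's lemma for lines and edges *)

Section TorusChains.
Variable A : comUnitRingType.
Local Notation SL2 := (SL2 A).
Local Notation T := (torus A).
Local Notation B := (borel A).
Local Notation X := (X A).
Local Notation CX n := (bar_complex (X n)).
Local Notation CT := (group_complex T int).
Local Notation CB := (group_complex B int).
Local Notation act1 n := (@simplex_act1 A n).
Local Notation actM n := (fun g h => @simplex_actM A g h n).

Definition shapiro_oo : cmap CB (CX 0) :=
  @shapiro SL2 B (simplex A 0) _ (act1 0) (actM 0) (@borel_SL2 A) (oo A) (@borel_oo A).

Definition unshapiro_oo n : {additive CX 0 n -> CB n} :=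
  @unshapiro SL2 B (simplex A 0) _ (act1 0) (actM 0) (@in_borel A) (oo A) (@oo_trans A) n.

Definition shapiro_edge : cmap CT (CX 1) :=
  @shapiro SL2 T (simplex A 1) _ (act1 1) (actM 1) (@torus_SL2 A) (edge0 A) (@torus_edge0 A).

Lemma edge0_trans (s : simplex A 1) : exists g, simplex_act g (edge0 A) = s.
Proof. exact: edge_transitive. Qed.

Definition unshapiro_edge n : {additive CX 1 n -> CT n} :=
  @unshapiro SL2 T (simplex A 1) _ (act1 1) (actM 1) (@in_torus A) (edge0 A) edge0_trans n.

Definition torus_oo_cmap : cmap CT (CX 0) :=
  @shapiro SL2 T (simplex A 0) _ (act1 0) (actM 0) (@torus_SL2 A) (oo A) (@torus_oo A).

Lemma torus_oo_cmapE n (h : n.-tuple T) :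
  torus_oo_cmap n (barg h) = << X_gen (oo A) *g map_tuple (@torus_SL2 A) h >>.
Proof. exact: shapiroE. Qed.

Lemma shapiro_edgeE n (h : n.-tuple T) :
  shapiro_edge n (barg h) = << X_gen (edge0 A) *g map_tuple (@torus_SL2 A) h >>.
Proof. exact: shapiroE. Qed.

Lemma torus_oo_factor n (c : CT n) :
  torus_oo_cmap n c = shapiro_oo n (group_cmap (@torus_borel A) int n c).
Proof.
apply: (int_ext (f := torus_oo_cmap n)
  (h := shapiro_oo n \o group_cmap (@torus_borel A) int n)) => g.
rewrite -[LHS]/(torus_oo_cmap n (barg g)) torus_oo_cmapE.
rewrite -[RHS]/(shapiro_oo n (group_cmap (@torus_borel A) int n << 1%Z *g g >>)).
rewrite [X in shapiro_oo n X]bar_map_funU [RHS]shapiroE; congr mkmalgU.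
by apply: eq_from_tnth => i; rewrite !tnth_map.
Qed.

Lemma shapiro_edge_surj n : hsurj shapiro_edge n.+1.
Proof.
move=> d; exact: (shapiro_surj edge0_trans (@torus_edge0 A) (@in_torus_val A) (@stab_edge0 A)).
Qed.

Lemma unshapiro_edge_homologous n (c : CX 1 n.+1) : cyc c ->
  c - shapiro_edge n.+1 (unshapiro_edge n.+1 c) \in bdry (CX 1) n.+1.
Proof. exact: (unshapiro_homologous edge0_trans (@torus_edge0 A) (@stab_edge0 A)). Qed.

Section TorusBorel.
Hypothesis TB : forall i : nat, (i <= 3)%N ->
  bijective (group_homology_map (@torus_borel A) int i).

Lemma torus_oo_inj n : (n <= 3)%N -> hinj torus_oo_cmap n.
Proof.
move=> le_n3; apply: (hinj_comp torus_oo_factor).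
  by apply: hinj_homology_map; apply/bij_inj/TB.
by move=> c; exact: (shapiro_inj (@oo_trans A) (@in_borel_val A) (@stab_oo A)).
Qed.

Lemma torus_oo_surj n : (n.+1 <= 3)%N -> hsurj torus_oo_cmap n.+1.
Proof.
move=> le_n3; apply: (hsurj_comp torus_oo_factor).
  apply: hsurj_homology_map => y; have [h _ hK] := TB le_n3.
  by exists (h y); apply: hK.
by move=> d; exact: (shapiro_surj (@oo_trans A) (@borel_oo A) (@in_borel_val A) (@stab_oo A)).
Qed.
End TorusBorel.

Definition K0 : gmodule SL2 := gker (aug A).
Local Notation CK := (bar_complex K0).
Local Notation CZ := (group_complex SL2 int).

Definition aug_cmap : cmap (CX 0) CZ := bmap (aug A).

Lemma aug_torus_oo n (c : CT n) : aug_cmap n (torus_oo_cmap n c) = group_cmap (@torus_SL2 A) int n c.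
Proof.
apply: (int_ext (f := aug_cmap n \o torus_oo_cmap n) (h := group_cmap (@torus_SL2 A) int n)) => g.
rewrite -[LHS]/(aug_cmap n (torus_oo_cmap n (barg g))) torus_oo_cmapE.
by rewrite [LHS]bmapU [RHS]bar_map_funU pt_oo aug_pt //; apply: unimodular_e1.
Qed.

Lemma group_cmap_inj (V : zmodType) n (c : group_complex T V n) :
  group_cmap (@torus_SL2 A) V n c = 0 -> c = 0.
Proof.
move=> c0; apply/malgP => h; rewrite mcoeff0.
suff -> : c@_h = (group_cmap (@torus_SL2 A) V n c)@_(map_tuple (@torus_SL2 A) h).
  by rewrite c0 mcoeff0.
apply/esym; apply: (malg_ext (f := mcoeff (map_tuple (@torus_SL2 A) h) \o
  group_cmap (@torus_SL2 A) V n) (h := mcoeff h)) => m g.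
rewrite -[LHS]/((group_cmap (@torus_SL2 A) V n << m *g g >>)@_(map_tuple (@torus_SL2 A) h)).
have inj_map : injective (map_tuple (@torus_SL2 A) (n := n)).
  move=> s t st; apply: eq_from_tnth => i.
  by have := congr1 (fun u : n.-tuple SL2 => tnth u i) st; rewrite !tnth_map => /val_inj.
by rewrite [X in X@__]bar_map_funU mcoeffU (inj_eq inj_map); apply: esym (mcoeffU _ _ _).
Qed.

(** The cone argument with the chains of X_0 in the middle. The comparison of the torus with the
    Borel subgroup enters in degrees n+1 and n+2, so that degree 3 is reached for n = 1. *)
Lemma rel_homology_K0 n : (n.+1 < 3)%N ->
    (forall i : nat, (i <= 3)%N -> bijective (group_homology_map (@torus_borel A) int i)) ->
  isomorphic (rel_homology (@torus_SL2 A) int n.+2) (homology CK n.+1).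
Proof.
move=> lt_n3 TB; have le_n3 := ltnW lt_n3.
apply: (rel_homology_shift (j := torus_oo_cmap) (i := bmap (gker_incl (aug A)))
  (p := aug_cmap)) => [k c|k c|k c|k c|k x|k z||d|d].
- exact: aug_torus_oo.
- exact: group_cmap_inj.
- by apply: bmap_inj; apply: gker_incl_inj.
- by apply: bmap0 => x; apply: (kerP x).
- by move=> x0; apply: (bmap_exact (f := aug A)) x0; apply: gker_exact.
- by apply: bmap_surj; apply: aug_surj.
- exact: torus_oo_inj.
- exact: torus_oo_surj.
- exact: torus_oo_surj.
Qed.

End TorusChains.

(** * The invariant of H_1(SL_2(A), X_0) with values in A^* *)

Section Phi.
Variable A : comUnitRingType.
Local Notation vect := 'cV[A]_2.
Local Notation SL2 := (SL2 A).
Local Notation T := (torus A).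
Local Notation U := (K1M A).
Local Notation X := (X A).
Local Notation CX n := (bar_complex (X n)).
Local Notation CT := (group_complex T int).
Local Notation tuple1 g := [tuple g : SL2].

Lemma X_gen_inj n : injective (@X_gen A n).
Proof.
move=> s t st; have h1 := mcoeffU s (1 : int) s; have h2 := mcoeffU t (1 : int) s.
have h3 : (1 : int) *+ (s == s) = 1 *+ (t == s).
  exact: etrans (esym h1) (etrans (congr1 (mcoeff s) st) h2).
by move: h3; rewrite eqxx; case: eqP => // ->.
Qed.

Lemma unimodular_inj (u : vect) a b : unimodular u -> a *: u = b *: u -> a = b.
Proof.
move=> /unimodular_trans[g <-] ab.
have := congr1 (mulmx (val g^-1%g)) ab.
rewrite -!scalemxAr !mulmxA -SL2_valM mulVg mul1mx.
by move/(congr1 (fun w : vect => w 0 0)); rewrite !mxE /= !mulr1.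
Qed.

Lemma line_unit (u w : vect) : unimodular u -> line w = line u ->
  exists c : U, w = val c *: u.
Proof.
move=> u1 uw; have [c wc] := line_mem uw; have [d ud] := line_mem (esym uw).
have dc : d * c = 1.
  by apply: (unimodular_inj u1); rewrite scale1r -scalerA -wc -ud.
have uc : c \is a GRing.unit by apply/unitrPr; exists d; rewrite mulrC.
by exists (Sub c uc : U).
Qed.

Fact phi_zmod_morphism :
  zmod_morphism (fun c : CX 0 1%N => chi_chain (@borel_chi A) (unshapiro_oo A 1 c)).
Proof. by move=> x y; rewrite (raddfB (unshapiro_oo A 1)) (raddfB (chi_chain _)). Qed.
(** The diagonal character of the Borel subgroup, transported to H_1(SL_2(A), X_0) by Shapiro's
    lemma. *)
Definition phi : {additive CX 0 1 -> U} := Additive phi_zmod_morphism.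

Lemma phiE c : phi c = chi_chain (@borel_chi A) (unshapiro_oo A 1 c).
Proof. by []. Qed.

Lemma phi_bdry c : c \in bdry (CX 0) 1 -> phi c = 0.
Proof.
move=> c0; rewrite phiE (chi_chain_bdry (@borel_chiM A)) //.
exact: (unshapiro_bdry (@oo_trans A) (@borel_oo A) (@in_borel_val A) (@stab_oo A)).
Qed.

Lemma phi_torus (c : CT 1) : phi (torus_oo_cmap A 1 c) = chi_chain (@torus_chi A) c.
Proof.
rewrite torus_oo_factor phiE [X in chi_chain _ X](shapiroK _ _ (@oo_trans A) (@borel_oo A) (@in_borel_val A)).
have fB : zmod_morphism (fun c : CT 1 =>
    chi_chain (@borel_chi A) (group_cmap (@torus_borel A) int 1 c)).
  by move=> x y; rewrite (raddfB (group_cmap (@torus_borel A) int 1)) (raddfB (chi_chain _)).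
apply: (int_ext (f := Additive fB) (h := chi_chain (@torus_chi A))) => g.
have [t ->] := bar1_surj g; rewrite [RHS]chi_chain1.
have bE : group_cmap (@torus_borel A) int 1 (bar1 t) = bar1 (torus_borel t).
  by rewrite [LHS]bar_map_funU; congr mkmalgU; apply: val_inj.
by rewrite -[LHS]/(chi_chain _ (group_cmap (@torus_borel A) int 1 (bar1 t))) bE chi_chain1.
Qed.

Definition oo_transport : simplex A 0 -> SL2 :=
  @transport SL2 (simplex A 0) (fun g => @simplex_act A g 0) _ (@oo_trans A).

Lemma oo_transportE s : simplex_act (oo_transport s) (oo A) = s.
Proof. exact: (@transportE SL2 (simplex A 0) (fun g => @simplex_act A g 0)
  (@simplex_act1 A 0) (oo A) (@oo_trans A) s). Qed.

(** A chosen generator of each line; [phi] reads off by which unit a group element changes these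
    generators. *)
Definition base_vec (s : simplex A 0) : vect := val (oo_transport s) *m e1 A.

Lemma phi_cell (s : simplex A 0) (g : SL2) :
  val g *m base_vec (simplex_act g^-1%g s) =
  val (phi << X_gen s *g tuple1 g >>) *: base_vec s.
Proof.
pose b : SL2 := ((oo_transport s)^-1 * g * oo_transport (simplex_act g^-1%g s))%g.
have b_oo : simplex_act b (oo A) = oo A.
  rewrite /b simplex_actM oo_transportE -simplex_actM -mulgA mulgV mulg1.
  by rewrite -{2}(oo_transportE s) -simplex_actM mulVg simplex_act1.
have -> : phi << X_gen s *g tuple1 g >> = borel_chi (in_borel b).
  rewrite phiE; have -> : unshapiro_oo A 1 << X_gen s *g tuple1 g >> = bar1 (in_borel b).
    apply: etrans (unshapiroE _ _ _ _ _ _) _; congr mkmalgU.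
    apply: eq_from_tnth => i; rewrite tnth_map tnth_mktuple; case: i => [[|//] lt_i].
    by rewrite /b /= invg1 simplex_act1.
  exact: chi_chain1.
have be1 : val b *m e1 A = val (borel_chi (in_borel b)) *: e1 A.
  rewrite -{1}(stab_oo b_oo) e1E SL2_vec vecZ !mulr0 !mulr1 !addr0; congr vec.
  exact/eqP/(valP (in_borel b)).
by rewrite /base_vec scalemxAr -be1 !mulmxA -!SL2_valM /b -!mulgA mulVKg.
Qed.

Lemma base_vec_unit (s : simplex A 0) (u : vect) : unimodular u -> X_gen s = pt u ->
  exists c : U, base_vec s = val c *: u.
Proof.
move=> u1 su; apply: line_unit => //.
have [s' s'E s'u] := simpE (pt_admissible u1).
have ss' : s = s'.
  have : X_gen s = X_gen s' by rewrite su -s'E.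
  exact: X_gen_inj.
rewrite -(s'u ord0) -ss' -[in RHS](oo_transportE s).
by rewrite tnth_map tnth_oo line_act_line.
Qed.

(** Here [nu] compares a vector with the chosen generator of its line. The formula allows [phi] to
    be computed with arbitrary vectors: the unknown terms cancel for eigenvectors and along
    cycles. *)
Lemma phi_pt : exists nu : vect -> U, forall (u w : vect) (g : SL2) (x : U),
  unimodular u -> unimodular w -> val g *m w = val x *: u ->
  phi << pt u *g tuple1 g >> = nu w + x - nu u.
Proof.
have vP (u : vect) : exists c : U, unimodular u -> forall s, X_gen s = pt u ->
    base_vec s = val c *: u.
  have [u1|] := pselect (unimodular u); last by exists 0.
  have [s sE _] := simpE (pt_admissible u1).
  have [c cE] := base_vec_unit u1 (esym sE); exists c => _ s' s'E.
  rewrite -cE; congr base_vec.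
  have : X_gen s' = X_gen s by rewrite s'E -sE.
  exact: X_gen_inj.
pose nu u := projT1 (cid (vP u)).
have nuP u : unimodular u -> forall s, X_gen s = pt u -> base_vec s = val (nu u) *: u.
  by rewrite /nu; case: cid.
exists nu => u w g x u1 w1 gw.
have [s sE _] := simpE (pt_admissible u1); have {}sE : X_gen s = pt u := esym sE.
have s'E : X_gen (simplex_act g^-1%g s) = pt w.
  rewrite -gact_gen sE pt_act //; apply: eq_pt.
  rewrite -(line_scale _ (valP x)) scalemxAr -gw mulmxA -SL2_valM mulVg.
  by rewrite mul1mx.
have := phi_cell s g; rewrite (nuP _ u1 _ sE) (nuP _ w1 _ s'E) sE; set c := phi _.
rewrite -scalemxAr gw !scalerA => /(unimodular_inj u1) cE.
apply/eqP; rewrite eq_sym subr_eq; apply/eqP/val_inj; exact: cE.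
Qed.

Lemma phi_eigen (u : vect) (g : SL2) (x : U) :
  unimodular u -> val g *m u = val x *: u -> phi << pt u *g tuple1 g >> = x.
Proof. by move=> u1 gu; have [nu nuP] := phi_pt; rewrite (nuP u u g x) // addrAC subrr add0r. Qed.

End Phi.

(** * The first Milnor-Witt K-group *)

Lemma raddfB2 (V W : zmodType) (f : {additive V -> W}) x y x' y' :
  f x = x' -> f y = y' -> f (x - y) = x' - y'.
Proof. by move=> <- <-; apply: raddfB. Qed.

Lemma raddf_compB (V W Z : zmodType) (f : {additive W -> Z}) (g : {additive V -> W}) x y :
  f (g (x - y)) = f (g x) - f (g y).
Proof. by rewrite !raddfB. Qed.

Lemma hclass_subE (C : complex) n (c d e : C n) (c0 : cyc c) (d0 : cyc d) (e0 : cyc e) :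
  e = c - d -> hclass c0 - hclass d0 = hclass e0.
Proof. by move=> ecd; move: e0; rewrite ecd => e0; apply: hclass_sub. Qed.

Lemma pair_sub1 (V W : zmodType) (x y : V * W) : (x - y).1 = x.1 - y.1.
Proof. by []. Qed.

Lemma pair_sub2 (V W : zmodType) (x y : V * W) : (x - y).2 = x.2 - y.2.
Proof. by []. Qed.

Lemma fibprodB (V W Q : zmodType) (f : {additive V -> Q}) (g : {additive W -> Q})
  (x y : fibprod f g) : val (x - y) = val x - val y.
Proof. exact: raddfB. Qed.

Lemma ker_sub (V W : zmodType) (f : {additive V -> W}) (x y : ker f) :
  val (x - y) = val x - val y.
Proof. exact: raddfB. Qed.

Section KernelLift.
Variables (G : groupType) (L M N : gmodule G) (f : gmor L M) (h : gmor M N).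
Hypothesis hf : forall x, h (f x) = 0.

Definition gker_lift_fun (x : L) : gker h := in_ker (hf x).

Fact gker_lift_zmod_morphism : zmod_morphism gker_lift_fun.
Proof. by move=> x y; apply: val_inj; apply: (raddfB f). Qed.

Definition gker_lift_add : {additive L -> gker h} := Additive gker_lift_zmod_morphism.

Fact gker_lift_act g x : gker_lift_add (gact L g x) = gact (gker h) g (gker_lift_add x).
Proof. by apply: val_inj; apply: gmor_act. Qed.

Definition gker_lift : gmor L (gker h) := Gmor gker_lift_act.

Lemma bmap_gker_lift n (c : bar_complex L n) :
  bmap (gker_incl h) n (bmap gker_lift n c) = bmap f n c.
Proof. exact: bmap_comp. Qed.

End KernelLift.

Lemma qpi_coinv_eq0 (G : groupType) (M : gmodule G) (m : M) :
  qpi (@coinv_rel _ M) m = 0 <-> << m *g [tuple] >> \in bdry (bar_complex M) 0.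
Proof.
rewrite bdry_coinv -(raddf0 (qpi (@coinv_rel _ M))).
by split=> [/eqP|m0]; [|apply/eqP]; rewrite quot_eq subr0.
Qed.

Lemma coinv_repr (G : groupType) (M : gmodule G) (x : coinv M) :
  exists m : M, x = qpi (@coinv_rel _ M) m.
Proof. by exists (repr x); rewrite repr_qpi. Qed.

(* The exact sequence 0 -> Z -> M1 -> M0 -> N, where U stands for the group H_1(G, M0) and
   tor for generators of H_1(G, M1). *)
Section SecondDifferential.
Variables (G : groupType) (M1 M0 N : gmodule G) (p : gmor M1 M0) (eps : gmor M0 N).
Hypothesis eps_p : forall x, eps (p x) = 0.
Hypothesis p_onto : forall x, eps x = 0 -> exists y, p y = x.
Local Notation C1 := (bar_complex M1).
Local Notation C0 := (bar_complex M0).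
Local Notation CK := (bar_complex (gker eps)).
Local Notation CZ := (bar_complex (gker p)).
Local Notation P := (bmap p).
Local Notation PK := (bmap (gker_lift eps_p)).
Local Notation iZ := (bmap (gker_incl p)).
Local Notation I := (ker (coinv_map (gker_incl p))).

Variables (U : zmodType) (phi : {additive C0 1 -> U}) (tor : U -> C1 1).
Hypothesis phi_bdry : forall y, y \in bdry C0 1 -> phi y = 0.
Hypothesis tor_cyc : forall a, cyc (tor a).
Hypothesis tor_gen : forall x, cyc x -> exists a, x - tor a \in bdry C1 1.
Hypothesis phi_tor : forall a, phi (P 1 (tor a)) = - (a *+ 2).

Definition square (b : U) := exists e, b = e *+ 2.

Lemma squareB a b : square a -> square b -> square (a - b).
Proof. by move=> [x ->] [y ->]; exists (x - y); rewrite mulrnBl. Qed.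

Lemma phi_cycle (x : C1 1) (a : U) : x - tor a \in bdry C1 1 -> phi (P 1 x) = - (a *+ 2).
Proof.
move=> xa; have /phi_bdry/eqP := cmap_bdry P xa.
by rewrite (raddfB (P 1)) (raddfB phi) subr_eq0 => /eqP ->.
Qed.

(* The differential d2 with values in U: b is only defined up to squares. *)
Definition d2_unit (x : I) (b : U) : Prop :=
  exists (z : gker p) (c : C1 1),
  [/\ val x = qpi (@coinv_rel _ (gker p)) z, bnd C1 0 c = << (val z : M1) *g [tuple] >>
    & phi (P 1 c) = b].

Lemma d2_unitB x y a b : d2_unit x a -> d2_unit y b -> d2_unit (x - y) (a - b).
Proof.
move=> [z [c [xz cz ca]]] [z' [c' [xz' cz' ca']]]; exists (z - z'), (c - c'); split.
- exact: esym (raddfB2 (esym xz) (esym xz')).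
- exact: etrans (raddfB2 cz cz') (esym (raddfB (mkmalgU [tuple]) _ _)).
- by rewrite (raddfB (P 1)); apply: raddfB2.
Qed.

(** When z is trivial in the coinvariants, c is a cycle up to a chain with coefficients in the
    kernel of p, which P kills. The cycle is a torus class, where phi takes the negative of a
    double, that is, a square in multiplicative notation. *)
Lemma d2_unit_zero (b : U) : d2_unit 0 b -> square b.
Proof.
move=> [z [c [/esym/qpi_coinv_eq0/bdryP[e ez] cz <-]]].
have x0 : cyc (c - iZ 1 e).
  rewrite /cyc [LHS](raddfB (bnd C1 0)) cz cmap_bnd ez.
  by rewrite bmapU subrr.
have [a xa] := tor_gen x0; exists (- a); rewrite mulNrn -(phi_cycle xa).
rewrite (raddfB (P 1)) (_ : P 1 (iZ 1 e) = 0) ?subr0 //.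
by apply: bmap0 => y; apply: (kerP y).
Qed.

Lemma d2_unit_total x : exists b, d2_unit x b.
Proof.
have := kerP x; have [z xz] := coinv_repr (val x).
rewrite xz [coinv_map _ _]quot_mapE => /qpi_coinv_eq0/bdryP[c cz].
by exists (phi (P 1 c)), z, c.
Qed.

Lemma d2_unit_square x a b : d2_unit x a -> d2_unit x b -> square (a - b).
Proof. by move=> xa xb; apply: d2_unit_zero; rewrite -(subrr x); apply: d2_unitB. Qed.

Variables (I2 : set I) (s : {additive U -> {quotz I2}}) (pf : U -> I).
Hypothesis I2P : forall x, I2 x <-> exists2 b, d2_unit x b & square b.
Hypothesis sE : forall a, s a = qpi I2 (pf a).
Hypothesis d2_pf : forall a, d2_unit (pf a) (- a).
Hypothesis tor2 : forall a, a *+ 2 = 0 -> PK 1 (tor a) \in bdry CK 1.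

Lemma I2_closed : I2 0 /\ forall x y, I2 x -> I2 y -> I2 (x - y).
Proof.
split=> [|x y /I2P[a xa sa] /I2P[b yb sb]].
  have [b b0] := d2_unit_total 0.
  by apply/I2P; exists b => //; apply: d2_unit_zero.
by apply/I2P; exists (a - b); [apply: d2_unitB | apply: squareB].
Qed.

Lemma I2_d2 x b : d2_unit x b -> I2 x -> square b.
Proof.
move=> xb /I2P[a xa [e ae]]; have [f bf] := d2_unit_square xb xa.
by exists (f + e); rewrite mulrnDl -bf -ae subrK.
Qed.

(** The plus sign comes from d^2 taking the value -a on <<a>>. *)
Lemma fibre_iff a x b : d2_unit x b -> s a = qpi I2 x <-> square (a + b).
Proof.
move=> xb; have [I20 I2B] := I2_closed; have ab := d2_unitB (d2_pf a) xb.
have -> : s a = qpi I2 x <-> I2 (pf a - x).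
  rewrite sE -(qpi_eq0 _ I20 I2B) raddfB.
  by split=> [->|/eqP]; [rewrite subrr | rewrite subr_eq0 => /eqP].
split=> [/(I2_d2 ab)[e eE]|[e eE]].
  by exists (- e); rewrite mulNrn -eE opprB opprK addrC.
by apply/I2P; exists (- a - b) => //; exists (- e); rewrite mulNrn -eE opprD.
Qed.

(** The connecting map to I records only part of the class; phi of the lift c supplies an actual
    unit rather than one modulo squares, since c is determined by x up to boundaries and chains with
    coefficients in the kernel of p. *)
Let R (x : homology CK 1) (q : fibprod s (qpi I2)) : Prop :=
  exists (c : C1 1) (z : gker p) (k0 : cyc (PK 1 c)),
  [/\ x = hclass k0, bnd C1 0 c = << (val z : M1) *g [tuple] >>,
    val (val q).2 = qpi (@coinv_rel _ (gker p)) z & (val q).1 = - phi (P 1 c)].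

Lemma H1_fibre_product : isomorphic (homology CK 1) (fibprod s (qpi I2)).
Proof.
have dK_onto (k : gker eps) : exists y, gker_lift eps_p y = k.
  by have [y yk] := p_onto (kerP k); exists y; apply: val_inj.
have chase c : cyc (PK 1 c) -> exists z : gker p,
    bnd C1 0 c = << (val z : M1) *g [tuple] >>.
  move=> c0; have pc : P 0 (bnd C1 0 c) = 0.
    by rewrite -(bmap_gker_lift eps_p) -cmap_bnd (c0 : bnd CK 0 _ = 0) raddf0.
  have pz : p (bnd C1 0 c)@_[tuple] = 0 by rewrite -bmap_coeff pc mcoeff0.
  by exists (in_ker pz); rewrite [LHS]bar0E.
have inI (z : gker p) c : bnd C1 0 c = << (val z : M1) *g [tuple] >> ->
    coinv_map (gker_incl p) (qpi (@coinv_rel _ (gker p)) z) = 0.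
  by move=> cz; rewrite [LHS]quot_mapE; apply/qpi_coinv_eq0/bdryP; exists c.
apply: (isomorphic_of_rel (R := R)).
- move=> x; have [k [k0 ->]] := hclassP x; have [c kc] := bmap_surj k dK_onto.
  move: k0; rewrite -kc => k0; have [z cz] := chase _ k0.
  pose y : I := in_ker (inI _ _ cz).
  have yd2 : d2_unit y (phi (P 1 c)) by exists z, c.
  have fib : (- phi (P 1 c), y) \in fibpred s (qpi I2).
    apply/eqP; apply/(fibre_iff _ yd2); exists 0; by rewrite addNr mul0rn.
  by exists (exist (fun p => p \in fibpred s (qpi I2)) (- phi (P 1 c), y) fib), c, z, k0.
- move=> x x' q q' [c [z [k0 [-> cz qz qc]]]] [c' [z' [k0' [-> cz' qz' qc']]]].
  have k0B : cyc (PK 1 (c - c')) by rewrite (raddfB (PK 1)); apply: cycB.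
  exists (c - c'), (z - z'), k0B; split.
  + exact: (hclass_subE k0 k0' k0B (raddfB (PK 1) c c')).
  + exact: etrans (raddfB2 cz cz') (esym (raddfB (mkmalgU [tuple]) _ _)).
  + rewrite (fibprodB q q') pair_sub2 (ker_sub (val q).2 (val q').2) qz qz'.
    exact/esym/(raddfB (qpi (@coinv_rel _ (gker p)))).
  + rewrite (fibprodB q q') pair_sub1 qc qc'.
    by rewrite (raddf_compB phi (P 1)) opprB opprK addrC.
- move=> q [c [z [k0 [/esym/hclass_eq0/bdryP[k' kk'] cz qz qc]]]].
  have [c' kc'] := bmap_surj k' dK_onto.
  have Pc : P 1 (c - bnd C1 1 c') = 0.
    by rewrite -(bmap_gker_lift eps_p) raddfB -cmap_bnd kc' kk' subrr raddf0.
  have [e ec] := bmap_exact (@gker_exact _ _ _ p) Pc.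
  have ez : bnd CZ 0 e = << z *g [tuple] >>.
    apply/eqP; rewrite -subr_eq0; apply/eqP/(bmap_inj (@gker_incl_inj _ _ _ p)).
    by rewrite raddfB -cmap_bnd ec raddfB bnd_bnd subr0 cz bmapU subrr.
  apply: val_inj; apply: injective_projections => /=.
    rewrite qc; apply/eqP; rewrite oppr_eq0; apply/eqP/phi_bdry.
    by rewrite -[P 1 c](subrK (P 1 (bnd C1 1 c'))) -raddfB Pc add0r -cmap_bnd bdry_bnd.
  by apply: val_inj; rewrite qz; apply/qpi_coinv_eq0/bdryP; exists e.
- move=> x [c [z [k0 [-> cz /esym/qpi_coinv_eq0/bdryP[e ez] /esym/eqP]]]].
  rewrite oppr_eq0 => /eqP phi0; apply/hclass_eq0.
  have PiZ : P 1 (iZ 1 e) = 0 by apply: bmap0 => y; apply: (kerP y).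
  have PKiZ : PK 1 (iZ 1 e) = 0.
    by apply: bmap0 => y; apply: val_inj; apply: (kerP y).
  have x0 : cyc (c - iZ 1 e).
    by rewrite /cyc [LHS](raddfB (bnd C1 0)) cz cmap_bnd ez bmapU subrr.
  (* Since phi vanishes, the remaining torus class satisfies 2a = 0, and such classes bound in the
     kernel of [eps] by [tor2]. *)
  have [a xa] := tor_gen x0; have := phi_cycle xa.
  rewrite (raddfB (P 1)) PiZ subr0 phi0 => /esym/eqP; rewrite oppr_eq0 => /eqP/tor2 ta.
  have := rpredD (cmap_bdry PK xa) ta.
  by rewrite (raddfB (PK 1)) subrK (raddfB (PK 1)) PKiZ subr0.
- move=> q; have [z yz] := coinv_repr (val (val q).2).
  have := kerP (val q).2; rewrite yz => /[dup] qI.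
  rewrite [coinv_map _ _]quot_mapE => /qpi_coinv_eq0/bdryP[c cz].
  have yd2 : d2_unit (val q).2 (phi (P 1 c)) by exists z, c.
  have /eqP/(fibre_iff _ yd2)[e eE] := valP q.
  (* A torus cycle leaves the boundary unchanged and shifts phi by a double, which turns the
     congruence modulo squares into the required equality. *)
  pose c' := c - tor (- e).
  have c'z : bnd C1 0 c' = << (val z : M1) *g [tuple] >>.
    by rewrite raddfB cz (tor_cyc (- e) : bnd C1 0 _ = 0) subr0.
  have k0 : cyc (PK 1 c').
    rewrite /cyc [LHS]cmap_bnd c'z bmapU (_ : gker_lift eps_p (val z) = 0) ?monalgU0 //.
    by apply: val_inj; apply: (kerP z).
  exists (hclass k0), c', z, k0; split=> //.
  by rewrite (raddf_compB phi (P 1)) phi_tor opprK mulNrn -eE opprB addrK.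
Qed.

End SecondDifferential.

(** * Torus cycles on the edge (oo, 0) *)

Section TorusCycles.
Variable A : comUnitRingType.
Local Notation SL2 := (SL2 A).
Local Notation T := (torus A).
Local Notation U := (K1M A).
Local Notation X := (X A).
Local Notation CX n := (bar_complex (X n)).
Local Notation CT := (group_complex T int).
Local Notation phi := (phi A).
Local Notation D1 := (bmap (partial A 0)).
Local Notation "[: g ]" := [tuple g : SL2].

Definition torus_cycle (a : U) : CT 1 := bar1 (torus_diag a).

Lemma cyc_torus1 (c : CT 1) : cyc c.
Proof.
apply: (int_ext (f := bnd CT 0) (h := \0)) => g.
by have [t ->] := bar1_surj g; apply: bnd_bar1.
Qed.

Lemma torus_homologous (c : CT 1) :
  c - torus_cycle (chi_chain (@torus_chi A) c) \in bdry CT 1.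
Proof. exact: (homologous_bar1 (@torus_diagD A) (@torus_diagK A)). Qed.

Lemma torus_cycle0 : torus_cycle 0 \in bdry CT 1.
Proof.
rewrite /torus_cycle torus_diag0; apply/bdryP; exists (bar2 1%g 1%g).
by rewrite bnd_bar2 mulg1 subrr add0r.
Qed.

Lemma chi_torus_cycle (a : U) : chi_chain (@torus_chi A) (torus_cycle a) = a.
Proof. by rewrite (chi_chain1 (@torus_chi A)) torus_chi_diag. Qed.

Lemma unimodular_e2 : unimodular (e2 A).
Proof.
by apply: (@dt_unimodular _ _ (e1 A)); rewrite e1E e2E dt_vec mulr0 mul1r sub0r unitrN unitr1.
Qed.

Lemma dt_e1e2 : dt (e1 A) (e2 A) \is a GRing.unit.
Proof. by rewrite e1E e2E dt_vec mulr1 mulr0 subr0 unitr1. Qed.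

Lemma phi_edge u v (g : SL2) : dt u v \is a GRing.unit ->
  phi (D1 1 << edge u v *g [: g] >>) = phi << pt v *g [: g] >> - phi << pt u *g [: g] >>.
Proof.
by move=> uv; rewrite bmapU partial_edge // (raddfB (mkmalgU [: g])) (raddfB phi).
Qed.

(** On the edge from e_1 to e_2 the matrix diag(a, a^-1) has eigenvalue a^-1 at the end and a at the
    start; the difference is -2a in additive notation. *)
Lemma phi_shapiro_edge (t : CT 1) :
  phi (D1 1 (shapiro_edge A 1 t)) = - (chi_chain (@torus_chi A) t *+ 2).
Proof.
have fB : zmod_morphism (fun t : CT 1 => phi (D1 1 (shapiro_edge A 1 t))).
  by move=> x y; rewrite (raddfB (shapiro_edge A 1)) (raddfB (D1 1)) (raddfB phi).
have gB : zmod_morphism (fun t : CT 1 => - (chi_chain (@torus_chi A) t *+ 2)).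
  by move=> x y; rewrite (raddfB (chi_chain _)) mulrnBl opprB opprK addrC.
apply: (int_ext (f := Additive fB) (h := Additive gB)) => g.
have [a ->] := bar1_surj g.
rewrite -[LHS]/(phi (D1 1 (shapiro_edge A 1 (bar1 a)))).
rewrite -[RHS]/(- (chi_chain (@torus_chi A) (bar1 a) *+ 2)) chi_chain1.
have -> : shapiro_edge A 1 (bar1 a) = << edge (e1 A) (e2 A) *g [: torus_SL2 a] >>.
  rewrite [LHS]shapiro_edgeE edge_edge0; congr mkmalgU.
  by apply: eq_from_tnth => i; rewrite tnth_map; case: i => [[|//] lt_i].
rewrite phi_edge ?dt_e1e2 // (phi_eigen (x := - torus_chi a) unimodular_e2); last first.
  by rewrite e2E torus_vec vecZ !mulr0 !mulr1.
rewrite (phi_eigen (x := torus_chi a) (unimodular_e1 A)) ?mulr2n ?opprD //.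
by rewrite e1E torus_vec vecZ !mulr0 !mulr1.
Qed.

Definition torus_chain (a : U) : CX 1 1%N := shapiro_edge A 1 (torus_cycle a).

Lemma cyc_torus_chain (a : U) : cyc (torus_chain a).
Proof. exact/cmap_cyc/cyc_torus1. Qed.

Lemma torus_chain_gen (x : CX 1 1%N) : cyc x ->
  exists a : U, x - torus_chain a \in bdry (CX 1) 1.
Proof.
move=> /shapiro_edge_surj[c _ xc]; exists (chi_chain (@torus_chi A) c).
apply: bdry_trans xc _; rewrite -(raddfB (shapiro_edge A 1)).
exact/cmap_bdry/torus_homologous.
Qed.

Lemma phi_torus_chain (a : U) : phi (D1 1 (torus_chain a)) = - (a *+ 2).
Proof. by rewrite phi_shapiro_edge chi_torus_cycle. Qed.

Lemma unshapiro_torus_chain (x : CX 1 1%N) a : cyc x ->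
  chi_chain (@torus_chi A) (unshapiro_edge A 1 x) = a ->
  x - torus_chain a \in bdry (CX 1) 1.
Proof.
move=> x0 xa; apply: bdry_trans (unshapiro_edge_homologous x0) _.
by rewrite -(raddfB (shapiro_edge A 1)) -xa; exact/cmap_bdry/torus_homologous.
Qed.

(** Every class in H_1(SL_2(A), X_0) comes from the torus, where phi restricts to the isomorphism
    [torus_chi]. *)
Lemma phi_eq0 : (forall i : nat, (i <= 3)%N ->
    bijective (group_homology_map (@torus_borel A) int i)) ->
  forall y : CX 0 1%N, cyc y -> phi y = 0 -> y \in bdry (CX 0) 1.
Proof.
move=> TB y y0 phi0; have [c _ yc] := torus_oo_surj TB (isT : (1 <= 3)%N) y0.
have := phi_bdry yc; rewrite (raddfB phi) phi0 phi_torus sub0r => /eqP.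
rewrite oppr_eq0 => /eqP chi0; have := torus_homologous c; rewrite chi0 => c0.
have {}c0 := rpredD c0 (torus_cycle0); rewrite subrK in c0.
by have := rpredD yc (cmap_bdry (torus_oo_cmap A) c0); rewrite subrK.
Qed.

End TorusCycles.

(** * The second differential on the elements <<a>> *)

Section PfisterForms.
Variable A : comUnitRingType.
Local Notation vect := 'cV[A]_2.
Local Notation SL2 := (SL2 A).
Local Notation U := (K1M A).
Local Notation X := (X A).
Local Notation phi := (phi A).
Local Notation D1 := (bmap (partial A 0)).
Local Notation "[: g ]" := [tuple g : SL2].
Local Notation d2_unit := (d2_unit phi).

Fact lower_subproof (x : A) : \det (mx2 1 0 x 1) == 1.
Proof. by rewrite det2 !mxE /= mul0r subr0 mulr1. Qed.
Definition lower (x : A) : SL2 := Sub (mx2 1 0 x 1) (lower_subproof x).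

Fact upper_subproof (x : A) : \det (mx2 1 x 0 1) == 1.
Proof. by rewrite det2 !mxE /= mulr0 subr0 mulr1. Qed.
Definition upper (x : A) : SL2 := Sub (mx2 1 x 0 1) (upper_subproof x).

Lemma lower_vec x a b : val (lower x) *m vec a b = vec a (x * a + b).
Proof. by rewrite SL2_vec /= !mxE /= !mul1r mul0r addr0. Qed.

Lemma upper_vec x a b : val (upper x) *m vec a b = vec (a + x * b) b.
Proof. by rewrite SL2_vec /= !mxE /= !mul1r mul0r add0r. Qed.

Lemma std_tri (a : U) : X_gen (std_simplex a) = tri (e1 A) (e2 A) (vec 1 (val a)).
Proof.
rewrite /tri (simp_lines (s := std_simplex a)) // => i.
rewrite tnth_mktuple /std_vect (tnth_nth 0); case: i => [[|[|[|//]]] lt_i] //=.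
by rewrite e1E e2E vecZ mulr0 mulr1 vecD addr0 add0r.
Qed.

Lemma bnd_gen1 (M : gmodule SL2) (m : M) (g : SL2) :
  bnd (bar_complex M) 0 << m *g [: g] >> = << gact M g^-1%g m - m *g [tuple] >>.
Proof. exact: bar_bnd1. Qed.

Lemma bnd_gen1B (M : gmodule SL2) (m m' : M) (g g' : SL2) :
  bnd (bar_complex M) 0 (<< m *g [: g^-1%g] >> - << m' *g [: g'^-1%g] >>) =
  << (gact M g m - m) - (gact M g' m' - m') *g [tuple] >>.
Proof.
apply: etrans (raddfB2 (bnd_gen1 m g^-1%g) (bnd_gen1 m' g'^-1%g)) _; rewrite !invgK.
exact: esym (raddfB (mkmalgU [tuple]) _ _).
Qed.

Lemma dt_std (a : U) : [/\ dt (e1 A) (e2 A) \is a GRing.unit,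
  dt (e1 A) (vec 1 (val a)) \is a GRing.unit & dt (e2 A) (vec 1 (val a)) \is a GRing.unit].
Proof.
rewrite e1E e2E !dt_vec !(mulr1, mulr0, mul0r, mul1r, subr0, sub0r) unitrN unitr1.
by split=> //; apply: valP.
Qed.

Lemma partial_std (a : U) : partial A 1 (X_gen (std_simplex a)) =
  edge (e2 A) (vec 1 (val a)) - edge (e1 A) (vec 1 (val a)) + edge (e1 A) (e2 A).
Proof. by have [h1 h2 h3] := dt_std a; rewrite std_tri; apply: partial_tri. Qed.

Lemma sub_rearrange (V : zmodType) (x y z x' y' : V) :
  (x - y + z) - (x' - y' + z) = (x - x') - (y - y').
Proof. by rewrite opprD addrACA subrr addr0 !opprD !opprK addrACA. Qed.

(** The triangles (oo, 0, a) and (oo, 0, 1) share the edge (oo, 0). Their edges at 0 are matched by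
    a lower unipotent matrix, those at oo by an upper one. The lower one sends e_1 + e_2 to e_1 + a
    e_2 exactly, the upper one only to a^-1 times it, and this factor is the value of d^2. *)
Lemma d2_pfister (a : U) : d2_unit (pfister a) (- a).
Proof.
pose u1 : vect := vec 1 (val (0 : U)); pose ua : vect := vec 1 (val a).
have [h1 h2 h3] := dt_std 0; have [_ h2a h3a] := dt_std a.
have ug : val (lower (val a - 1)) *m u1 = ua.
  by rewrite lower_vec mulr1 subrK.
have vg : val (upper ((val a)^-1 - 1)) *m u1 = (val a)^-1 *: ua.
  by rewrite upper_vec vecZ !mulr1 addrC subrK mulVr // (valP a).
have ue : val (lower (val a - 1)) *m e2 A = e2 A by rewrite e2E lower_vec mulr0 add0r.
have ve : val (upper ((val a)^-1 - 1)) *m e1 A = e1 A by rewrite e1E upper_vec mulr0 addr0.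
have u11 : unimodular u1 by apply: (@dt_unimodular _ _ (e1 A)); rewrite dt_unitC.
have ua1 : unimodular ua by apply: (@dt_unimodular _ _ (e1 A)); rewrite dt_unitC.
have invE (g : SL2) (u v : vect) : val g *m u = v -> val g^-1%g *m v = u.
  by move=> <-; rewrite mulmxA -SL2_valM mulVg mul1mx.
set g1 := lower _ in ug ue; set g2 := upper _ in vg ve.
exists (partial_Z1 A (X_gen (std_simplex a)) - partial_Z1 A (X_gen (std_simplex 0))).
exists (<< edge (e2 A) u1 *g [: g1^-1%g] >> - << edge (e1 A) u1 *g [: g2^-1%g] >>).
split.
- rewrite [LHS]/(GW_class a - GW_class 0); symmetry.
  by apply: raddfB2; rewrite /GW_class [RHS]quot_mapE.
- apply: etrans (bnd_gen1B _ _ _ _) _; congr (mkmalgU [tuple]).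
  have E1 : gact (X 1) g1 (edge (e2 A) u1) = edge (e2 A) ua.
    by apply: etrans (edge_act g1 h3) _; rewrite ug ue.
  have E2 : gact (X 1) g2 (edge (e1 A) u1) = edge (e1 A) ua.
    apply: etrans (edge_act g2 h2) _; rewrite vg ve; apply: eq_edge => //.
    by apply: line_scale; rewrite unitrV (valP a).
  apply: etrans (congr2 (fun x y : X 1 => (x - edge (e2 A) u1) - (y - edge (e1 A) u1)) E1 E2) _.
  apply: etrans (esym (sub_rearrange _ _ (edge (e1 A) (e2 A)) _ _)) _.
  exact: esym (congr2 (fun x y : X 1 => x - y) (partial_std a) (partial_std 0)).
- have [nu nuP] := phi_pt A.
  have N1 := nuP u1 ua g1^-1%g 0 u11 ua1 (etrans (invE _ _ _ ug) (esym (scale1r _))).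
  have N2 : phi << pt u1 *g [: g2^-1%g] >> = nu ua + a - nu u1.
    apply: nuP => //.
    by rewrite -(invE _ _ _ vg) -scalemxAr scalerA mulrV ?scale1r ?(valP a).
  have N3 := phi_eigen (x := 0) (unimodular_e2 A) (etrans (invE _ _ _ ue) (esym (scale1r _))).
  have N4 := phi_eigen (x := 0) (unimodular_e1 A) (etrans (invE _ _ _ ve) (esym (scale1r _))).
  apply: etrans (raddf_compB phi (D1 1) _ _) _.
  apply: etrans (congr2 (fun x y : U => x - y) (phi_edge g1^-1%g h3) (phi_edge g2^-1%g h2)) _.
  apply: etrans (congr2 (fun x y : U => x - y) (congr2 (fun x y : U => x - y) N1 N3)
    (congr2 (fun x y : U => x - y) N2 N4)) _.
  move: (nu ua) (nu u1) => x y.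
  by rewrite !subr0 addr0 (addrAC x a) opprD addrA subrr add0r.
Qed.

End PfisterForms.

(** * The central element -1, the group I^2(A) and H_2 *)

Section MilnorWitt.
Variable A : comUnitRingType.
Local Notation vect := 'cV[A]_2.
Local Notation SL2 := (SL2 A).
Local Notation U := (K1M A).
Local Notation X := (X A).
Local Notation CX n := (bar_complex (X n)).
Local Notation phi := (phi A).
Local Notation D1 := (bmap (partial A 0)).
Local Notation PK := (bmap (gker_lift (@aug_partial A))).
Local Notation "[: g ]" := [tuple g : SL2].

Section MinusOne.
Variable a : U.
Hypothesis aN1 : val a = -1.
Let h : SL2 := torus_SL2 (torus_diag a).

Lemma minus1_vec (u : vect) : val h *m u = (-1) *: u.
Proof.
by rewrite [u]vecE [LHS]torus_vec vecZ torus_chi_diag aN1 invrN invr1.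
Qed.

Lemma minus1_central (g : SL2) : (h * g = g * h)%g.
Proof.
by apply: SL2_eq; rewrite !SL2_valM -!mulmxA !minus1_vec -scalemxAr.
Qed.

Lemma minus1_simplex n (s : simplex A n) : simplex_act h s = s.
Proof.
apply: simplex_eq => i; have [v [_ sv _]] := is_simplex_valP s.
rewrite tnth_map sv line_act_line minus1_vec.
by apply: line_scale; rewrite unitrN unitr1.
Qed.

Lemma minus1_simplexV n (s : simplex A n) : simplex_act h^-1%g s = s.
Proof. by rewrite -{1}(minus1_simplex s) -simplex_actM mulVg simplex_act1. Qed.

Lemma minus1_unshapiro (s : simplex A 1) :
  chi_chain (@torus_chi A) (unshapiro_edge A 1 << X_gen s *g [: h] >>) = a.
Proof.
have -> : unshapiro_edge A 1 << X_gen s *g [: h] >> = bar1 (torus_diag a).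
  apply: etrans (unshapiroE _ _ _ _ _ _) _; congr mkmalgU.
  apply: eq_from_tnth => i; rewrite tnth_map tnth_mktuple; case: i => [[|//] lt_i].
  rewrite /= invg1 simplex_act1 minus1_simplexV.
  by rewrite -mulgA minus1_central mulKg; apply: in_torus_val.
by rewrite (chi_chain1 (@torus_chi A)) torus_chi_diag.
Qed.

(** As -1 is central and fixes every simplex, each of the three edges of the triangle contributes
    the same torus class, with total sign 1 - 1 + 1 = 1. The chain [m] itself becomes 0 in K, being
    a boundary of X_2. *)
Lemma minus1_bdry : PK 1 (torus_chain a) \in bdry (bar_complex (K0 A)) 1.
Proof.
pose t := std_simplex (0 : U); pose m := partial A 1 (X_gen t).
have fB : zmod_morphism (fun x : X 1 =>
    chi_chain (@torus_chi A) (unshapiro_edge A 1 << x *g [: h] >>)).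
  move=> x y; apply: etrans (congr1 _ (raddf_compB (unshapiro_edge A 1) (mkmalgU [: h]) x y)) _.
  exact: (raddfB (chi_chain _)).
have chim : chi_chain (@torus_chi A) (unshapiro_edge A 1 << m *g [: h] >>) = a.
  apply: etrans (partial_gen_const (F := Additive fB) t minus1_unshapiro) _.
  by rewrite alt_sum3 subrr add0r.
have hm : gact (X 1) h^-1%g m = m.
  apply: (X_ext (f := gact (X 1) h^-1%g) (h := idfun)) => s.
  by apply: etrans (gact_gen _ _) _; rewrite minus1_simplexV.
have m0 : cyc (<< m *g [: h] >> : CX 1 1%N).
  by apply: etrans (bnd_gen1 m h) _; rewrite hm subrr monalgU0.
have := cmap_bdry PK (unshapiro_torus_chain m0 chim).
have Pm : PK 1 (<< m *g [: h] >> : CX 1 1%N) = 0.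
  apply: etrans (bmapU _ _ _) _; rewrite (_ : gker_lift _ m = 0) ?monalgU0 //.
  by apply: val_inj; apply: (partial_partial (X_gen t)).
by rewrite (raddfB (PK 1)) Pm sub0r rpredN.
Qed.

End MinusOne.

Lemma torus_chain2 (mu2 : forall a : A, a ^+ 2 = 1 -> a = 1 \/ a = -1) (a : U) :
  a *+ 2 = 0 -> PK 1 (torus_chain a) \in bdry (bar_complex (K0 A)) 1.
Proof.
move=> /(congr1 val)/= a2; have [a1|aN1] := mu2 (val a) a2; last exact: minus1_bdry.
have -> : a = 0 by apply: val_inj.
exact: (cmap_bdry PK (cmap_bdry (shapiro_edge A) (torus_cycle0 A))).
Qed.

(** Through phi the term E^2_{0,1} becomes units modulo squares: the image of H_1(X_1) has the
    squares as its values, and a cycle of X_0 on which phi vanishes bounds. *)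
Lemma I2_unit : (forall i : nat, (i <= 3)%N ->
    bijective (group_homology_map (@torus_borel A) int i)) ->
  forall x : fundamental_ideal A, I2 x <-> exists2 b, d2_unit phi x b & square b.
Proof.
move=> TB x; split=> [[z [c [y [xz cz yc /esym/qpi_range_eq0[w wy]]]]]|[b [z [c [xz cz cb]]] [e be]]].
  exists (phi (D1 1 c)); first by exists z, c.
  have [x1 [x10 wE]] := hclassP w.
  have xy : hclass (cmap_cyc D1 x10) = hclass (kerP y).
    apply: etrans (esym (homology_mapE x10 _)) _; rewrite -wE; apply: etrans wy _.
    by congr (qpi _ _); apply: val_inj.
  move: xy => /hclass_eq/phi_bdry; rewrite (raddfB phi) yc => /eqP.
  rewrite subr_eq0 => /eqP <-; have [a xa] := torus_chain_gen x10.
  exists (- a); rewrite mulNrn -phi_torus_chain; apply/eqP; rewrite -subr_eq0.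
  by rewrite -(raddf_compB phi (D1 1)); apply/eqP/phi_bdry/(cmap_bdry D1).
have y0 : cyc (D1 1 c).
  apply: etrans (cmap_bnd D1 c) _; rewrite cz; apply: etrans (bmapU _ _ _) _.
  by rewrite (kerP z) monalgU0.
exists z, c, (in_ker y0); split=> //; apply/esym/qpi_range_eq0.
exists (hclass (cyc_torus_chain (- e))).
rewrite [LHS](homology_mapE _ (cmap_cyc D1 (cyc_torus_chain (- e)))).
rewrite -[RHS]/(hclass y0); apply/hclass_eq/(phi_eq0 TB); first exact/cycB/y0/cmap_cyc/cyc_torus_chain.
apply: etrans (raddfB2 (phi_torus_chain (- e)) (etrans cb be)) _.
by rewrite mulNrn opprK subrr.
Qed.

Lemma torus_SL2_H2 (mu2 : forall a : A, a ^+ 2 = 1 -> a = 1 \/ a = -1)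
    (TB : forall i : nat, (i <= 3)%N ->
       bijective (group_homology_map (@torus_borel A) int i)) :
  GE2_ring A ->
  exists2 s : {additive K1M A -> I_mod_I2 A}, pfister_mod_spec s &
    isomorphic (rel_homology (@torus_SL2 A) int 2) (K1MW s).
Proof.
move=> ge2; have I2P := I2_unit TB.
have [I20 I2B] := I2_closed (@phi_bdry A) (@torus_chain_gen A) (@phi_torus_chain A) I2P.
have sB : zmod_morphism (fun a : U => qpi (@I2 A) (pfister a)).
  move=> a b; rewrite -raddfB; apply/eqP; rewrite -subr_eq0 -raddfB; apply/eqP.
  (* The differential takes the value 0 on the defect of additivity of a |-> <<a>>, so the defect
     lies in I^2(A). *)
  apply/(qpi_eq0 _ I20 I2B)/I2P; exists (- (a - b) - (- a - - b)).
    by apply/d2_unitB/d2_unitB/d2_pfister/d2_pfister/d2_pfister.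
  by exists 0; rewrite opprB opprK (addrC (- a)) subrr mul0rn.
pose s : {additive U -> I_mod_I2 A} := Additive sB.
have sE a : s a = qpi (@I2 A) (pfister a) by [].
exists s => //; apply: isomorphic_trans (rel_homology_K0 (n := 0) isT TB) _.
refine (H1_fibre_product (X0_exact (GE2_connected ge2)) (@phi_bdry A) (@cyc_torus_chain A)
  (@torus_chain_gen A) (@phi_torus_chain A) I2P sE (@d2_pfister A) (torus_chain2 mu2)).
Qed.

End MilnorWitt.

(** * The refined scissors congruence group *)

Lemma raddfMn2 (V W : zmodType) (f : {additive V -> W}) x y n : f x = y -> f (x *+ n) = y *+ n.
Proof. by move=> <-; apply: raddfMn. Qed.

(* The composite of the connecting homomorphisms H_2(K) -> H_1(ker p0) -> H_0(ker p1). *)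
Section IteratedConnecting.
Variables (G : groupType) (M2 M1 M0 N : gmodule G).
Variables (p1 : gmor M2 M1) (p0 : gmor M1 M0) (eps : gmor M0 N).
Hypothesis p01 : forall x, p0 (p1 x) = 0.
Hypothesis p0_ex : forall x, p0 x = 0 -> exists y, p1 y = x.
Hypothesis eps_p : forall x, eps (p0 x) = 0.
Hypothesis eps_ex : forall x, eps x = 0 -> exists y, p0 y = x.
Local Notation C2 := (bar_complex M2).
Local Notation C1 := (bar_complex M1).
Local Notation CK := (bar_complex (gker eps)).
Local Notation P1 := (bmap p1).
Local Notation P0 := (bmap p0).
Local Notation PK := (bmap (gker_lift eps_p)).
Local Notation iZ := (bmap (gker_incl p1)).
Local Notation RP := (ker (coinv_map (gker_incl p1))).

Let PK_P0 n (c : C1 n) : PK n c = 0 -> P0 n c = 0.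
Proof. by move=> c0; rewrite -(bmap_gker_lift eps_p) c0 raddf0. Qed.

Let PK_P1 n (c : C2 n) : PK n (P1 n c) = 0.
Proof.
apply: (malg_ext (f := PK n \o P1 n) (h := \0)) => m g.
rewrite -[LHS]/(PK n (P1 n << m *g g >>)); apply: etrans (congr1 _ (bmapU _ _ _)) _.
apply: etrans (bmapU _ _ _) _; rewrite (_ : gker_lift _ _ = 0) ?monalgU0 //.
by apply: val_inj; apply: p01.
Qed.

Let R (x : homology CK 2) (r : RP) : Prop :=
  exists (c : C1 2) (u : C2 1) (m : gker p1) (k0 : cyc (PK 2 c)),
  [/\ x = hclass k0, bnd C1 1 c = P1 1 u, bnd C2 0 u = << (val m : M2) *g [tuple] >>
    & val r = qpi (@coinv_rel _ (gker p1)) m].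

Let lift0 (u : C2 0) : P1 0 u = 0 ->
  exists m : gker p1, u = << (val m : M2) *g [tuple] >>.
Proof.
move=> pu; have pm : p1 u@_[tuple] = 0 by rewrite -bmap_coeff pu mcoeff0.
by exists (in_ker pm); rewrite [LHS]bar0E.
Qed.

Let K_onto (k : gker eps) : exists y, gker_lift eps_p y = k.
Proof. by have [y yk] := eps_ex (kerP k); exists y; apply: val_inj. Qed.

Let R_total x : exists r, R x r.
Proof.
have [k [k0 ->]] := hclassP x; have [c kc] := bmap_surj k K_onto.
move: k0; rewrite -kc => k0.
have /PK_P0/(bmap_exact p0_ex)[u uc] : PK 1 (bnd C1 1 c) = 0.
  by rewrite -cmap_bnd; exact: k0.
have [|m mu] := lift0 (u := bnd C2 0 u).
  by rewrite -cmap_bnd uc; apply: bnd_bnd.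
have rm : coinv_map (gker_incl p1) (qpi (@coinv_rel _ (gker p1)) m) = 0.
  by rewrite [LHS]quot_mapE; apply/qpi_coinv_eq0/bdryP; exists u.
by exists (in_ker rm), c, u, m, k0.
Qed.

Let R_sub x x' r r' : R x r -> R x' r' -> R (x - x') (r - r').
Proof.
move=> [c [u [m [k0 [-> cu um rm]]]]] [c' [u' [m' [k0' [-> cu' um' rm']]]]].
have k0B : cyc (PK 2 (c - c')) by rewrite (raddfB (PK 2)); apply: cycB.
exists (c - c'), (u - u'), (m - m'), k0B; split.
- exact: (hclass_subE k0 k0' k0B (raddfB (PK 2) c c')).
- exact: etrans (raddfB2 cu cu') (esym (raddfB (P1 1) u u')).
- exact: etrans (raddfB2 um um') (esym (raddfB (mkmalgU [tuple]) _ _)).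
- exact: etrans (raddfB2 rm rm') (esym (raddfB (qpi _) m m')).
Qed.

Let R_fun0 r : R 0 r -> r = 0.
Proof.
move=> [c [u [m [k0 [/esym/hclass_eq0/bdryP[k' kk'] cu um rm]]]]].
have [c' kc'] := bmap_surj k' K_onto.
have /PK_P0/(bmap_exact p0_ex)[w wc] : PK 2 (c - bnd C1 2 c') = 0.
  by rewrite (raddfB (PK 2)) -cmap_bnd kc' kk' subrr.
have /(bmap_exact (@gker_exact _ _ _ p1))[v vu] : P1 1 (u - bnd C2 1 w) = 0.
  by rewrite (raddfB (P1 1)) -cmap_bnd wc (raddfB (bnd C1 1)) bnd_bnd subr0 cu subrr.
apply: val_inj; rewrite rm; apply/qpi_coinv_eq0/bdryP; exists v.
apply/eqP; rewrite -subr_eq0; apply/eqP/(bmap_inj (@gker_incl_inj _ _ _ p1)).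
rewrite (raddfB (iZ 0)) -cmap_bnd vu (raddfB (bnd C2 0)) bnd_bnd subr0 um.
by rewrite bmapU subrr.
Qed.

Hypothesis C2_tor : forall x : C2 1, cyc x -> x *+ 2 \in bdry C2 1.
Hypothesis C1_tor : forall x : C1 2, cyc x -> PK 2 x *+ 2 \in bdry CK 2.
Hypothesis Z1_tor : forall x : C1 1, cyc x -> P0 1 x = 0 -> x *+ 2 \in bdry C1 1.

(** For the kernel one doubling makes a 1-cycle of M2 bound and a second one makes the image of a
    2-cycle of M1 bound, whence 4. For the cokernel a single doubling lets the image of u in M1
    bound, whence 2. *)
Lemma connecting_map : exists f : {additive homology CK 2 -> RP},
  (forall x, f x = 0 -> x *+ 4 = 0) /\ (forall r, exists x, f x = r *+ 2).
Proof.
have [f fP] := additive_of_rel R_total R_sub R_fun0; exists f; split=> [x|r].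
  move/fP=> [c [u [m [k0 [-> cu um /esym/qpi_coinv_eq0/bdryP[v vm]]]]]].
  have u0 : cyc (u - iZ 1 v).
    by rewrite /cyc [LHS](raddfB (bnd C2 0)) um cmap_bnd vm bmapU subrr.
  have /bdryP[w wu] := C2_tor u0.
  have P1iZ : P1 1 (iZ 1 v) = 0 by apply: bmap0 => y; apply: (kerP y).
  have c0 : cyc (c *+ 2 - P1 2 w).
    rewrite /cyc [LHS](raddfB (bnd C1 1)) cmap_bnd wu.
    rewrite (raddfMn (P1 1)) (raddfB (P1 1)) P1iZ subr0 -cu.
    by rewrite (raddfMn (bnd C1 1)) subrr.
  have := C1_tor c0; rewrite (raddfB (PK 2)) PK_P1 subr0 (raddfMn (PK 2)) -mulrnA.
  move=> c4; have k4 : cyc (PK 2 c *+ 4).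
    by rewrite /cyc (raddfMn (bnd_out CK 2)) k0 mul0rn.
  apply: etrans (_ : hclass k4 = 0); last exact/hclass_eq0.
  by rewrite /hclass -(raddfMn (qpi _)); congr (qpi _ _); apply: val_inj; rewrite (raddfMn val).
have [m rm] := coinv_repr (val r).
have := kerP r; rewrite rm [coinv_map _ _]quot_mapE => /qpi_coinv_eq0/bdryP[u um].
have u0 : cyc (P1 1 u).
  apply: etrans (cmap_bnd P1 u) _; rewrite um bmapU.
  by rewrite (_ : p1 (val m) = 0) ?monalgU0 //; apply: (kerP m).
have Pu : P0 1 (P1 1 u) = 0.
  apply: (malg_ext (f := P0 1 \o P1 1) (h := \0)) => x g.
  rewrite -[LHS]/(P0 1 (P1 1 << x *g g >>)); apply: etrans (congr1 _ (bmapU _ _ _)) _.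
  by apply: etrans (bmapU _ _ _) _; rewrite p01 monalgU0.
have /bdryP[c cu] := Z1_tor u0 Pu.
have cu2 : bnd C1 1 c = P1 1 (u *+ 2) by rewrite (raddfMn (P1 1)).
have k0 : cyc (PK 2 c).
  by apply: etrans (cmap_bnd PK c) _; rewrite cu2 PK_P1.
exists (hclass k0); apply/fP; exists c, (u *+ 2), (m *+ 2), k0; split.
- reflexivity.
- exact: cu2.
- apply: etrans (raddfMn2 2 um) _; exact: esym (raddfMn (mkmalgU [tuple]) _ _).
- apply: etrans (raddfMn2 (f := val) 2 rm) _; exact: esym (raddfMn (qpi _) _ _).
Qed.

End IteratedConnecting.

(** * Permutation modules whose stabilizers have exponent 2 *)

Section InvolutiveStabilizers.
Variables (G : groupType) (S : choiceType) (act : G -> S -> S).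
Hypotheses (act1 : forall s, act 1%g s = s).
Hypotheses (actM : forall g h s, act (g * h)%g s = act g (act h s)).
Hypothesis stab2 : forall g s, act g s = s -> (g * g = 1)%g.
Local Notation C := (bar_complex (permmod act1 actM)).

Let in_orbit (s : S) : pred S := fun t => `[< exists g, act g s = t >].

Let orbit_ex s : exists t, in_orbit s t.
Proof. by exists s; apply/asboolP; exists 1%g; apply: act1. Qed.

Let rep (s : S) : S := xchoose (orbit_ex s).

Let repP s : exists g, act g (rep s) = s.
Proof.
have /asboolP[g gs] := xchooseP (orbit_ex s).
by exists g^-1%g; rewrite /rep -gs -actM mulVg act1.
Qed.

(** [xchoose] depends only on the extension of its predicate, so points of one orbit get the same
    representative. *)
Let rep_act g s : rep (act g s) = rep s.
Proof.
apply: eq_xchoose => t; apply: asbool_equiv_eq; split=> [] [h <-].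
  by exists (h * g)%g; rewrite actM.
by exists (h * g^-1)%g; rewrite actM -(actM g^-1%g) mulVg act1.
Qed.

Let sigma s : G := projT1 (cid (repP s)).

Let sigmaE s : act (sigma s) (rep s) = s.
Proof. by rewrite /sigma; case: cid. Qed.

Let verts1 (x : nat -> G) s : verts act1 actM 1 x s =
  cell act1 actM (act (x 0%N)^-1%g s) [tuple ((x 0%N)^-1 * x 1%N)%g].
Proof.
congr cell; apply: eq_from_tnth => i; rewrite tnth_mktuple; case: i => [[|//] lt_i].
by rewrite (tnth_nth 1%g).
Qed.

(** For g of square 1 the boundary of [g|g] is 2[g] - [1], and [1] is the boundary of [1|1]. *)
Lemma stab_cell2 t (g : G) : act g t = t ->
  cell act1 actM t [tuple g] *+ 2 \in bdry C 1.
Proof.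
move=> gt; have gg := stab2 gt.
have gV : g^-1%g = g by apply: (mulgI g); rewrite mulgV gg.
have b1 : cell act1 actM t [tuple 1%g] \in bdry C 1.
  apply/bdryP; exists (verts act1 actM 2 (fun=> 1%g) t).
  apply: etrans (bnd_verts _ _ _ _ _) _.
  apply: etrans (alt_sum3 (fun i => verts act1 actM 1 ((fun=> 1%g) \o bump i) t)) _.
  by rewrite subrr add0r verts1 /= invg1 act1 mulg1.
have b2 : cell act1 actM t [tuple g] - cell act1 actM t [tuple 1%g] + cell act1 actM t [tuple g]
    \in bdry C 1.
  pose x k : G := if k == 1%N then g else 1%g.
  apply/bdryP; exists (verts act1 actM 2 x t).
  apply: etrans (bnd_verts _ _ _ _ _) _.
  apply: etrans (alt_sum3 (fun i => verts act1 actM 1 (x \o bump i) t)) _.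
  by rewrite !verts1 /= /x /= invg1 act1 gV gt !mulg1 mul1g.
by have := rpredD b2 b1; rewrite addrAC subrK mulr2n.
Qed.

(** Straightening moves a cycle to cells [g] based at orbit representatives that g stabilizes. *)
Lemma cyc1_torsion2 (x : C 1) : cyc x -> x *+ 2 \in bdry C 1.
Proof.
move=> x0; have := straighten_homologous sigma x0 => /(rpredMn 2).
rewrite mulrnBl; suff: straighten act1 actM sigma 1 x *+ 2 \in bdry C 1.
  by move=> h1 h2; have := rpredD h2 h1; rewrite subrK.
pose B : set (C 1) := fun y => y \in bdry C 1.
have B0 : B 0 by apply: rpred0.
have BB u v : B u -> B v -> B (u - v) by apply: rpredB.
have fB : zmod_morphism (fun x : C 1 => qpi B (straighten act1 actM sigma 1 x *+ 2)).
  by move=> u v; rewrite (raddfB (straighten act1 actM sigma 1)) mulrnBl raddfB.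
apply/(qpi_eq0 _ B0 BB).
apply: (perm_ext (f := Additive fB) (h := \0)) => s g.
rewrite -[LHS]/(qpi B (straighten act1 actM sigma 1 (cell act1 actM s g) *+ 2)).
apply/(qpi_eq0 _ B0 BB); rewrite (straighten_cell _ _ sigmaE).
have -> : straight act sigma s g =
    [tuple ((sigma s)^-1 * thead g * sigma (act (thead g)^-1 s))%g].
  apply: eq_from_tnth => i; rewrite tnth_mktuple; case: i => [[|//] lt_i].
  rewrite (tnth_nth 1%g [tuple _]) /= invg1 act1 /thead.
  by congr (_ * tnth g _ * sigma (act (tnth g _)^-1 _))%g; apply: val_inj.
apply: stab_cell2; rewrite -[RHS](actK act1 actM (sigma s)) sigmaE !actM.
by rewrite -(rep_act (thead g)^-1%g s) sigmaE (actKV act1 actM).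
Qed.

End InvolutiveStabilizers.

Section SimplexStabilizers.
Variable A : comUnitRingType.
Local Notation vect := 'cV[A]_2.
Local Notation SL2 := (SL2 A).
Local Notation U := (K1M A).

Lemma dtZ (a b : A) (u v : vect) : dt (a *: u) (b *: v) = a * b * dt u v.
Proof. by rewrite /dt !mxE; ring. Qed.

Lemma fixes_basis (g : SL2) (u v : vect) : dt u v \is a GRing.unit ->
  val g *m u = u -> val g *m v = v -> g = 1%g.
Proof.
rewrite -dt_unitmx => uv gu gv; apply: val_inj.
have : row_mx (val g *m u) (val g *m v) = val g *m row_mx u v :> 'M[A]_2.
  by rewrite -mul_mx_row.
by rewrite gu gv => guv; rewrite -[val g](mulmxK uv) -guv mulmxV.
Qed.

(** The three vectors are scaled by units a, b, c, and determinant 1 forces ab = ac = bc = 1. Hence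
    a^2 = a^2 bc = (ab)(ac) = 1, and likewise for b. *)
Lemma stab_simplex2 (g : SL2) (s : simplex A 2) : simplex_act g s = s -> (g * g = 1)%g.
Proof.
move=> gs; have [v [v1 sv v_inv]] := is_simplex_valP s.
have eig i : exists c : U, val g *m v i = val c *: v i.
  apply: line_unit => //; have := congr1 (fun s : simplex A 2 => tnth (val s) i) gs.
  by rewrite tnth_map sv line_act_line.
have dtv i j : i != j -> dt (v i) (v j) \is a GRing.unit.
  by move=> ij; rewrite -dt_unitmx; apply: v_inv.
have inv i j (a b : U) : i != j -> val g *m v i = val a *: v i ->
    val g *m v j = val b *: v j -> val a * val b = 1.
  move=> /dtv uij ga gb; have := dt_act g (v i) (v j).
  by rewrite ga gb dtZ -{2}(mul1r (dt (v i) (v j))) => /(mulIr uij).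
have [a ga] := eig 0; have [b gb] := eig 1; have [c gc] := eig ord_max.
have ab := inv 0 1 a b isT ga gb; have ac := inv 0 ord_max a c isT ga gc.
have bc := inv 1 ord_max b c isT gb gc.
have a2 : val a * val a = 1 by rewrite -[LHS]mulr1 -bc mulrACA ab ac mulr1.
have b2 : val b * val b = 1 by rewrite -[LHS]mulr1 -ac mulrACA (mulrC (val b)) ab bc mulr1.
apply: (fixes_basis (dtv 0 1 isT)); rewrite SL2_valM -mulmxA.
  by rewrite ga -scalemxAr ga scalerA a2 scale1r.
by rewrite gb -scalemxAr gb scalerA b2 scale1r.
Qed.

End SimplexStabilizers.

Lemma raddf_compDB (V W Z : zmodType) (f : {additive W -> Z}) (g h : {additive V -> W}) x y :
  f (g (x - y)) + f (h (x - y)) = f (g x) + f (h x) - (f (g y) + f (h y)).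
Proof. by rewrite !raddfB addrACA opprD. Qed.

Lemma cmap_bdryB (C D : complex) (f : cmap C D) n (x y : C n) :
  x - y \in bdry C n -> f n x - f n y \in bdry D n.
Proof. by move=> xy; rewrite -raddfB; apply: cmap_bdry. Qed.

Lemma bdry_mul2 (C : complex) n (x y : C n) :
  x - y \in bdry C n -> y *+ 2 \in bdry C n -> x *+ 2 \in bdry C n.
Proof.
by move=> xy y2; have := rpredD (rpredMn 2 xy) y2; rewrite mulrnBl subrK.
Qed.

Lemma bdry_opp_mul2 (C : complex) n (x y : C n) :
  x + y = 0 -> y - x \in bdry C n -> x *+ 2 \in bdry C n.
Proof.
move=> /eqP; rewrite addr_eq0 => /eqP -> h.
by rewrite mulNrn mulr2n opprD -rpredN opprD opprK; move: h; rewrite opprK.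
Qed.

(** * The edge (oo, 0) and its flip *)

Section FlippedEdge.
Variable A : comUnitRingType.
Local Notation SL2 := (SL2 A).
Local Notation T := (torus A).
Local Notation X := (X A).
Local Notation CX n := (bar_complex (X n)).
Local Notation CT := (group_complex T int).
Local Notation act1 n := (@simplex_act1 A n).
Local Notation actM n := (fun g h => @simplex_actM A g h n).
Local Notation PK := (bmap (gker_lift (@aug_partial A))).
Local Notation P0 := (bmap (partial A 0)).

Let w : SL2 := SL2_E 0.

Lemma torus_conj (t : T) : (torus_SL2 t * w = w * (torus_SL2 t)^-1)%g.
Proof.
have tV x y : val (torus_SL2 t)^-1%g *m vec x y =
    vec ((val (torus_chi t))^-1 * x) (val (torus_chi t) * y).
  rewrite -[(torus_SL2 t)^-1%g]/(torus_SL2 t^-1%g) [LHS]torus_vec torus_chiV /=.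
  by rewrite invrK.
apply: SL2_eq; rewrite ?e1E ?e2E !SL2_valM -!mulmxA tV !E_vec [LHS]torus_vec;
  by congr vec; rewrite !(mul0r, mulr0, mulr1, addr0, add0r, mulrN, oppr0).
Qed.

Definition edge1 : simplex A 1 := simplex_act w (edge0 A).

Lemma torus_edge1 (t : T) : simplex_act (torus_SL2 t) edge1 = edge1.
Proof.
rewrite /edge1 -simplex_actM torus_conj simplex_actM; congr simplex_act.
exact: (torus_edge0 t^-1%g).
Qed.

Lemma edge1E : X_gen edge1 = edge (e2 A) (e1 A).
Proof.
rewrite -gact_gen edge_edge0; apply: etrans (edge_act w (dt_e1e2 A)) _.
apply: eq_edge; rewrite e1E e2E E_vec !(mul0r, add0r, oppr0) //.
by rewrite -[RHS](line_scale _ (unitrN1 A)) vecZ mulr0 mulr1.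
Qed.

Definition flip_edge : cmap CT (CX 1) :=
  @shapiro SL2 T (simplex A 1) _ (act1 1) (actM 1) (@torus_SL2 A) edge1 torus_edge1.

Lemma flip_edgeE n (h : n.-tuple T) :
  flip_edge n (barg h) = << X_gen edge1 *g map_tuple (@torus_SL2 A) h >>.
Proof. exact: shapiroE. Qed.

Lemma conj_stab (s : SL2) (t : T) : simplex_act s (edge0 A) = edge1 ->
  (s^-1 * torus_SL2 t * s = torus_SL2 t^-1)%g.
Proof.
move=> se; have : simplex_act (w^-1 * s)%g (edge0 A) = edge0 A.
  by rewrite simplex_actM se -simplex_actM mulVg simplex_act1.
move/stab_edge0; set t0 := in_torus _ => t0E.
have -> : s = (w * torus_SL2 t0)%g by rewrite t0E mulVKg.
rewrite -mulgA (mulgA _ w) torus_conj invgM -!mulgA mulKg.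
rewrite -[LHS]/(torus_SL2 (t0^-1 * (t^-1 * t0))%g); congr torus_SL2.
by rewrite (torus_mulC t^-1%g) mulKg.
Qed.

Lemma unshapiro_flip n (c : CT n) :
  unshapiro_edge A n (flip_edge n c) = inv_cmap (@torus_mulC A) n c.
Proof.
apply: (int_ext (f := unshapiro_edge A n \o flip_edge n)
  (h := inv_cmap (@torus_mulC A) n)) => h.
rewrite -[LHS]/(unshapiro_edge A n (flip_edge n (barg h))) flip_edgeE.
rewrite -[RHS]/(inv_cmap (@torus_mulC A) n (barg h)) inv_cmapE.
apply: etrans (unshapiroE _ _ _ _ _ _) _; congr mkmalgU.
apply: eq_from_tnth => j; rewrite tnth_map tnth_mktuple !tnth_map.
have stabV g : simplex_act g edge1 = edge1 -> simplex_act g^-1%g edge1 = edge1.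
  by move=> ge; rewrite -{1}ge -simplex_actM mulVg simplex_act1.
have -> : simplex_act (left_prod (map_tuple (@torus_SL2 A) h) j)^-1%g edge1 = edge1.
  apply: stabV; move: (nat_of_ord j); elim=> [|k IHk]; first exact: simplex_act1.
  rewrite left_prodS simplex_actM (_ : simplex_act (nth _ _ _) edge1 = edge1) //.
  case: (ltnP k n) => [lt_kn|le_nk]; last by rewrite nth_default ?simplex_act1 ?size_tuple.
  by rewrite -[k]/(nat_of_ord (Ordinal lt_kn)) -tnth_nth tnth_map torus_edge1.
rewrite /= (stabV _ (torus_edge1 _)) conj_stab; last first.
  exact: (@transportE SL2 (simplex A 1) (fun g => @simplex_act A g 1) (@simplex_act1 A 1)
    (edge0 A) (@edge0_trans A) edge1).
exact: in_torus_val.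
Qed.

Lemma PK_flip n (c : CT n) : PK n (shapiro_edge A n c) + PK n (flip_edge n c) = 0.
Proof.
have fB : zmod_morphism (fun c : CT n => PK n (shapiro_edge A n c) + PK n (flip_edge n c)).
  by move=> x y; exact: raddf_compDB.
apply: (int_ext (f := Additive fB) (h := \0)) => h.
have bE (e : CX 1 n) s : e = << X_gen s *g map_tuple (@torus_SL2 A) h >> ->
    PK n e = << gker_lift (@aug_partial A) (X_gen s) *g map_tuple (@torus_SL2 A) h >>.
  by move=> ->; apply: bmapU.
apply: etrans (congr2 +%R (bE _ _ (shapiro_edgeE h)) (bE _ _ (flip_edgeE h))) _.
apply: etrans (esym (raddfD (mkmalgU _) _ _)) _.
have L0 : gker_lift (@aug_partial A) (X_gen (edge0 A)) +
    gker_lift (@aug_partial A) (X_gen edge1) = 0.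
  apply: val_inj; have u12 := dt_e1e2 A; have u21 := u12; rewrite dt_unitC in u21.
  apply: etrans (congr2 +%R (etrans (congr1 _ (edge_edge0 A)) (partial_edge u12))
    (etrans (congr1 _ edge1E) (partial_edge u21))) _.
  by rewrite addrA subrK subrr.
exact: etrans (congr1 (mkmalgU _) L0) (raddf0 (mkmalgU _)).
Qed.

Lemma CX1_cyc2_torsion (x : CX 1 2%N) : cyc x ->
  PK 2 x *+ 2 \in bdry (bar_complex (K0 A)) 2.
Proof.
move=> /shapiro_edge_surj[c c0 /(cmap_bdryB PK) xc]; apply: bdry_mul2 xc _.
apply: bdry_opp_mul2 (PK_flip c) _.
have f0 : cyc (flip_edge 2 c) by apply: cmap_cyc.
have := unshapiro_edge_homologous f0; rewrite unshapiro_flip => h1.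
have h2 := cmap_bdryB (shapiro_edge A) (inv_cyc2 (@torus_mulC A) c0).
exact: (cmap_bdryB PK (bdry_trans h1 h2)).
Qed.

(** The cycle is homologous to the torus class of some a, and phi of its image is -2a. Hence 2a = 0,
    and twice that class bounds already in the torus. *)
Lemma CX1_cyc1_torsion (x : CX 1 1%N) : cyc x -> P0 1 x = 0 -> x *+ 2 \in bdry (CX 1) 1.
Proof.
move=> /torus_chain_gen[a xa] Px.
have a2 : a *+ 2 = 0.
  have := phi_bdry (cmap_bdry P0 xa); rewrite (raddfB (P0 1)) Px sub0r.
  by rewrite (raddfN (phi A)) phi_torus_chain opprK.
have t2 : torus_cycle a *+ 2 \in bdry CT 1.
  have := torus_homologous (torus_cycle a *+ 2).
  rewrite (raddfMn (chi_chain _)) chi_torus_cycle a2 => h.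
  by have := rpredD h (torus_cycle0 A); rewrite subrK.
apply: bdry_mul2 xa _; have := cmap_bdry (shapiro_edge A) t2.
by rewrite (raddfMn (shapiro_edge A 1)).
Qed.

Lemma K0_RP1 : universal_GE2_ring A ->
  exists f : {additive homology (bar_complex (K0 A)) 2 -> RP1 A},
  (forall x, f x = 0 -> x *+ 4 = 0) /\ (forall r, exists x, f x = r *+ 2).
Proof.
move=> univ.
have tor (x : CX 2 1%N) : cyc x -> x *+ 2 \in bdry (CX 2) 1.
  by apply: cyc1_torsion2; apply: stab_simplex2.
refine (connecting_map (eps_p := @aug_partial A) (@partial_partial A 0) (X1_exact univ) (X0_exact (universal_connected univ))
  tor CX1_cyc2_torsion CX1_cyc1_torsion).
Qed.

End FlippedEdge.

(** * Passage to coefficients in Z[1/2] *)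

Section CokerMap.
Variables (C D C' D' : complex) (f : cmap C D) (f' : cmap C' D') (a : cmap C C') (b : cmap D D').
Hypothesis baf : forall n c, b n (f n c) = f' n (a n c).

Fact coker_map_range n x : range (f n) x -> b n x \in zspan (range (f' n)).
Proof. by case=> c _ <-; apply/zspanP/zspan_gen; exists (a n c). Qed.

Definition coker_map n : {additive coker_complex f n -> coker_complex f' n} :=
  quot_map (@coker_map_range n).

Lemma coker_mapE n x : coker_map n (qpi (range (f n)) x) = qpi (range (f' n)) (b n x).
Proof. exact: quot_mapE. Qed.

Fact coker_map_bnd n c : bnd (coker_complex f') n (coker_map n.+1 c) =
  coker_map n (bnd (coker_complex f) n c).
Proof.
rewrite -[c]repr_qpi coker_mapE; move: (repr c) => d.
rewrite [bnd (coker_complex f') n _]quot_mapE [bnd (coker_complex f) n _]quot_mapE.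
by rewrite coker_mapE cmap_bnd.
Qed.

Definition coker_cmap : cmap (coker_complex f) (coker_complex f') := Cmap coker_map_bnd.

Hypothesis a_loc : forall n, localizes2 (a n).
Hypothesis b_loc : forall n, localizes2 (b n).

Lemma localizes2_coker_homology n : localizes2 (homology_map coker_cmap n).
Proof.
apply: localizes2_homology => m.
refine (localizes2_coker (h := @coker_map m) (@baf m) _ (a_loc m) (b_loc m)); exact: coker_mapE.
Qed.

End CokerMap.

Definition dyadic_coef (G : groupType) : gmor (trivmod G int) (trivmod G dyadic) :=
  @Gmor G (trivmod G int) (trivmod G dyadic) int_dyadic (fun _ _ => erefl).

Lemma localizes2_group_complex (G : groupType) n : localizes2 (bmap (dyadic_coef G) n).
Proof. by apply: localizes2_bmap => [x|]; [apply: int_dyadic_inj | apply: localizes2_int_dyadic]. Qed.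

Lemma bmap_dyadic_coef (G G' : groupType) (phi : UMagmaMorphism.type G' G) n
    (c : group_complex G' int n) :
  bmap (dyadic_coef G) n (group_cmap phi int n c) =
  group_cmap phi dyadic n (bmap (dyadic_coef G') n c).
Proof.
apply: (malg_ext (f := bmap (dyadic_coef G) n \o group_cmap phi int n)
  (h := group_cmap phi dyadic n \o bmap (dyadic_coef G') n)) => m g.
rewrite -[LHS]/(bmap (dyadic_coef G) n (group_cmap phi int n << m *g g >>)).
rewrite -[RHS]/(group_cmap phi dyadic n (bmap (dyadic_coef G') n << m *g g >>)).
rewrite [X in bmap _ _ X]bar_map_funU [LHS]bmapU.
by rewrite [X in group_cmap _ _ _ X]bmapU [RHS]bar_map_funU.
Qed.

(** Both sides localize the integral group H_3(SL_2(A), T(A)): one by change of coefficients on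
    chains, the other through the iterated connecting map followed by the tensor product. *)
Lemma torus_SL2_H3 (A : comUnitRingType)
    (TB : forall i : nat, (i <= 3)%N ->
       bijective (group_homology_map (@torus_borel A) int i)) :
  universal_GE2_ring A ->
  isomorphic (rel_homology (@torus_SL2 A) dyadic 3) (invert2 (RP1 A)).
Proof.
move=> univ.
have loc : localizes2 (homology_map (coker_cmap (@bmap_dyadic_coef _ _ (@torus_SL2 A))) 3).
  apply: localizes2_coker_homology => n; exact: localizes2_group_complex.
have [h [hV hK hVK]] := rel_homology_K0 (n := 1) isT TB.
have [f [f_ker f_coker]] := K0_RP1 univ.
apply: (localizes2_unique loc (v := @tensl _ _ dyadic_one \o (f \o h))).
apply: localizes2_comp (@localizes2_tens _) => [x /f_ker x4|y].
  (* The kernel is killed by 4 = 2^2. *)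
  by exists 2%N; apply: (can_inj hK); rewrite raddfMn x4 raddf0.
by have [x fx] := f_coker y; exists 1%N, (hV x); rewrite expn1 -fx /= hVK.
Qed.

Theorem theorem8p3 (A : comUnitRingType)
    (mu2 : forall a : A, a ^+ 2 = 1 -> a = 1 \/ a = -1)
    (TB : forall i : nat, (i <= 3)%N ->
       bijective (group_homology_map (@torus_borel A) int i))
    (H1 : forall x : group_homology (SL2 A) int 1, x = 0) :
  (GE2_ring A ->
     exists2 s : {additive K1M A -> I_mod_I2 A}, pfister_mod_spec s &
       isomorphic (rel_homology (@torus_SL2 A) int 2) (K1MW s))
  /\
  (universal_GE2_ring A ->
     isomorphic (rel_homology (@torus_SL2 A) dyadic 3) (invert2 (RP1 A))).
Proof.
by split=> [ge2|univ]; [apply: torus_SL2_H2 | apply: torus_SL2_H3].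
Qed.
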